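(* The mapping $$\mathrm{Sp}(1,1)/\mathrm{Sp}(1)I_2 \to \mathcal{M}(\mathbb{B}), \qquad A\,\mathrm{Sp}(1)I_2 \mapsto \mathcal{F}_{A^{-1}},$$ is a well defined bijection of sets. In particular, $\mathcal{M}(\mathbb{B})$ has a unique smooth manifold structure for which this bijection is a diffeomorphism (where $\mathrm{Sp}(1,1)/\mathrm{Sp}(1)I_2$ carries its quotient manifold structure). Furthermore, $\mathcal{M}(\mathbb{B})$ has dimension $7$ as a manifold for this structure.
   Context: $\mathbb{H}$ denotes the quaternions and $\mathbb{B}=\{q\in\mathbb{H}: |q|<1\}$. $\mathrm{Sp}(1,1)=\{A\in M_2(\mathbb{H}): A^*I_{1,1}A=I_{1,1}\}$ with $I_{1,1}=\operatorname{diag}(1,-1)$, a Lie group. $\mathrm{Sp}(1)=\{q\in\mathbb{H}:|q|=1\}$, and $\mathrm{Sp}(1)I_2=\{uI_2:u\in\mathrm{Sp}(1)\}$, a closed subgroup of $\mathrm{Sp}(1,1)$. The coset space $\mathrm{Sp}(1,1)/\mathrm{Sp}(1)I_2$ carries the unique manifold structure for which the quotient map from $\mathrm{Sp}(1,1)$ is a submersion. A function $f:\mathbb{B}\to\mathbb{H}$ is (left) slice regular if for every $I\in\mathbb{H}$ with $I^2=-1$ one has $\frac12\left(\frac{\partial}{\partial x}+I\frac{\partial}{\partial y}\right)f(x+Iy)=0$ whenever $x,y\in\mathbb{R}$, $x+yI\in\mathbb{B}$. Such functions have power series expansions $f(q)=\sum_n q^na_n$ on $\mathbb{B}$. For $f(q)=\sum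 q^na_n$ and $g(q)=\sum q^nb_n$, the $*$-product is $(f*g)(q)=\sum_n q^n\sum_{k=0}^n a_kb_{n-k}$; the regular conjugate is $f^c(q)=\sum q^n\overline{a_n}$; the symmetrization is $f^s=f*f^c$; the $*$-reciprocal is $f^{-*}(q)=f^s(q)^{-1}f^c(q)$ off the zero set of $f^s$. For $a,b\in\mathbb{H}$ let $l_{(a,b)}(q)=qa+b$. For $A=\begin{pmatrix}a&c\\ b&d\end{pmatrix}\in\mathrm{Sp}(1,1)$, the slice regular M\''obius transformation $\mathcal{F}_A:\mathbb{B}\to\mathbb{B}$ is $\mathcal{F}_A=l_{(c,d)}^{-*}*l_{(a,b)}$, written $\mathcal{F}_A(q)=(qc+d)^{-*}*(qa+b)$. Set $\mathcal{M}(\mathbb{B})=\{\mathcal{F}_A:A\in\mathrm{Sp}(1,1)\}$. (It is known that each $\mathcal{F}_A$ is a well defined slice regular bijection of $\mathbb{B}$ onto itself.) *)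

(* Defs.v *)
From HB Require Import structures.
From mathcomp Require Import all_boot all_order all_algebra.
From mathcomp Require Import ring lra.
From mathcomp Require Import all_classical all_reals all_analysis.

Set Implicit Arguments.
Unset Strict Implicit.
Unset Printing Implicit Defensive.

Import Order.TTheory GRing.Theory Num.Theory.
Import numFieldNormedType.Exports.

Local Open Scope classical_set_scope.
Local Open Scope ring_scope.

(* The row (a, b, c, d) is a + b i + c j + d k.  The alias inherits from R^4 its
   real vector space structure and its topology.  The norm `|q| inherited from
   row vectors is the sup norm; the quaternionic modulus is [qnorm]. *)
Definition quat (R : realType) : Type := 'rV[R]_4.

Section Quaternions.
Variable R : realType.
Implicit Types q r : quat R.

HB.instance Definition _ := NormedModule.copy (quat R) 'rV[R]_4.

Definition qcoord q (k : nat) : R := (q : 'rV[R]_4) ord0 (inord k).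

Definition mkquat (a b c d : R) : quat R := \row_(k < 4) [:: a; b; c; d]`_k.

Lemma qcoord_mk a b c d k : (k < 4)%N ->
  qcoord (mkquat a b c d) k = [:: a; b; c; d]`_k.
Proof. by move=> k4; rewrite /qcoord mxE inordK. Qed.

Lemma qcoordD q r k : qcoord (q + r) k = qcoord q k + qcoord r k.
Proof. by rewrite /qcoord mxE. Qed.

Lemma qcoordN q k : qcoord (- q) k = - qcoord q k.
Proof. by rewrite /qcoord mxE. Qed.

Lemma qcoordZ t q k : qcoord (t *: q) k = t * qcoord q k.
Proof. by rewrite /qcoord mxE. Qed.

Lemma qcoord0 k : qcoord 0 k = 0.
Proof. by rewrite /qcoord mxE. Qed.

Lemma quatP q r :
  qcoord q 0 = qcoord r 0 -> qcoord q 1 = qcoord r 1 ->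
  qcoord q 2 = qcoord r 2 -> qcoord q 3 = qcoord r 3 -> q = r.
Proof.
rewrite /qcoord => h0 h1 h2 h3; apply/rowP => i; rewrite -(inord_val i).
by case: i => -[|[|[|[|//]]]] /=.
Qed.

Definition qmul q r : quat R :=
  mkquat
    (qcoord q 0 * qcoord r 0 - qcoord q 1 * qcoord r 1
     - qcoord q 2 * qcoord r 2 - qcoord q 3 * qcoord r 3)
    (qcoord q 0 * qcoord r 1 + qcoord q 1 * qcoord r 0
     + qcoord q 2 * qcoord r 3 - qcoord q 3 * qcoord r 2)
    (qcoord q 0 * qcoord r 2 - qcoord q 1 * qcoord r 3
     + qcoord q 2 * qcoord r 0 + qcoord q 3 * qcoord r 1)
    (qcoord q 0 * qcoord r 3 + qcoord q 1 * qcoord r 2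
     - qcoord q 2 * qcoord r 1 + qcoord q 3 * qcoord r 0).

Lemma qmulA : associative qmul.
Proof. by move=> p q r; apply: quatP; rewrite !qcoord_mk //=; ring. Qed.

Lemma qmul1l : left_id (mkquat 1 0 0 0) qmul.
Proof. by move=> q; apply: quatP; rewrite !qcoord_mk //=; ring. Qed.

Lemma qmul1r : right_id (mkquat 1 0 0 0) qmul.
Proof. by move=> q; apply: quatP; rewrite !qcoord_mk //=; ring. Qed.

Lemma qmulDl : left_distributive qmul +%R.
Proof.
by move=> p q r; apply: quatP; rewrite qcoordD !qcoord_mk //= !qcoordD; ring.
Qed.

Lemma qmulDr : right_distributive qmul +%R.
Proof.
by move=> p q r; apply: quatP; rewrite qcoordD !qcoord_mk //= !qcoordD; ring.
Qed.

Lemma qone_neq0 : mkquat 1 0 0 0 != 0 :> quat R.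
Proof.
apply/eqP => /(congr1 (qcoord^~ 0%N)); rewrite qcoord_mk //= qcoord0.
by move/eqP; rewrite oner_eq0.
Qed.

HB.instance Definition _ := GRing.Zmodule_isNzRing.Build (quat R)
  qmulA qmul1l qmul1r qmulDl qmulDr qone_neq0.

Definition qconj q : quat R :=
  mkquat (qcoord q 0) (- qcoord q 1) (- qcoord q 2) (- qcoord q 3).

Definition qnorm2 q : R := \sum_(k < 4) qcoord q k ^+ 2.

Definition qnorm q : R := Num.sqrt (qnorm2 q).

Definition qinv q : quat R := (qnorm2 q)^-1 *: qconj q.

Lemma qnorm2E q : qnorm2 q =
  qcoord q 0 ^+ 2 + qcoord q 1 ^+ 2 + qcoord q 2 ^+ 2 + qcoord q 3 ^+ 2.
Proof. by rewrite /qnorm2 !big_ord_recl big_ord0 /= addr0 !addrA. Qed.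

Lemma qnorm2_eq0 q : (qnorm2 q == 0) = (q == 0).
Proof.
apply/eqP/eqP => [|->]; last first.
  by rewrite qnorm2E !qcoord0 expr0n /= !addr0.
rewrite qnorm2E => h.
have [h0 h1 h2 h3] : [/\ qcoord q 0 ^+ 2 = 0, qcoord q 1 ^+ 2 = 0,
    qcoord q 2 ^+ 2 = 0 & qcoord q 3 ^+ 2 = 0].
  have := sqr_ge0 (qcoord q 0); have := sqr_ge0 (qcoord q 1).
  have := sqr_ge0 (qcoord q 2); have := sqr_ge0 (qcoord q 3).
  by split; lra.
by apply: quatP; rewrite qcoord0; apply/eqP; rewrite -sqrf_eq0; apply/eqP.
Qed.

Lemma qmulE q r : q * r = qmul q r.
Proof. by []. Qed.

Lemma qinvZl q : q != 0 -> qinv q * q = 1.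
Proof.
rewrite -qnorm2_eq0 qmulE /qinv => q0.
apply: quatP; rewrite !(qcoord_mk, qcoordZ) //=; last 3 first.
- by ring.
- by ring.
- by ring.
by apply: (mulfI q0); move: q0; rewrite qnorm2E => q0; field.
Qed.

Lemma qinvZr q : q != 0 -> q * qinv q = 1.
Proof.
rewrite -qnorm2_eq0 qmulE /qinv => q0.
apply: quatP; rewrite !(qcoord_mk, qcoordZ) //=; last 3 first.
- by ring.
- by ring.
- by ring.
by apply: (mulfI q0); move: q0; rewrite qnorm2E => q0; field.
Qed.

Let qunitP q r : r * q = 1 /\ q * r = 1 -> q != 0.
Proof.
case=> rq _; apply/eqP => q0; move: rq; rewrite q0 mulr0 => /eqP.
by rewrite eq_sym oner_eq0.
Qed.

Let qinv_out : {in [predC [pred q | q != 0]], qinv =1 id}.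
Proof.
move=> q; rewrite inE /= negbK => /eqP ->.
by apply: quatP; rewrite !(qcoordZ, qcoord_mk) //= !qcoord0 ?oppr0 mulr0.
Qed.

HB.instance Definition _ := GRing.NzRing_hasMulInverse.Build (quat R)
  qinvZl qinvZr qunitP qinv_out.

Let qscaleAl t q r : t *: (q * r) = (t *: q) * r.
Proof.
by rewrite !qmulE; apply: quatP; rewrite qcoordZ !qcoord_mk //= !qcoordZ; ring.
Qed.

HB.instance Definition _ := GRing.Lmodule_isLalgebra.Build R (quat R) qscaleAl.

Let qscaleAr t q r : t *: (q * r) = q * (t *: r).
Proof.
by rewrite !qmulE; apply: quatP; rewrite qcoordZ !qcoord_mk //= !qcoordZ; ring.
Qed.

HB.instance Definition _ := GRing.Lalgebra_isAlgebra.Build R (quat R) qscaleAr.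

Lemma qconj_mull q : qconj q * q = (qnorm2 q)%:A.
Proof.
rewrite qmulE; apply: quatP; rewrite qcoordZ !qcoord_mk ?qnorm2E //=; ring.
Qed.

Lemma qconj_mulr q : q * qconj q = (qnorm2 q)%:A.
Proof.
rewrite qmulE; apply: quatP; rewrite qcoordZ !qcoord_mk ?qnorm2E //=; ring.
Qed.

Lemma qnorm2M q r : qnorm2 (q * r) = qnorm2 q * qnorm2 r.
Proof. by rewrite qmulE !qnorm2E !qcoord_mk //=; ring. Qed.

Lemma qnorm2_conj q : qnorm2 (qconj q) = qnorm2 q.
Proof. by rewrite !qnorm2E !qcoord_mk //=; ring. Qed.

Lemma qnorm2_ge0 q : 0 <= qnorm2 q.
Proof. by apply: sumr_ge0 => k _; exact: sqr_ge0. Qed.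

Lemma qalg_inj (x y : R) : x%:A = y%:A :> quat R -> x = y.
Proof.
by move/(congr1 (qcoord^~ 0%N)); rewrite !qcoordZ !qcoord_mk //= !mulr1.
Qed.

Lemma qconj0 : qconj 0 = 0.
Proof. by apply: quatP; rewrite qcoord_mk //= !qcoord0 ?oppr0. Qed.

Lemma qconj1 : qconj 1 = 1.
Proof. by apply: quatP; rewrite !qcoord_mk //= oppr0. Qed.

Lemma qconjN q : qconj (- q) = - qconj q.
Proof. by apply: quatP; rewrite qcoordN !qcoord_mk //= !qcoordN. Qed.

Lemma qconjM q r : qconj (q * r) = qconj r * qconj q.
Proof. by rewrite !qmulE; apply: quatP; rewrite !qcoord_mk //=; ring. Qed.

Lemma qconjD q r : qconj (q + r) = qconj q + qconj r.
Proof.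
by apply: quatP; rewrite qcoordD !qcoord_mk //= !qcoordD ?opprD.
Qed.

Lemma qconjK : involutive qconj.
Proof. by move=> q; apply: quatP; rewrite !qcoord_mk //= !opprK. Qed.

End Quaternions.

(* Slice regular functions on the unit ball are represented by total functions
   H -> H, of which only the values on the ball matter; they are handled through
   their (unique) power series expansion sum_n q^n a_n on the ball. *)
Section SliceRegular.
Variable R : realType.
Implicit Types (f g : quat R -> quat R) (s t : nat -> quat R).

Definition pseries_terms s (q : quat R) : nat -> quat R := fun n => q ^+ n * s n.

Definition has_expansion f s := forall q, qnorm q < 1 ->
  series (pseries_terms s q) @ \oo --> f q.

Definition pseries_sum s (q : quat R) : quat R :=
  lim (series (pseries_terms s q) @ \oo).

(* Junk value 0 when [f] has no power series expansion on the ball. *)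
Definition expansion f : nat -> quat R := xget (fun=> 0) (has_expansion f).

Definition star f g : quat R -> quat R :=
  pseries_sum (fun n => \sum_(k < n.+1) expansion f k * expansion g (n - k)%N).

Definition regular_conj f : quat R -> quat R :=
  pseries_sum (fun n => qconj (expansion f n)).

Definition symmetrization f : quat R -> quat R := star f (regular_conj f).

(* Meaningful off the zero set of the symmetrization ([0^-1 = 0]). *)
Definition star_inv f : quat R -> quat R :=
  fun q => (symmetrization f q)^-1 * regular_conj f q.

Definition affine (a b : quat R) : quat R -> quat R := fun q => q * a + b.

Definition ball1 : Type := {q : quat R | qnorm q < 1}.

End SliceRegular.

Section Sp11.
Variable R : realType.
Implicit Types A B : 'M[quat R]_2.

Definition I11 : 'M[quat R]_2 := diag_mx (\row_j (-1) ^+ j).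

Definition ctrmx A : 'M[quat R]_2 := map_mx (@qconj R) A^T.

Definition is_sp11 A : bool := ctrmx A *m I11 *m A == I11.

Definition sp11 : Type := {A : 'M[quat R]_2 | is_sp11 A}.

HB.instance Definition _ := Choice.on sp11.

Lemma I11K : I11 *m I11 = 1%:M.
Proof.
rewrite /I11 mulmx_diag -diag_const_mx; congr diag_mx; apply/rowP => j.
by rewrite !mxE -exprD addnn -mul2n exprM sqrrN expr1n expr1n.
Qed.

Lemma ctrmxM A B : ctrmx (A *m B) = ctrmx B *m ctrmx A.
Proof.
apply/matrixP => i j; rewrite !mxE.
rewrite (big_morph (@qconj R) (@qconjD R) (@qconj0 R)).
by apply: eq_bigr => k _; rewrite qconjM !mxE.
Qed.

Lemma ctrmxK A : ctrmx (ctrmx A) = A.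
Proof. by apply/matrixP => i j; rewrite !mxE qconjK. Qed.

Lemma ctrmx_I11 : ctrmx I11 = I11.
Proof.
apply/matrixP => i j; rewrite !mxE eq_sym; case: eqP => [->|_] /=; last first.
  by rewrite !mulr0n qconj0.
rewrite !mulr1n; case: j => [[|[|//]]] ? /=; first by rewrite expr0 qconj1.
by rewrite expr1 qconjN qconj1.
Qed.

Let ord2P (P : 'I_2 -> Prop) : P 0 -> P 1 -> forall i, P i.
Proof.
move=> P0 P1 [[|[|//]] ilt].
  by rewrite (_ : Ordinal ilt = 0) //; exact: val_inj.
by rewrite (_ : Ordinal ilt = 1) //; exact: val_inj.
Qed.

Let formE A B i j :
  (A *m I11 *m B) i j = A i 0 * B 0 j - A i 1 * B 1 j.
Proof.
rewrite mxE !big_ord_recl big_ord0 addr0 /= mul_mx_diag !mxE /=.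
rewrite expr0 expr1 mulr1 mulrN1 mulNr.
by rewrite (_ : lift ord0 ord0 = 1) //; exact: val_inj.
Qed.

Lemma is_sp11_ctr A : is_sp11 A -> A *m I11 *m ctrmx A = I11.
Proof.
move=> /eqP AIA.
have e00 := congr1 (fun M : 'M[quat R]_2 => M 0 0) AIA.
have e01 := congr1 (fun M : 'M[quat R]_2 => M 0 1) AIA.
have e11 := congr1 (fun M : 'M[quat R]_2 => M 1 1) AIA.
move: e00 e01 e11; rewrite !formE !mxE /= !mulr1n mulr0n expr0 expr1.
set a := A 0 0; set c := A 0 1; set b := A 1 0; set d := A 1 1.
rewrite !qconj_mull => e00 /subr0_eq e01 e11.
have n0 : qnorm2 a - qnorm2 b = 1 by apply: qalg_inj; rewrite scalerBl scale1r.
have n1 : qnorm2 c - qnorm2 d = -1.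
  by apply: qalg_inj; rewrite scalerBl scaleN1r.
have n2 : qnorm2 a * qnorm2 c = qnorm2 b * qnorm2 d.
  by rewrite -(qnorm2_conj a) -(qnorm2_conj b) -!qnorm2M e01.
have nbc : qnorm2 b = qnorm2 c by nra.
have nad : qnorm2 a = qnorm2 d by lra.
have a_gt0 : 0 < qnorm2 a by have := qnorm2_ge0 b; lra.
have abcd : a * qconj b = c * qconj d.
  apply: (scalerI (lt0r_neq0 a_gt0)).
  transitivity (a * (qconj b * d) * qconj d).
    by rewrite -!mulrA qconj_mulr -nad !mulr_algr -scalerAr.
  by rewrite -e01 mulrA qconj_mulr mulr_algl -scalerAl.
apply/matrixP; apply: ord2P; apply: ord2P; rewrite formE !mxE /=.
- by rewrite !qconj_mulr -nbc -scalerBl n0 scale1r.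
- by rewrite abcd subrr.
- by have := congr1 (@qconj R) abcd; rewrite !qconjM !qconjK => ->; rewrite subrr.
- by rewrite !qconj_mulr nbc -scalerBl n1 scaleN1r expr1.
Qed.

Lemma is_sp11_1 : is_sp11 1%:M.
Proof.
rewrite /is_sp11 mulmx1 (_ : ctrmx 1%:M = 1%:M) ?mul1mx //.
apply/matrixP => i j; rewrite !mxE eq_sym.
by case: eqP => _; rewrite ?qconj1 ?qconj0.
Qed.

Lemma is_sp11M A B : is_sp11 A -> is_sp11 B -> is_sp11 (A *m B).
Proof.
move=> /eqP hA /eqP hB; rewrite /is_sp11 ctrmxM.
have -> : ctrmx B *m ctrmx A *m I11 *m (A *m B) =
    ctrmx B *m (ctrmx A *m I11 *m A) *m B by rewrite !mulmxA.
by rewrite hA hB.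
Qed.

Lemma is_sp11V A : is_sp11 A -> is_sp11 (I11 *m ctrmx A *m I11).
Proof.
move=> hA; rewrite /is_sp11 !ctrmxM ctrmx_I11 ctrmxK.
have -> : I11 *m (A *m I11) *m I11 *m (I11 *m ctrmx A *m I11) =
    I11 *m (A *m (I11 *m I11 *m I11) *m ctrmx A) *m I11 by rewrite !mulmxA.
by rewrite I11K mul1mx is_sp11_ctr // I11K mul1mx.
Qed.

Definition sp11_one : sp11 := exist _ 1%:M is_sp11_1.

Definition sp11_mul (A B : sp11) : sp11 :=
  exist _ (val A *m val B) (is_sp11M (valP A) (valP B)).

Definition sp11_inv (A : sp11) : sp11 :=
  exist _ (I11 *m ctrmx (val A) *m I11) (is_sp11V (valP A)).

Let sp11_mulA : associative sp11_mul.
Proof. by move=> A B C; apply: val_inj; rewrite /= mulmxA. Qed.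

Let sp11_mul1 : left_id sp11_one sp11_mul.
Proof. by move=> A; apply: val_inj; rewrite /= mul1mx. Qed.

Let sp11_1mul : right_id sp11_one sp11_mul.
Proof. by move=> A; apply: val_inj; rewrite /= mulmx1. Qed.

Let sp11_mulV : left_inverse sp11_one sp11_inv sp11_mul.
Proof.
move=> A; apply: val_inj => /=; have /eqP hA := valP A.
by rewrite -!mulmxA (mulmxA (ctrmx _)) hA I11K.
Qed.

Let sp11_Vmul : right_inverse sp11_one sp11_inv sp11_mul.
Proof.
move=> A; apply: val_inj => /=.
by rewrite !mulmxA is_sp11_ctr ?I11K //; exact: valP.
Qed.

HB.instance Definition _ := isGroup.Build sp11
  sp11_mulA sp11_mul1 sp11_1mul sp11_mulV sp11_Vmul.

Definition sp1I : set sp11 :=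
  [set B | exists2 u : quat R, qnorm u = 1 & val B = u%:M].

Definition left_coset (A : sp11) : set sp11 := [set (A * B)%g | B in sp1I].

Definition coset_space : Type :=
  {C : set sp11 | exists A : sp11, C = left_coset A}.

Definition coset_proj (A : sp11) : coset_space :=
  exist _ (left_coset A) (ex_intro _ A erefl).

(* Convention: A has rows (a, c) and (b, d). *)
Definition mobius (A : sp11) : quat R -> quat R :=
  let: (a, c, b, d) := (val A 0 0, val A 0 1, val A 1 0, val A 1 1) in
  star (star_inv (affine c d)) (affine a b).

(* [mobius A] is a function on H; M(B) consists of self-maps of the ball. *)
Definition mobius_set : Type :=
  {F : ball1 R -> ball1 R |
    exists A : sp11, forall q, sval (F q) = mobius A (sval q)}.

(* The inclusion of Sp(1,1) in M_2(H), identified with the real normed space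
   H^4 since matrices over [quat R] carry no such structure. *)
Definition sp11_entries (A : sp11) : quat R * quat R * quat R * quat R :=
  (val A 0 0, val A 0 1, val A 1 0, val A 1 1).

End Sp11.

Section Smooth.
Variables (R : realType) (V W : normedModType R).

(* C^oo on an open set U: all iterated directional derivatives of f are
   (Frechet) differentiable on U. *)
Definition smooth_on (U : set V) (f : V -> W) : Prop :=
  forall (vs : seq V) (x : V), U x ->
    differentiable (foldr (fun v g => 'D_v g) f vs) x.

End Smooth.

(* The values of [chart_map] outside [chart_dom] are irrelevant. *)
Record chart (R : realType) (X : Type) (n : nat) := Chart {
  chart_dom : set X;
  chart_map :> X -> 'rV[R]_n
}.

Definition is_chart R X n (c : chart R X n) : Prop :=
  open (c @` chart_dom c) /\ set_inj (chart_dom c) c.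

Section CoordinateRepresentation.
Variables (R : realType) (X Y : Type) (m n : nat).
Variables (f : X -> Y) (c : chart R X m) (d : chart R Y n).

Definition coord_dom : set 'rV[R]_m :=
  c @` (chart_dom c `&` f @^-1` chart_dom d).

(* [g] is d o f o c^-1 on its (open) domain, and is smooth there. *)
Definition smooth_coord_rep (g : 'rV[R]_m -> 'rV[R]_n) : Prop :=
  [/\ open coord_dom, smooth_on coord_dom g &
      forall x, chart_dom c x -> chart_dom d (f x) -> g (c x) = d (f x)].

End CoordinateRepresentation.

Definition compatible R X n (c d : chart R X n) : Prop :=
  (exists g, smooth_coord_rep id c d g) /\ (exists g, smooth_coord_rep id d c g).

Definition atlas_open R X n (At : set (chart R X n)) (U : set X) : Prop :=
  forall c, At c -> open (c @` (chart_dom c `&` U)).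

(* A smooth manifold structure on the set X, of pure dimension [mdim]: a maximal
   smooth atlas whose topology ([atlas_open]) is Hausdorff and second countable.
   Two charts with the same domain and the same values on it belong to the same
   maximal atlases, so [=] on [manifold R X] is the usual equality of smooth
   structures. *)
Record manifold (R : realType) (X : Type) := Manifold {
  mdim : nat;
  atlas : set (chart R X mdim);
  atlas_chart : forall c, atlas c -> is_chart c;
  atlas_cover : forall x, exists2 c, atlas c & chart_dom c x;
  atlas_compatible : forall c d, atlas c -> atlas d -> compatible c d;
  atlas_maximal : forall c, is_chart c ->
    (forall d, atlas d -> compatible c d) -> atlas c;
  atlas_hausdorff : forall x y, x <> y ->
    exists U V : set X, [/\ atlas_open atlas U, atlas_open atlas V,
                            U x, V y & U `&` V = set0];
  atlas_second_countable : exists B : nat -> set X,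
    (forall i, atlas_open atlas (B i)) /\
    (forall U x, atlas_open atlas U -> U x -> exists i, B i x /\ B i `<=` U)
}.

Arguments mdim {R X} m.
Arguments atlas {R X} m.

Section SmoothMaps.
Variables (R : realType) (X Y : Type).
Variables (M : manifold R X) (N : manifold R Y).

Definition smooth_map (f : X -> Y) : Prop :=
  forall c d, atlas M c -> atlas N d -> exists g, smooth_coord_rep f c d g.

Definition submersion (f : X -> Y) : Prop :=
  smooth_map f /\
  forall c d g, atlas M c -> atlas N d -> smooth_coord_rep f c d g ->
    forall u, coord_dom f c d u -> set_surj setT setT ('d g u).

End SmoothMaps.

Definition diffeomorphism R X Y (M : manifold R X) (N : manifold R Y)
    (f : X -> Y) : Prop :=
  smooth_map M N f /\
  exists h, [/\ cancel f h, cancel h f & smooth_map N M h].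

(* Let e : X -> V be injective.  The charts of X as a submanifold of V are the
   diffeomorphisms c from a relatively open part of X onto an open subset of R^n:
   the inverse of c is smooth as a map to V, and c is locally the restriction of
   a smooth map defined on an open subset of V. *)
Definition euclidean_chart (R : realType) (V : normedModType R) (X : Type)
    (e : X -> V) n (c : chart R X n) : Prop :=
  [/\ exists2 O : set V, open O & chart_dom c = e @^-1` O,
      is_chart c,
      exists2 g : 'rV[R]_n -> V, smooth_on (c @` chart_dom c) g &
        forall x, chart_dom c x -> g (c x) = e x &
      forall x, chart_dom c x -> exists (O : set V) (h : V -> 'rV[R]_n),
        [/\ open O, O (e x), smooth_on O h &
            forall y, chart_dom c y -> O (e y) -> h (e y) = c y]].

Definition submanifold (R : realType) (V : normedModType R) (X : Type)
    (e : X -> V) (M : manifold R X) : Prop :=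
  atlas M = [set c | euclidean_chart e c].

(* The Lie group structure of the closed subgroup Sp(1,1) of GL_2(H) is that of
   an embedded submanifold of M_2(H). *)
Definition lie_structure (R : realType) (G : manifold R (sp11 R)) : Prop :=
  submanifold (@sp11_entries R) G.

(* Main.v *)
Require Import Defs.
From HB Require Import structures.
From mathcomp Require Import all_boot all_order all_algebra.
From mathcomp Require Import ring lra.
From mathcomp Require Import all_classical all_reals all_analysis.

Set Implicit Arguments.
Unset Strict Implicit.
Unset Printing Implicit Defensive.

Import Order.TTheory GRing.Theory Num.Theory.
Import numFieldNormedType.Exports.

Local Open Scope classical_set_scope.
Local Open Scope ring_scope.

(** The map is well defined and bijective because of the coefficients of the
    transformations. If [|c| < |d|], put [p = - d^-1 c]. The *-reciprocal of
    [q c + d] has the expansion [sum_n q^n p^n d^-1], and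
    [sum_n q^n p^n = (1 - T p)^-1] where [T = y^-1 q y] and [y = 1 - q p^c] with
    [p^c] the conjugate of [p] ([cvg_geometric_twist], [star_inv_affine]). It
    follows that
      [F_A q = (1 + T d^-1 c)^-1 (d^-1 b + T d^-1 a)],
    and the relations between the entries of a matrix in Sp(1,1) turn this into
    [|F_A q| < 1] ([mobius_value], [mobius_ball]). The coefficients of [F_A] involve
    only [d^-1 a], [d^-1 b] and [d^-1 c], so [F_A] does not change when [A] is
    multiplied by Sp(1) on the left ([mobius_sp1I]). Conversely power series
    expansions are unique ([has_expansion_unique]) and those of degree 0, 1 and 2
    determine [A] up to such a factor ([mobius_inj]). Passing to inverses turns left
    factors into right ones, that is, into cosets.

    For the manifolds everything is explicit. A matrix in Sp(1,1) is determined by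
    [c d^-1], which runs through the open ball, and by [a d^-1] and [d / |d|], which
    run through the unit sphere; the first two are coordinates on the coset space.
    With Cayley transforms as charts of the sphere, Sp(1,1) and its coset space become
    embedded submanifolds of H^4 and H^2, of dimensions 10 and 7. A general theorem
    ([embedded_manifold]) makes manifolds of them, and a map between submanifolds is
    smooth as soon as it extends to a smooth map of the ambient spaces. The projection
    is a submersion since there is a smooth section through every point
    ([coset_section], [submersion_of_sections]).

    An arbitrary manifold structure for which the projection is a submersion also has
    dimension 7 ([submersion_mdim]). Indeed a smooth section for the explicit
    structure, followed by the projection, reads in charts as an injective smooth map
    with surjective differential, and such a map cannot lower the dimension: near any
    point the fibre of a smooth map with surjective differential and nontrivial kernel
    contains other points ([submersion_fibre]). Finally a manifold structure can be
    transported along a bijection, and maximality of atlases makes the result unique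
    ([transported_manifold], [diffeomorphism_unique]). *)

(** * Iterated differentiability *)

Section Locality.
Variables (R : realType) (V W : normedModType R).
Implicit Types (f g : V -> W).

Lemma differentiable_expansion f (L : {linear V -> W}) x : continuous L ->
  f \o shift x = cst (f x) + L +o_ 0 id -> differentiable f x.
Proof. by move=> cL fL; apply/diff_locallyP; rewrite (diff_unique cL fL). Qed.

(** The difference [g - f] vanishes near [x], so it has the zero map as
    differential there. *)
Lemma near_eq_differentiable f g x :
  (\near x, f x = g x) -> differentiable f x -> differentiable g x.
Proof.
move=> fg df.
have -> : g = f + (g - f) by apply/funext => y; rewrite !fctE addrC subrK.
apply: differentiableD => //.
set h := g - f.
have h0 : \near x, h x = 0.
  by near=> y; rewrite /h !fctE (near fg y) // subrr.
have hx : h x = 0 by exact: nbhs_singleton h0.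
apply: (@differentiable_expansion _ \0); first exact: cst_continuous.
apply/eqaddoP => _/posnumP[e]; near=> y.
have -> : (h \o +%R^~ x - (cst (h x) + \0)) y = h (y + x) - (h x + 0) by [].
rewrite (_ : h (y + x) = 0) ?hx ?addr0 ?subr0 ?normr0 ?mulr_ge0 //.
near: y; have := h0; rewrite (near_shift 0 x).
by apply: filterS => y /=; rewrite subr0.
Unshelve. all: by end_near. Qed.

End Locality.

Section IteratedDifferentiability.
Variable R : realType.

(** The order of differentiation is made explicit so that closure properties
    can be proved by induction on it; smoothness is the conjunction over all
    orders. *)
Fixpoint times_differentiable (V W : normedModType R) (k : nat) (U : set V)
    (f : V -> W) : Prop :=
  (forall x, U x -> differentiable f x) /\
  if k is k'.+1 then forall v, times_differentiable k' U ('D_v f) else True.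

Lemma smooth_onP (V W : normedModType R) (U : set V) (f : V -> W) :
  smooth_on U f <-> forall k, times_differentiable k U f.
Proof.
split=> [sf k|sf vs x Ux].
  elim: k f sf => [|k IH] f sf; split => //; try exact: (sf [::]).
  by move=> v; apply: IH => vs x Ux; have := sf (rcons vs v) x Ux; rewrite foldr_rcons.
move: (sf (size vs)); elim/last_ind: vs f {sf} => [|vs v IH] f.
  by case=> + _; apply.
by rewrite size_rcons foldr_rcons => -[_ sf]; exact: IH (sf v).
Qed.

Section OneDomain.
Variables (V : normedModType R) (U : set V).
Hypothesis oU : open U.

Lemma near_on (P : V -> Prop) x : U x -> (forall y, U y -> P y) -> \near x, P x.
Proof. by move=> Ux UP; near=> y; apply: UP; near: y; exact: open_nbhs_nbhs. 
Unshelve. all: by end_near. Qed.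

Variables W : normedModType R.
Implicit Types (f g : V -> W).

Lemma times_differentiableW k f : times_differentiable k.+1 U f -> times_differentiable k U f.
Proof.
elim: k f => [|k IH] f [df kf]; split => // v.
by apply: IH; exact: kf.
Qed.

Lemma times_differentiable_eq k f g : (forall x, U x -> f x = g x) ->
  times_differentiable k U f -> times_differentiable k U g.
Proof.
elim: k f g => [|k IH] f g fg [df kf];
  (split; first by move=> x Ux; apply: near_eq_differentiable (df _ Ux); exact: near_on) => // v.
by apply: IH (kf v) => x Ux; apply: near_eq_derive; exact: near_on.
Qed.

Lemma times_differentiable_cst k (w : W) : times_differentiable k U (cst w).
Proof.
elim: k w => [|k IH] w; (split; first by move=> x Ux; exact: differentiable_cst) => // v.
by apply: times_differentiable_eq (IH 0) => x _ /=; rewrite derive_cst.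
Qed.

Lemma times_differentiableD k f g : times_differentiable k U f ->
  times_differentiable k U g -> times_differentiable k U (fun x => f x + g x).
Proof.
rewrite -[fun x => _]/(f + g).
elim: k f g => [|k IH] f g [df kf] [dg kg];
  (split; first by move=> x Ux; apply: differentiableD; auto) => // v.
apply: times_differentiable_eq (IH _ _ (kf v) (kg v)) => x Ux.
by rewrite deriveD //; apply: diff_derivable; auto.
Qed.

Lemma times_differentiable_sum k n (f : 'I_n -> V -> W) :
  (forall i, times_differentiable k U (f i)) ->
  times_differentiable k U (fun x => \sum_(i < n) f i x).
Proof.
elim: n f => [|n IH] f kf.
  apply: times_differentiable_eq (times_differentiable_cst k 0) => x _.
  by rewrite big_ord0.
apply: (@times_differentiable_eq _ (fun x => f ord0 x + \sum_(i < n) f (lift ord0 i) x)).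
  by move=> x _; rewrite big_ord_recl.
by apply: times_differentiableD; [exact: kf|apply: IH => i; exact: kf].
Qed.

End OneDomain.

Lemma times_differentiable_linear (V W : normedModType R) (U : set V)
    (oU : open U) (Z : normedModType R) (L : {linear W -> Z}) k
    (f : V -> W) :
  continuous L -> times_differentiable k U f ->
  times_differentiable k U (fun x => L (f x)).
Proof.
move=> cL; have dL y : differentiable L y by exact: linear_differentiable.
elim: k f => [|k IH] f [df kf];
  (split; first by move=> x Ux; apply: differentiable_comp => //; exact: df) => // v.
apply: (times_differentiable_eq oU) (IH _ (kf v)) => x Ux.
have dfx := df x Ux.
rewrite deriveE // deriveE; last by apply: differentiable_comp.
by rewrite -[fun x => L (f x)]/(L \o f) (diff_comp dfx (dL (f x))) /= diff_lin.
Qed.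

Section RealValued.
Variables (V : normedModType R) (U : set V).
Hypothesis oU : open U.
Implicit Types (f g : V -> R).

Lemma times_differentiableM k f g : times_differentiable k U f ->
  times_differentiable k U g -> times_differentiable k U (fun x => f x * g x).
Proof.
elim: k f g => [|k IH] f g hf hg; have [df kf] := hf; have [dg kg] := hg;
  (split; first by move=> x Ux; apply: (@differentiableM R V f g x);
    [exact: df|exact: dg]) => // v.
apply: (times_differentiable_eq oU (f := fun x => f x * 'D_v g x + g x * 'D_v f x)).
  move=> x Ux; have dfx := df x Ux; have dgx := dg x Ux.
  by rewrite -[fun y => f y * g y]/(f * g) (deriveM (diff_derivable dfx) (diff_derivable dgx)).
have hf' := times_differentiableW hf; have hg' := times_differentiableW hg.
exact: (times_differentiableD oU (IH _ _ hf' (kg v)) (IH _ _ hg' (kf v))).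
Qed.

Lemma times_differentiableV k f : (forall x, U x -> f x != 0) ->
  times_differentiable k U f -> times_differentiable k U (fun x => (f x)^-1).
Proof.
move=> f0; elim: k => [|k IH] hf; have [df kf] := hf;
  (split; first by move=> x Ux; apply: differentiableV; [exact: df|exact: f0]) => // v.
pose g x := - 1 * ((f x)^-1 * (f x)^-1) * 'D_v f x.
have fV := IH (times_differentiableW hf).
apply: (times_differentiable_eq oU (f := g)).
  move=> x Ux; rewrite deriveV /g ?f0 //; last by apply: diff_derivable; exact: df.
  by rewrite mulN1r -expr2 exprVn.
have c1 := times_differentiable_cst oU k (- 1 : R).
have h1 := times_differentiableM fV fV.
have h2 := times_differentiableM c1 h1.
exact: (times_differentiableM h2 (kf v)).
Qed.

Lemma times_differentiable_sqrt k f : (forall x, U x -> 0 < f x) ->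
  times_differentiable k U f ->
  times_differentiable k U (fun x => Num.sqrt (f x)).
Proof.
move=> f0.
have dsqrt x : U x -> is_diff (f x) (@Num.sqrt R) ( *:%R^~ (2 * Num.sqrt (f x))^-1).
  move=> Ux; have [h1 h2] := is_derive1_sqrt (f0 x Ux).
  have h : differentiable (@Num.sqrt R) (f x) by apply/derivable1_diffP.
  apply: DiffDef => //; rewrite diff1E //.
  by apply/funext => y /=; rewrite derive1E h2.
elim: k => [|k IH] hf; have [df kf] := hf;
  (split; first by move=> x Ux; have [? _] := dsqrt x Ux;
    apply: (@differentiable_comp _ _ _ _ f (@Num.sqrt R)) => //; exact: df) => // v.
have fV := IH (times_differentiableW hf).
apply: (times_differentiable_eq oU (f := fun x => 'D_v f x * (2 * Num.sqrt (f x))^-1)).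
  move=> x Ux; have [ds e] := dsqrt x Ux; have dfx := df x Ux.
  rewrite (deriveE _ dfx) (deriveE _ (differentiable_comp dfx ds)).
  transitivity ('d Num.sqrt (f x) ('d f x v)).
    exact: esym (congr1 (@^~ ('d f x v)) e).
  exact: esym (congr1 (@^~ v) (diff_comp dfx ds)).
have c2 := times_differentiable_cst oU k (2 : R).
have h0 x : U x -> 2 * Num.sqrt (f x) != 0.
  by move=> Ux; rewrite mulf_neq0 // gt_eqF // sqrtr_gt0 f0.
have h1 := times_differentiableV h0 (times_differentiableM c2 fV).
exact: (times_differentiableM (kf v) h1).
Qed.

End RealValued.

(** Finite dimension in the form used by the chain rule, where a derivative along
    [w] is expanded into derivatives along the [e i]; products inherit it. *)
Definition finite_coordinates (W : normedModType R) : Prop :=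
  exists n (e : 'I_n -> W) (l : 'I_n -> {linear W -> R^o}),
    (forall i, continuous (l i)) /\ forall w, w = \sum_i (l i w : R) *: e i.

Section Coordinates.
Variables (V : normedModType R) (U : set V).
Hypothesis oU : open U.

Lemma times_differentiable_scaler (W : normedModType R) k (f : V -> R) (w : W) :
  times_differentiable k U f -> times_differentiable k U (fun x => f x *: w).
Proof.
have sl : linear (fun t : R^o => t *: w).
  by move=> a b c; rewrite scalerDl scalerA.
pose L : {linear R^o -> W} :=
    HB.pack (fun t : R^o => t *: w) (GRing.isLinear.Build _ _ _ _ _ sl).
by apply: (times_differentiable_linear oU (L := L)); exact: scalel_continuous.
Qed.

Lemma times_differentiableZ (W : normedModType R) k (f : V -> R) (g : V -> W) :
  finite_coordinates W ->
  times_differentiable k U f -> times_differentiable k U g ->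
  times_differentiable k U (fun x => f x *: g x).
Proof.
move=> [n [e [l [cl eW]]]] kf kg.
apply: (times_differentiable_eq oU (f := fun x => \sum_i (f x * l i (g x)) *: e i)).
  by move=> x _; rewrite [in RHS](eW (g x)) scaler_sumr; apply: eq_bigr => i _; rewrite scalerA.
apply: times_differentiable_sum => // i; apply: times_differentiable_scaler.
apply: times_differentiableM => //.
exact: times_differentiable_linear.
Qed.

(** The derivative of [g \o f] along [v] is the combination of the partial
    derivatives of [g] at [f x] with the coordinates of ['D_v f x] as
    coefficients, so the order goes down by one and the induction goes on. *)
Lemma times_differentiable_comp (W Z : normedModType R) (O : set W) k
    (f : V -> W) (g : W -> Z) :
  finite_coordinates W -> finite_coordinates Z ->
  open O -> (forall x, U x -> O (f x)) ->
  times_differentiable k U f -> times_differentiable k O g ->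
  times_differentiable k U (fun x => g (f x)).
Proof.
move=> fW fZ oO UO; have [n [e [l [cl eW]]]] := fW.
elim: k g => [|k IH] g hf hg; have [df kf] := hf; have [dg kg] := hg;
  (split; first by move=> x Ux; apply: differentiable_comp;
    [exact: df|exact: dg (UO x Ux)]) => // v.
pose h x := \sum_i (l i ('D_v f x) : R) *: 'D_(e i) g (f x).
apply: (times_differentiable_eq oU (f := h)) => [x Ux|].
  have dfx := df x Ux; have dgx := dg _ (UO _ Ux).
  have -> : 'D_v (fun x => g (f x)) x = 'd g (f x) ('D_v f x).
    rewrite (deriveE _ dfx) (deriveE _ (differentiable_comp dfx dgx)).
    by rewrite (diff_comp dfx dgx).
  rewrite [in RHS](eW ('D_v f x)) linear_sum /h; apply: eq_bigr => i _.
  by rewrite linearZ (deriveE _ dgx).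
apply: times_differentiable_sum => // i; apply: times_differentiableZ => //.
  exact: (times_differentiable_linear oU (cl i) (kf v)).
exact: (IH _ (times_differentiableW hf) (kg (e i))).
Qed.

End Coordinates.
End IteratedDifferentiability.

(** * Smooth functions *)

Section SmoothCalculus.
Variables (R : realType) (V : normedModType R).
Implicit Types U : set V.

Lemma smooth_on_subset (W : normedModType R) U U' (f : V -> W) :
  U' `<=` U -> smooth_on U f -> smooth_on U' f.
Proof. by move=> UU' sf vs x U'x; apply: sf; exact: UU'. Qed.

Lemma smooth_on_differentiable (W : normedModType R) U (f : V -> W) :
  smooth_on U f -> forall x, U x -> differentiable f x.
Proof. by move=> sf x Ux; exact: (sf [::]). Qed.

Lemma smooth_on_derive (W : normedModType R) U (f : V -> W) v :
  smooth_on U f -> smooth_on U ('D_v f).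
Proof. by move=> sf vs x Ux; have := sf (rcons vs v) x Ux; rewrite foldr_rcons. Qed.

Lemma smooth_on_continuous (W : normedModType R) U (f : V -> W) :
  smooth_on U f -> forall x, U x -> {for x, continuous f}.
Proof. by move=> sf x Ux; apply: differentiable_continuous; exact: (sf [::]). Qed.

Lemma smooth_on_eq (W : normedModType R) U (f g : V -> W) :
  open U -> (forall x, U x -> f x = g x) -> smooth_on U f -> smooth_on U g.
Proof.
move=> oU fg /smooth_onP sf; apply/smooth_onP => k.
exact: times_differentiable_eq (sf k).
Qed.

Lemma smooth_on_local (W : normedModType R) U (f : V -> W) :
  (forall x, U x -> exists O g, [/\ open O, O x, smooth_on O g &
     forall y, O y -> f y = g y]) -> smooth_on U f.
Proof.
move=> loc vs x /loc [B [g [oB Bx sg fg]]].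
have : smooth_on B f by apply: (smooth_on_eq oB _ sg) => y /fg ->.
exact.
Qed.

Lemma open_preimage_smooth (W : normedModType R) U (f : V -> W) (O : set W) :
  open U -> smooth_on U f -> open O -> open (U `&` f @^-1` O).
Proof.
move=> oU sf oO; rewrite openE => x [Ux Ofx].
have nU : nbhs x U by exact: open_nbhs_nbhs.
have nO : nbhs x (f @^-1` O).
  by apply: (smooth_on_continuous sf Ux); exact: open_nbhs_nbhs.
exact: filterI.
Qed.

Section Operations.
Variable U : set V.
Hypothesis oU : open U.

Lemma smooth_on_cst (W : normedModType R) (w : W) : smooth_on U (fun=> w).
Proof. apply/smooth_onP => k; exact: times_differentiable_cst. Qed.

Lemma smooth_on_linear (W Z : normedModType R) (L : {linear W -> Z}) (f : V -> W) :
  continuous L -> smooth_on U f -> smooth_on U (fun x => L (f x)).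
Proof.
move=> cL /smooth_onP sf; apply/smooth_onP => k.
exact: times_differentiable_linear.
Qed.

Lemma smooth_on_id : smooth_on U id.
Proof.
apply/smooth_onP => -[|k]; split => // v.
by apply: times_differentiable_eq (times_differentiable_cst oU k v) => // x Ux; rewrite derive_id.
Qed.

Lemma smooth_onD (W : normedModType R) (f g : V -> W) :
  smooth_on U f -> smooth_on U g -> smooth_on U (fun x => f x + g x).
Proof.
move=> /smooth_onP sf /smooth_onP sg.
by apply/smooth_onP => k; exact: times_differentiableD.
Qed.

Lemma smooth_on_sum (W : normedModType R) n (f : 'I_n -> V -> W) :
  (forall i, smooth_on U (f i)) -> smooth_on U (fun x => \sum_(i < n) f i x).
Proof.
move=> sf; apply/smooth_onP => k; apply: times_differentiable_sum => // i.
by have /smooth_onP := sf i; exact.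
Qed.

Lemma smooth_onM (f g : V -> R) :
  smooth_on U f -> smooth_on U g -> smooth_on U (fun x => f x * g x).
Proof.
move=> /smooth_onP sf /smooth_onP sg.
by apply/smooth_onP => k; exact: times_differentiableM.
Qed.

Lemma smooth_onN (f : V -> R) : smooth_on U f -> smooth_on U (fun x => - f x).
Proof.
move=> sf; apply: (smooth_on_eq (f := fun x => -1 * f x)) => // [x _|].
  by rewrite mulN1r.
exact: (smooth_onM (smooth_on_cst (-1 : R)) sf).
Qed.

Lemma smooth_onV (f : V -> R) : (forall x, U x -> f x != 0) ->
  smooth_on U f -> smooth_on U (fun x => (f x)^-1).
Proof.
move=> f0 /smooth_onP sf.
by apply/smooth_onP => k; exact: times_differentiableV.
Qed.

Lemma smooth_on_sqrt (f : V -> R) : (forall x, U x -> 0 < f x) ->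
  smooth_on U f -> smooth_on U (fun x => Num.sqrt (f x)).
Proof.
move=> f0 /smooth_onP sf.
by apply/smooth_onP => k; exact: times_differentiable_sqrt.
Qed.

Lemma smooth_on_scaler (W : normedModType R) (f : V -> R) (w : W) :
  smooth_on U f -> smooth_on U (fun x => f x *: w).
Proof.
move=> /smooth_onP sf; apply/smooth_onP => k.
exact: times_differentiable_scaler.
Qed.

Lemma smooth_on_comp (W Z : normedModType R) (O : set W) (f : V -> W) (g : W -> Z) :
  finite_coordinates W -> finite_coordinates Z ->
  open O -> (forall x, U x -> O (f x)) ->
  smooth_on U f -> smooth_on O g -> smooth_on U (fun x => g (f x)).
Proof.
move=> fW fZ oO UO /smooth_onP sf /smooth_onP sg.
apply/smooth_onP => k.
exact: (times_differentiable_comp oU fW fZ oO UO (sf k) (sg k)).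
Qed.

Lemma smooth_on_coordinates (W : normedModType R) n (e : 'I_n -> W)
    (l : 'I_n -> W -> R) (f : V -> W) :
  (forall w, w = \sum_i l i w *: e i) ->
  (forall i, smooth_on U (fun x => l i (f x))) -> smooth_on U f.
Proof.
move=> eW sl; apply: (smooth_on_eq (f := fun x => \sum_i l i (f x) *: e i)) => //.
by apply: smooth_on_sum => i; exact: smooth_on_scaler.
Qed.

Lemma smooth_on_rV n (f : V -> 'rV[R]_n) :
  (forall i, smooth_on U (fun x => f x ord0 i)) -> smooth_on U f.
Proof.
by apply: (smooth_on_coordinates (e := fun i => 'e_i) (l :=
  fun i (w : 'rV[R]_n) => w ord0 i)) => w; exact: row_sum_delta.
Qed.

End Operations.
End SmoothCalculus.

Section CoordinateSpaces.
Variable R : realType.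

Lemma finite_coordinates_rV n : finite_coordinates 'rV[R]_n.
Proof.
have cl (i : 'I_n) : linear (fun w : 'rV[R]_n => w ord0 i : R^o).
  by move=> a u v; rewrite !mxE.
pose l i : {linear 'rV[R]_n -> R^o} :=
    HB.pack (fun w : 'rV[R]_n => w ord0 i : R^o) (GRing.isLinear.Build _ _ _ _ _ (cl i)).
exists n, (fun i => 'e_i), l; split; last by move=> w; exact: row_sum_delta.
by move=> i; exact: coord_continuous.
Qed.

Lemma smooth_on_coord (V : normedModType R) (U : set V) n (f : V -> 'rV[R]_n) i :
  open U -> smooth_on U f -> smooth_on U (fun x => f x ord0 i).
Proof.
move=> oU sf.
have cl : linear (fun w : 'rV[R]_n => w ord0 i : R^o) by move=> a u v; rewrite !mxE.
pose l : {linear 'rV[R]_n -> R^o} :=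
    HB.pack (fun w : 'rV[R]_n => w ord0 i : R^o) (GRing.isLinear.Build _ _ _ _ _ cl).
by apply: (smooth_on_linear oU (L := l)) sf; exact: coord_continuous.
Qed.

Lemma finite_coordinates_quat : finite_coordinates (quat R).
Proof. exact: finite_coordinates_rV. Qed.

Section Products.
Variables W Z : normedModType R.

Lemma linear_continuous_fst (Y : normedModType R) (L : {linear W -> Y}) :
  continuous L -> exists2 L' : {linear (W * Z)%type -> Y},
    continuous L' & forall x, L' x = L x.1.
Proof.
move=> cL; have ll : linear (fun x : W * Z => L x.1) by move=> a u v /=; exact: linearP.
pose L' : {linear (W * Z)%type -> Y} :=
    HB.pack (fun x : W * Z => L x.1) (GRing.isLinear.Build _ _ _ _ _ ll).
exists L' => // x; apply: (@cvg_comp _ _ _ fst L _ (nbhs x.1));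
  [exact: (@cvg_fst _ _ (nbhs x.1) (nbhs x.2))|exact: cL].
Qed.

Lemma linear_continuous_snd (Y : normedModType R) (L : {linear Z -> Y}) :
  continuous L -> exists2 L' : {linear (W * Z)%type -> Y},
    continuous L' & forall x, L' x = L x.2.
Proof.
move=> cL; have ll : linear (fun x : W * Z => L x.2) by move=> a u v /=; exact: linearP.
pose L' : {linear (W * Z)%type -> Y} :=
    HB.pack (fun x : W * Z => L x.2) (GRing.isLinear.Build _ _ _ _ _ ll).
exists L' => // x; apply: (@cvg_comp _ _ _ snd L _ (nbhs x.2));
  [exact: (@cvg_snd _ _ (nbhs x.1) (nbhs x.2))|exact: cL].
Qed.

Lemma finite_coordinates_prod :
  finite_coordinates W -> finite_coordinates Z -> finite_coordinates (W * Z)%type.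
Proof.
move=> [n1 [e1 [l1 [cl1 eW]]]] [n2 [e2 [l2 [cl2 eZ]]]].
pose L1 i := projT1 (cid2 (linear_continuous_fst (cl1 i))).
have cL1 i : continuous (L1 i) /\ forall x, L1 i x = l1 i x.1.
  by rewrite /L1; case: cid2.
pose L2 i := projT1 (cid2 (linear_continuous_snd (cl2 i))).
have cL2 i : continuous (L2 i) /\ forall x, L2 i x = l2 i x.2.
  by rewrite /L2; case: cid2.
exists (n1 + n2)%N,
  (fun i => match fintype.split i with inl j => (e1 j, 0) | inr j => (0, e2 j) end),
  (fun i => match fintype.split i with inl j => L1 j | inr j => L2 j end); split.
  by move=> i; case: (fintype.split i) => j; [case: (cL1 j)|case: (cL2 j)].
move=> w; rewrite big_split_ord /=.
under eq_bigr => i _ do rewrite -[lshift _ _]/(unsplit (inl i)) unsplitK (cL1 i).2.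
under [X in _ + X]eq_bigr => i _ do rewrite -[rshift _ _]/(unsplit (inr i)) unsplitK (cL2 i).2.
have sfst n (F : 'I_n -> W * Z) : (\sum_i F i).1 = \sum_i (F i).1.
  by elim/big_rec2: _ => // i _ y _ <-.
have ssnd n (F : 'I_n -> W * Z) : (\sum_i F i).2 = \sum_i (F i).2.
  by elim/big_rec2: _ => // i _ y _ <-.
rewrite [LHS]surjective_pairing [RHS]surjective_pairing; congr pair; rewrite /= ?sfst ?ssnd /=.
  by rewrite [X in _ + X]big1 ?addr0 => [|i _]; rewrite ?scaler0 // -eW.
by rewrite [X in X + _]big1 ?add0r => [|i _]; rewrite ?scaler0 // -eZ.
Qed.

Variables (V : normedModType R) (U : set V).
Hypothesis oU : open U.

Lemma smooth_on_fst (f : V -> W * Z) : smooth_on U f -> smooth_on U (fun x => (f x).1).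
Proof.
have ci : continuous (idfun : W -> W) by move=> x; exact: cvg_id.
have [L cL LE] := linear_continuous_fst ci.
by move/(smooth_on_linear oU cL); apply: smooth_on_eq => // x _; rewrite LE.
Qed.

Lemma smooth_on_snd (f : V -> W * Z) : smooth_on U f -> smooth_on U (fun x => (f x).2).
Proof.
have ci : continuous (idfun : Z -> Z) by move=> x; exact: cvg_id.
have [L cL LE] := linear_continuous_snd ci.
by move/(smooth_on_linear oU cL); apply: smooth_on_eq => // x _; rewrite LE.
Qed.

Lemma smooth_on_pair (f : V -> W) (g : V -> Z) :
  smooth_on U f -> smooth_on U g -> smooth_on U (fun x => (f x, g x)).
Proof.
have l1 : linear (fun x : W => (x, 0) : W * Z).
  by move=> a u v; apply/pair_equal_spec; split => //=; rewrite scaler0 addr0.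
have l2 : linear (fun x : Z => (0, x) : W * Z).
  by move=> a u v; apply/pair_equal_spec; split => //=; rewrite scaler0 addr0.
pose L1 : {linear W -> (W * Z)%type} :=
    HB.pack (fun x : W => (x, 0) : W * Z) (GRing.isLinear.Build _ _ _ _ _ l1).
pose L2 : {linear Z -> (W * Z)%type} :=
    HB.pack (fun x : Z => (0, x) : W * Z) (GRing.isLinear.Build _ _ _ _ _ l2).
have c1 : continuous L1 by move=> x; apply: cvg_pair; [exact: cvg_id|exact: cvg_cst].
have c2 : continuous L2 by move=> x; apply: cvg_pair; [exact: cvg_cst|exact: cvg_id].
move=> /(smooth_on_linear oU c1) sf /(smooth_on_linear oU c2) sg.
apply: smooth_on_eq (smooth_onD oU sf sg) => // x _ /=.
by apply/pair_equal_spec; rewrite /= addr0 add0r.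
Qed.

End Products.
End CoordinateSpaces.

(** * Smoothness of the quaternion operations *)

Section QuaternionCalculus.
Variables (R : realType) (V : normedModType R) (U : set V).
Hypothesis oU : open U.
Implicit Types f g : V -> quat R.

Lemma smooth_on_qcoord f k : smooth_on U f -> smooth_on U (fun x => qcoord (f x) k).
Proof.
have ll : linear (fun q : quat R => qcoord q k : R^o).
  by move=> a u v; rewrite qcoordD qcoordZ.
pose L : {linear quat R -> R^o} :=
    HB.pack (fun q : quat R => qcoord q k : R^o) (GRing.isLinear.Build _ _ _ _ _ ll).
have cL : continuous L by exact: coord_continuous.
by move/(smooth_on_linear oU cL).
Qed.

Lemma smooth_on_quat f :
  smooth_on U (fun x => qcoord (f x) 0) -> smooth_on U (fun x => qcoord (f x) 1) ->
  smooth_on U (fun x => qcoord (f x) 2) -> smooth_on U (fun x => qcoord (f x) 3) ->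
  smooth_on U f.
Proof.
move=> s0 s1 s2 s3.
have := @smooth_on_rV _ _ _ oU 4 f; apply => i.
rewrite -(inord_val i); case: i => -[|[|[|[|//]]]] ?; by [].
Qed.

Lemma smooth_on_qmul f g : smooth_on U f -> smooth_on U g -> smooth_on U (fun x => f x * g x).
Proof.
move=> sf sg.
have sM i j : smooth_on U (fun x => qcoord (f x) i * qcoord (g x) j).
  by apply: smooth_onM => //; exact: smooth_on_qcoord.
have sB (h k : V -> R) : smooth_on U h -> smooth_on U k -> smooth_on U (fun x => h x - k x).
  by move=> sh sk; apply: smooth_onD => //; exact: smooth_onN.
have sD (h k : V -> R) : smooth_on U h -> smooth_on U k -> smooth_on U (fun x => h x + k x).
  by move=> sh sk; apply: smooth_onD.
apply: smooth_on_quat; under eq_fun do rewrite qcoord_mk //=.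
- exact: (sB _ _ (sB _ _ (sB _ _ (sM 0 0) (sM 1 1)) (sM 2 2)) (sM 3 3)).
- exact: (sB _ _ (sD _ _ (sD _ _ (sM 0 1) (sM 1 0)) (sM 2 3)) (sM 3 2)).
- exact: (sD _ _ (sD _ _ (sB _ _ (sM 0 2) (sM 1 3)) (sM 2 0)) (sM 3 1)).
- exact: (sD _ _ (sB _ _ (sD _ _ (sM 0 3) (sM 1 2)) (sM 2 1)) (sM 3 0)).
Qed.

Lemma smooth_on_qconj f : smooth_on U f -> smooth_on U (fun x => qconj (f x)).
Proof.
move=> sf; have sc := smooth_on_qcoord _ sf.
apply: smooth_on_quat; under eq_fun do rewrite qcoord_mk //=; first exact: sc.
- exact: smooth_onN (sc _).
- exact: smooth_onN (sc _).
- exact: smooth_onN (sc _).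
Qed.

Lemma smooth_on_qnorm2 f : smooth_on U f -> smooth_on U (fun x => qnorm2 (f x)).
Proof.
move=> sf; have sc := smooth_on_qcoord _ sf.
apply: smooth_on_sum => // i; under eq_fun do rewrite expr2.
by apply: smooth_onM.
Qed.

Lemma smooth_on_scaleq (h : V -> R) f :
  smooth_on U h -> smooth_on U f -> smooth_on U (fun x => h x *: f x).
Proof.
move=> sh sf; have sc := smooth_on_qcoord _ sf.
by apply: smooth_on_quat; under eq_fun do rewrite qcoordZ; apply: smooth_onM.
Qed.

Lemma smooth_on_qinv f : (forall x, U x -> f x != 0) ->
  smooth_on U f -> smooth_on U (fun x => (f x)^-1).
Proof.
move=> f0 sf; apply: (smooth_on_scaleq (h := fun x => (qnorm2 (f x))^-1)).
  by apply: smooth_onV => [//|x Ux|]; [rewrite qnorm2_eq0 f0|exact: smooth_on_qnorm2].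
exact: smooth_on_qconj.
Qed.

End QuaternionCalculus.

(** * Embedded submanifolds *)

Section ChartInverse.
Variables (R : realType) (X T : Type) (n : nat).

(** [t0] is the value off the image of the chart. *)
Lemma chart_factor (c : chart R X n) (f : X -> T) (t0 : T) :
  set_inj (chart_dom c) c ->
  exists g : 'rV[R]_n -> T, forall x, chart_dom c x -> g (c x) = f x.
Proof.
move=> ic.
exists (fun u => if pselect (exists2 x, chart_dom c x & c x = u) is left h
                 then f (projT1 (cid2 h)) else t0) => x cx.
case: pselect => [h|[]]; last by exists x.
case: cid2 => y /= cy cyx; congr f; apply: ic => //; exact: mem_set.
Qed.
End ChartInverse.

Section EmbeddedMaps.
Variables (R : realType) (V W : normedModType R) (X Y : Type).
Variables (eX : X -> V) (eY : Y -> W).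
Hypotheses (fV : finite_coordinates V) (fW : finite_coordinates W).

(** Near a point the coordinate representation is the composite of the inverse
    of [c], which is smooth into [V], of an ambient extension [F] of [f], and of
    an ambient extension of [d]. With [f] the identity this is the
    compatibility of two euclidean charts. *)
Lemma embedded_smooth_coord_rep m n (c : chart R X m) (d : chart R Y n) (f : X -> Y) :
  euclidean_chart eX c -> euclidean_chart eY d ->
  (forall x, chart_dom c x -> chart_dom d (f x) -> exists (O : set V) (F : V -> W),
    [/\ open O, O (eX x), smooth_on O F & forall y, O (eX y) -> F (eX y) = eY (f y)]) ->
  exists g, smooth_coord_rep f c d g.
Proof.
move=> [_ [oc ic] [gc sgc gcE] _] [[Od oOd dE] [_ _] _ locd] locf.
have [g gE] := chart_factor (fun x => d (f x)) 0 ic.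
exists g.
have nbd x : chart_dom c x -> chart_dom d (f x) ->
    exists B k, [/\ open B, B (c x), B `<=` coord_dom f c d, smooth_on B k &
      forall u, B u -> g u = k u].
  move=> cx dfx; have [A [F [oA Ax sF FE]]] := locf x cx dfx.
  have [B [h [oB Bx sh hE]]] := locd _ dfx.
  have oOdB : open (Od `&` B) by exact: openI.
  have oA' := open_preimage_smooth oA sF oOdB.
  have oC := open_preimage_smooth oc sgc oA'.
  exists ((c @` chart_dom c) `&` (gc @^-1` (A `&` (F @^-1` (Od `&` B))))).
  exists (fun u => h (F (gc u))).
  have CE u : ((c @` chart_dom c) `&` (gc @^-1` (A `&` (F @^-1` (Od `&` B))))) u ->
      exists2 y, chart_dom c y & [/\ c y = u, chart_dom d (f y), A (eX y) & B (eY (f y))].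
    move=> [[y cy <-]] [/=]; rewrite gcE // => Ay; rewrite FE // => -[Ody By].
    by exists y => //; split => //; rewrite dE.
  split => //.
  - split; first by exists x.
    by rewrite /= gcE //; split => //=; rewrite FE //; split => //; move: dfx; rewrite dE.
  - by move=> u /CE[y cy [<- dfy _ _]]; exists y.
  - have s1 := smooth_on_subset (@subIsetl _ _ _) sgc.
    have s2 := smooth_on_comp oC fV fW oA (fun u h => proj1 (proj2 h)) (s1 _) sF.
    exact: (smooth_on_comp oC fW (finite_coordinates_rV R n) oB (fun u h =>
      proj2 (proj2 (proj2 h))) s2 sh).
  - move=> u /CE[y cy [<- dfy Ay By]].
    by rewrite gE // gcE // FE // hE.
split => //.
- rewrite openE => u [x [cx dfx] <-].
  have [B [k [oB Bx BD _ _]]] := nbd x cx dfx.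
  by rewrite /interior; apply: filterS BD _; exact: open_nbhs_nbhs.
- apply: smooth_on_local => u [x [cx dfx] <-].
  by have [B [k [oB Bx BD sk gk]]] := nbd x cx dfx; exists B, k.
- by move=> x cx _; exact: gE.
Qed.

End EmbeddedMaps.

Section CountableBase.
Variables (R : realType) (V : normedModType R).

(** Balls of rational radius about the points with rational coordinates. *)
Lemma finite_coordinates_base : finite_coordinates V ->
  exists B : nat -> set V, (forall i, open (B i)) /\
    forall O x, open O -> O x -> exists i, B i x /\ B i `<=` O.
Proof.
move=> [n [e [l [cl eW]]]].
pose z (q : {ffun 'I_n -> rat}) : V := \sum_i (ratr (q i) : R) *: e i.
exists (fun i => if unpickle i is Some (q, r) then [set v | `|z q - v| < (ratr r : R)]
                 else set0); split.
  move=> i; case: (unpickle i) => [[q r]|]; last exact: open0.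
  rewrite -[X in open X](_ : ball (z q) (ratr r : R) = _); last by rewrite -ball_normE.
  exact: ball_open.
move=> O x oO Ox.
have /nbhs_ballP[eps /= e0 epsO] : nbhs x O by exact: open_nbhs_nbhs.
have [r] : exists r : rat, (ratr r : R) \in `]0, eps / 2[.
  by apply: rat_in_itvoo; rewrite divr_gt0.
rewrite in_itv /= => /andP[r0 re].
pose del : R := ratr r / (1 + \sum_i `|e i|).
have s0 : 0 < 1 + \sum_i `|e i| by rewrite ltr_pwDl // sumr_ge0.
have del0 : 0 < del by rewrite divr_gt0.
have /choice[q hq] : forall i, exists q : rat, `|l i x - ratr q : R| < del.
  move=> i; have [q] : exists q : rat, (ratr q : R) \in `]l i x - del, l i x + del[.
    by apply: rat_in_itvoo; rewrite ltrD2l gtrN.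
  by rewrite in_itv /= => /andP[q1 q2]; exists q; rewrite ltr_norml; lra.
have zx : `|z [ffun i => q i] - x| < ratr r.
  rewrite distrC {1}(eW x) /z -sumrB.
  apply: le_lt_trans (ler_norm_sum _ _ _) _.
  apply: (@le_lt_trans _ _ (\sum_i del * `|e i|)).
    by apply: ler_sum => i _; rewrite ffunE -scalerBl normrZ ler_wpM2r // ltW.
  rewrite -mulr_sumr /del mulrAC -mulrA gtr_pMr // ltr_pdivrMr // mul1r.
  by rewrite ltrDr.
exists (pickle ([ffun i => q i] : {ffun 'I_n -> rat}, r)); rewrite pickleK; split => //.
move=> y /= zy; apply: epsO; rewrite -ball_normE /=.
have -> : x - y = - (z [ffun i => q i] - x) + (z [ffun i => q i] - y).
  by rewrite opprB subrKA.
apply: le_lt_trans (ler_normD _ _) _; rewrite normrN (splitr eps) ltrD //.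
  exact: lt_trans re.
exact: lt_trans re.
Qed.

End CountableBase.

Lemma smooth_coord_rep_id (R : realType) (V : normedModType R) (X : Type) (e : X -> V) m n
    (c : chart R X m) (d : chart R X n) : finite_coordinates V ->
  euclidean_chart e c -> euclidean_chart e d -> exists g, smooth_coord_rep id c d g.
Proof.
move=> fV ec ed; apply: embedded_smooth_coord_rep ec ed _ => // x _ _.
by exists setT, id; split => //; [exact: openT|exact: smooth_on_id openT].
Qed.

Section EmbeddedManifold.
Variables (R : realType) (V : normedModType R) (X : Type) (n : nat) (e : X -> V).
Hypotheses (fV : finite_coordinates V) (ie : injective e).
Hypothesis cover : forall x, exists2 c : chart R X n, euclidean_chart e c & chart_dom c x.

(** The manifold topology is the one induced by [e]: a set that is open in one
    chart is cut out near each of its points by an open set of [V]. *)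
Lemma euclidean_chart_nbhs (c : chart R X n) (O : set 'rV[R]_n) x :
  euclidean_chart e c -> open O -> chart_dom c x -> O (c x) ->
  exists A : set V, [/\ open A, A (e x) & forall y, A (e y) -> chart_dom c y /\ O (c y)].
Proof.
move=> [[Oc oOc cE] _ _ loc] oO cx Ocx.
have [B [h [oB Bx sh hE]]] := loc x cx.
exists (Oc `&` (B `&` h @^-1` O)); split.
- exact: openI oOc (open_preimage_smooth oB sh oO).
- split; first by move: cx; rewrite cE.
  by split => //=; rewrite hE.
- move=> y [Ocy [By]] /=.
  have cy : chart_dom c y by rewrite cE.
  by rewrite hE.
Qed.

Lemma euclidean_chart_preimage_open (c : chart R X n) (O : set V) :
  euclidean_chart e c -> open O -> open (c @` (chart_dom c `&` e @^-1` O)).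
Proof.
move=> [_ [oc _] [g sg gE] _] oO.
rewrite (_ : c @` _ = (c @` chart_dom c) `&` g @^-1` O).
  exact: open_preimage_smooth.
apply/seteqP; split => [u [x [cx Ox] <-]|u [[x cx <-]]] /=.
  by split; [exists x|rewrite gE].
by rewrite gE // => Ox; exists x.
Qed.

(** Locally [c] is the composite of a euclidean chart [d] with a transition
    map, and both the local ambient extension of [d] and the inverse of [d] can be
    composed with it. The domain of [c] is cut out by the union of all open sets
    of [V] that meet the image of [e] inside it. *)
Lemma euclidean_chart_maximal (c : chart R X n) : is_chart c ->
  (forall d : chart R X n, euclidean_chart e d -> compatible c d) ->
  euclidean_chart e c.
Proof.
move=> cc compat; have [oc ic] := cc.
have fR := finite_coordinates_rV R n.
have [g gE] := chart_factor e 0 ic.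
split => //.
- exists (\bigcup_(A in [set A | open A /\ e @^-1` A `<=` chart_dom c]) A).
    by apply: bigcup_open => A [].
  apply/seteqP; split => x; last by move=> [A [_ Ac] Ax]; exact: Ac.
  move=> cx; have [d ed dx] := cover x.
  have [_ [k [oD _ _]]] := compat d ed.
  have [|A [oA Ax AE]] := euclidean_chart_nbhs ed oD dx; first by exists x.
  exists A => //; split => // y /AE[dy [z [dz cz] dzy]].
  have [_ [_ id_] _ _] := ed.
  by have -> : y = z by apply: id_ => //; exact: mem_set.
- exists g => //; apply: smooth_on_local => u [x cx <-].
  have [d ed dx] := cover x.
  have [[k [oD sk kE]] _] := compat d ed.
  have [_ [od _] [gd sgd gdE] _] := ed.
  exists (coord_dom id c d), (fun u => gd (k u)); split => //.
  + by exists x.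
  + apply: (smooth_on_comp oD fR fV od _ sk sgd) => _ [y [cy dy] <-].
    by rewrite kE //; exists y.
  + by move=> _ [y [cy dy] <-]; rewrite gE // kE // gdE.
- move=> x cx; have [d ed dx] := cover x.
  have [_ [k [oD sk kE]]] := compat d ed.
  have [[Od oOd dE] _ _ locd] := ed.
  have [B [h [oB Bx sh hE]]] := locd x dx.
  have oC := openI oOd (open_preimage_smooth oB sh oD).
  exists (Od `&` (B `&` h @^-1` coord_dom id d c)), (fun v => k (h v)); split => //.
  + split; first by move: dx; rewrite dE.
    by split => //=; rewrite hE //; exists x.
  + have sh' : smooth_on (Od `&` (B `&` h @^-1` coord_dom id d c)) h.
      by apply: smooth_on_subset sh => v [_ []].
    exact: (smooth_on_comp oC fR fR oD (fun v H => proj2 (proj2 H)) sh' sk).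
  + move=> y cy [Ody [By _]]; have dy : chart_dom d y by rewrite dE.
    by rewrite hE // kE.
Qed.

(** Separation and second countability are inherited from [V], whose topology
    induces the one of the atlas. *)
Lemma embedded_manifold :
  exists2 M : manifold R X, mdim M = n & submanifold e M.
Proof.
pose At : set (chart R X n) := [set c | euclidean_chart e c].
have at_open O : open O -> atlas_open At (e @^-1` O).
  by move=> oO c ec; exact: euclidean_chart_preimage_open.
have haus x y : x <> y -> exists U U' : set X,
    [/\ atlas_open At U, atlas_open At U', U x, U' y & U `&` U' = set0].
  move=> xy; have := @norm_hausdorff R V; rewrite open_hausdorff => /(_ (e x) (e y)).
  case; first by apply/eqP => /ie.
  move=> [A B] /= [/set_mem Ax /set_mem By] [oA oB AB].
  exists (e @^-1` A), (e @^-1` B); split => //; try exact: at_open.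
  apply/seteqP; split => // z [Az Bz].
  by have : (A `&` B) (e z) by []; rewrite (eqP AB).
have sc : exists B : nat -> set X, (forall i, atlas_open At (B i)) /\
    (forall U x, atlas_open At U -> U x -> exists i, B i x /\ B i `<=` U).
  have [B [oB hB]] := finite_coordinates_base fV.
  exists (fun i => e @^-1` B i); split => [i|U x oU Ux]; first exact: at_open.
  have [c ec cx] := cover x.
  have [|A [oA Ax AE]] := euclidean_chart_nbhs ec (oU c ec) cx; first by exists x.
  have [i [Bix BiA]] := hB A _ oA Ax.
  exists i; split => // y /BiA /AE[cy [z [cz Uz] czy]].
  have [_ [_ ic] _ _] := ec.
  by have -> : y = z by apply: ic => //; exact: mem_set.
have cov x : exists2 c, At c & chart_dom c x by have [c] := cover x; exists c.
have comp c d : At c -> At d -> compatible c d.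
  by move=> ec ed; split; [exact: smooth_coord_rep_id fV ec ed|exact: smooth_coord_rep_id fV
    ed ec].
have ch c : At c -> is_chart c by case.
by exists (Manifold ch cov comp (fun c cc h => euclidean_chart_maximal cc h) haus sc).
Qed.

End EmbeddedManifold.

(** * Fibres of submersions *)

Section Norms.
Variable R : realType.

Lemma norm_rV_coord n (v : 'rV[R]_n) i : `|v ord0 i| <= `|v|.
Proof. by rewrite [leRHS]/Num.Def.normr /= mx_normrE;
  exact: (le_bigmax _ (fun ij => `|v ij.1 ij.2|) (ord0, i)). Qed.

Lemma norm_rV_le n (v : 'rV[R]_n) (M : R) :
  0 <= M -> (forall i, `|v ord0 i| <= M) -> `|v| <= M.
Proof.
move=> M0 vM; rewrite [leLHS]/Num.Def.normr /= mx_normrE.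
by apply: bigmax_le => // -[i j] _ /=; rewrite ord1.
Qed.

Lemma norm_mulmx_le n m (u : 'rV[R]_n) (B : 'M[R]_(n, m)) :
  `|u *m B| <= `|u| * \sum_i `|row i B|.
Proof.
rewrite mulmx_sum_row; apply: le_trans (ler_norm_sum _ _ _) _.
by rewrite mulr_sumr; apply: ler_sum => i _; rewrite normrZ ler_wpM2r // norm_rV_coord.
Qed.

(** The norm of a row vector is the sup norm, which is not differentiable; the
    function to be minimised is built from the euclidean one instead. *)
Definition sqnorm n (w : 'rV[R]_n) : R := \sum_i (w ord0 i) ^+ 2.

Lemma sqnorm_ge n (w : 'rV[R]_n) : `|w| ^+ 2 <= sqnorm w.
Proof.
have s0 : 0 <= sqnorm w by apply: sumr_ge0 => i _; exact: sqr_ge0.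
suff : `|w| <= Num.sqrt (sqnorm w).
  by rewrite -(ler_sqr (x := `|w|)) ?nnegrE // sqr_sqrtr.
apply: norm_rV_le => // i; rewrite -sqrtr_sqr ler_sqrt //.
by rewrite /sqnorm (bigD1 i) //= lerDl sumr_ge0 // => j _; exact: sqr_ge0.
Qed.

Lemma sqnorm_le n (w : 'rV[R]_n) : sqnorm w <= n%:R * `|w| ^+ 2.
Proof.
rewrite /sqnorm -[n in n%:R]card_ord -sum1_card natr_sum mulr_suml.
apply: ler_sum => i _; rewrite mul1r -[leLHS]real_normK ?num_real //.
by rewrite ler_sqr ?nnegrE // norm_rV_coord.
Qed.
End Norms.

Section LinearRank.
Variables (R : realType) (m n : nat) (L : {linear 'rV[R]_m -> 'rV[R]_n}).

Lemma surjective_linear_right_inverse : set_surj setT setT L ->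
  exists B : 'M[R]_(n, m), forall y, L (y *m B) = y.
Proof.
move=> sL; exists (pinvmx (lin1_mx L)) => y.
have [v _ vy] := sL y I.
by rewrite -[L _](mul_rV_lin1 L) mulmxKpV // -vy -[L _](mul_rV_lin1 L) submxMl.
Qed.

Lemma surjective_linear_leq : set_surj setT setT L -> (n <= m)%N.
Proof.
move=> sL; have [B BK] := surjective_linear_right_inverse sL.
have : B *m lin1_mx L = 1%:M.
  by apply/row_matrixP => i; rewrite row_mul (rowE i B) (mul_rV_lin1 L) BK row1.
move/(congr1 (fun M => \rank M)); rewrite mxrank1 => <-.
exact: leq_trans (mxrankM_maxl _ _) (rank_leq_col _).
Qed.

Lemma linear_kernel : (n < m)%N -> exists2 v, v != 0 & L v = 0.
Proof.
move=> nm; have : kermx (lin1_mx L) != 0.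
  rewrite kermx_eq0 /row_free neq_ltn.
  by rewrite (leq_ltn_trans (rank_leq_col _) nm).
move/rowV0Pn => [v vk v0]; exists v => //.
by rewrite -[L _](mul_rV_lin1 L); apply/eqP; move: vk; rewrite sub_kermx.
Qed.
End LinearRank.

Section LocalSections.
Variables (R : realType).

Lemma local_section_surjective (V W : normedModType R) (f : V -> W) (s : W -> V) w :
  differentiable s w -> differentiable f (s w) ->
  (\near w, f (s w) = w) -> set_surj setT setT ('d f (s w)).
Proof.
move=> ds df fs y _; exists ('d s w y) => //.
have dfs := differentiable_comp ds df.
transitivity ('D_y (f \o s) w).
  by rewrite (deriveE _ dfs) (diff_comp ds df).
rewrite (near_eq_derive (g := id)); last by near=> z; rewrite /= (near fs z).
by rewrite derive_id.
Unshelve. all: by end_near. Qed.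
End LocalSections.

Section CriticalPoint.
Variables (R : realType) (m n : nat) (f : 'rV[R]_m -> 'rV[R]_n).

Lemma is_derive_along p u s i : differentiable f (p + s *: u) ->
  is_derive s (1 : R) (fun t : R => f (p + t *: u) ord0 i) ('d f (p + s *: u) u ord0 i).
Proof.
move=> df.
have dl : is_diff s (fun t : R => p + t *: u) (fun t => t *: u).
  have -> : (fun t : R => p + t *: u) = cst p + ( *:%R^~ u) by [].
  have h := is_diffD (is_diff_cst p s) (is_diff_scalel s u).
  by apply: (is_diff_eq h); rewrite add0r.
have [dl1 dl2] := dl.
have dfl := differentiable_comp dl1 df.
have der : derivable (f \o (fun t : R => p + t *: u)) s 1 by exact: diff_derivable.
apply: DeriveDef; first exact: (derivable_mxP _ _ _).1 der ord0 i.
have /(congr1 (fun M : 'rV_n => M ord0 i)) := derive_mx der.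
rewrite mxE => <-; rewrite (deriveE _ dfl) (diff_comp dl1 df) /=.
by rewrite dl2 scale1r.
Qed.

(** The derivative at [0] of the squared distance along the line through [p] in
    the direction [u], which vanishes at an interior minimum. *)
Lemma sqnorm_min_critical p u c (sg : R) : 0 < sg ->
  (forall s, `|s| < sg -> differentiable f (p + s *: u)) ->
  (forall s, `|s| < sg -> sqnorm (f p - c) <= sqnorm (f (p + s *: u) - c)) ->
  \sum_i (f p - c) ord0 i * 'd f p u ord0 i = 0.
Proof.
move=> sg0 df mn.
pose psi : R -> R := \sum_(i < n) (fun t : R => f (p + t *: u) ord0 i - c ord0 i) ^+ 2.
have psiE t : psi t = sqnorm (f (p + t *: u) - c).
  rewrite /psi /sqnorm fct_sumE; apply: eq_bigr => i _.
  by rewrite !mxE.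
pose dpsi s : R := \sum_(i < n) (2 * (f (p + s *: u) ord0 i - c ord0 i)) *: ('d f (p +
  s *: u) u ord0 i - 0).
have dp s : `|s| < sg -> is_derive s (1 : R) psi (dpsi s).
  move=> ss; apply: is_derive_sum => i.
  have h1 := is_derive_along i (df s ss).
  have h2 := @is_deriveB R R R _ _ s 1 _ _ h1 (is_derive_cst (c ord0 i) s 1).
  exact: (@is_deriveX R R _ 2 s 1 _ h2).
have norm_itv t : t \in `]-sg, sg[ -> `|t| < sg by rewrite in_itv /= ltr_norml.
have d0 : is_derive (0 : R) (1 : R) psi 0.
  apply: (@derive1_at_min R psi (- sg) sg 0).
  - by rewrite lerNl (le_trans (y := 0)) // ?oppr_le0 ltW.
  - by move=> t /norm_itv ts; have [] := dp t ts.
  - by rewrite in_itv /= oppr_lt0 sg0.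
  - by move=> t /norm_itv ts; rewrite !psiE scale0r addr0; exact: mn.
have s0 : `|0 : R| < sg by rewrite normr0.
have := @derive_val _ _ _ _ _ _ _ d0; rewrite (@derive_val _ _ _ _ _ _ _ (dp 0 s0)).
rewrite /dpsi scale0r addr0 => h.
have : 2 * \sum_i (f p - c) ord0 i * 'd f p u ord0 i = 0.
  rewrite -[RHS]h mulr_sumr; apply: eq_bigr => i _.
  by rewrite subr0 !mxE mulrA.
by move/eqP; rewrite mulf_eq0 pnatr_eq0 /= => /eqP.
Qed.

End CriticalPoint.

Lemma near_addl (R : realType) (V : normedModType R) (x0 : V) (P : set V) :
  (\forall x \near x0, P x) -> \forall h \near (0 : V), P (x0 + h).
Proof.
by rewrite (near_shift 0 x0); apply: filterS => h /=; rewrite subr0 addrC.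
Qed.

Section Fibres.
Variables (R : realType) (m n : nat) (U : set 'rV[R]_m) (f : 'rV[R]_m -> 'rV[R]_n).
Hypotheses (oU : open U) (sf : smooth_on U f).

Lemma diff_partials x u : differentiable f x ->
  'd f x u = \sum_j u ord0 j *: 'D_('e_j) f x.
Proof.
move=> df; rewrite {1}(row_sum_delta u) linear_sum; apply: eq_bigr => j _.
by rewrite linearZ (deriveE _ df).
Qed.

(** Continuity of the differential, from that of the finitely many partial
    derivatives. *)
Lemma near_diff x0 (eps : R) : U x0 -> 0 < eps ->
  \forall h \near (0 : 'rV[R]_m), forall u, `|'d f (x0 + h) u - 'd f x0 u| <= eps * `|u|.
Proof.
move=> Ux0 e0.
have e1 : 0 < eps / m.+1%:R by rewrite divr_gt0.
have cD j : \forall h \near (0 : 'rV[R]_m),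
    `|'D_('e_j) f x0 - 'D_('e_j) f (x0 + h)| <= eps / m.+1%:R.
  have cj := smooth_on_continuous (smooth_on_derive ('e_j) sf) Ux0.
  have /cvgrPdist_le /(_ _ e1) := cj.
  exact: near_addl.
have nU : \forall h \near (0 : 'rV[R]_m), U (x0 + h).
  by apply: near_addl; exact: open_nbhs_nbhs.
near=> h => u.
have Uh : U (x0 + h) by near: h.
have d0 := smooth_on_differentiable sf Ux0; have dh := smooth_on_differentiable sf Uh.
rewrite [X in X - _](diff_partials u dh).
rewrite [X in _ - X](diff_partials u d0).
rewrite -sumrB; apply: le_trans (ler_norm_sum _ _ _) _.
apply: (@le_trans _ _ (\sum_(j < m) `|u| * (eps / m.+1%:R))).
  apply: ler_sum => j _; rewrite -scalerBr normrZ.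
  apply: ler_pM => //; first exact: norm_rV_coord.
  by rewrite distrC; move: j; near: h; apply: filter_forall => j; exact: cD.
rewrite sumr_const card_ord -[_ *+ m]mulr_natr -mulrA [leRHS]mulrC ler_wpM2l //.
by rewrite mulrAC ler_pdivrMr // ler_wpM2l // ?ler_nat // ltW.
Unshelve. all: by end_near. Qed.

(** Let [B] be a right inverse of the differential at [x0] and [v] a nonzero
    vector of its kernel. For a small fixed [t > 0] the distance from
    [f (x0 + t v + y B)] to [f x0] is minimised over a small cube of [y]'s. By the
    first-order expansion at [x0] it is larger on the boundary of the cube than at
    [y = 0], so the minimum is attained inside; there the differential composed
    with [B] is close to the identity, so a critical point of the distance is a
    zero. The point found is not [x0], because [v] is not in the range of [B]. *)
Lemma submersion_fibre x0 : U x0 -> set_surj setT setT ('d f x0) -> (n < m)%N ->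
  exists x, [/\ U x, x != x0 & f x = f x0].
Proof.
move=> Ux0 sd nm.
have [B BK] := surjective_linear_right_inverse sd.
have [v v0 dv] := linear_kernel ('d f x0) nm.
set c := f x0.
pose KB : R := \sum_i `|row i B|.
have KB0 : 0 <= KB by apply: sumr_ge0.
pose K : R := 1 + `|v| + KB.
have K0 : 0 < K by rewrite /K -addrA ltr_pwDl // addr_ge0.
have Kn (t : R) (y : 'rV[R]_n) : `|t *: v + y *m B| <= K * (`|t| + `|y|).
  apply: le_trans (ler_normD _ _) _; rewrite normrZ.
  have := norm_mulmx_le y B; rewrite -/KB.
  have := normr_ge0 t; have := normr_ge0 y; have := normr_ge0 v.
  by rewrite /K; nra.
(* The constants make the error of the expansion at most [(t + |y|) / 8], and that
   of the differential along [u = z B] at most [|z| / (2 (n + 1))]. *)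
have e1 : 0 < (8 * K)^-1 by rewrite invr_gt0 mulr_gt0.
have e2 : 0 < (2 * n.+1%:R * K)^-1 by rewrite invr_gt0 !mulr_gt0.
have n1 : \forall h \near (0 : 'rV[R]_m), `|f (x0 + h) - c - 'd f x0 h| <= (8 * K)^-1 * `|h|.
  have /eqaddoP /(_ _ e1) := diff_locally (smooth_on_differentiable sf Ux0).
  apply: filterS => h.
  have -> : (f \o shift x0 - (cst (f x0) + 'd f x0)) h = f (h + x0) - (c + 'd f x0 h) by [].
  by rewrite [h + x0]addrC opprD addrA.
have n2 := near_diff Ux0 e2.
have n3 : \forall h \near (0 : 'rV[R]_m), U (x0 + h).
  by apply: near_addl; exact: open_nbhs_nbhs.
have : nbhs (0 : 'rV[R]_m) [set h | `|f (x0 + h) - c - 'd f x0 h| <= (8 * K)^-1 * `|h| /\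
    (forall u, `|'d f (x0 + h) u - 'd f x0 u| <= (2 * n.+1%:R * K)^-1 * `|u|) /\ U (x0 + h)].
  by apply: filterI => //; exact: filterI.
move=> /nbhs_ballP[del /= del0 bdel].
have hdel (h : 'rV[R]_m) (hd : `|h| < del) := bdel h ltac:(by rewrite -ball_normE /= sub0r
  normrN).
pose r := del / (4 * K).
have r0 : 0 < r by rewrite divr_gt0 // mulr_gt0.
(* The factor [1 / (n + 1)] absorbs the factor [n] between the two norms at
   [y = 0]. *)
pose t := r / n.+1%:R.
have t0 : 0 < t by rewrite divr_gt0.
have tr : t <= r by rewrite ler_pdivrMr // ler_peMr ?(ltW r0) // (ler_nat R 1 n.+1).
pose x (y : 'rV[R]_n) := x0 + (t *: v + y *m B).
have r2 : r <= 2 * r by rewrite mulr_natl mulr2n lerDl ltW.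
have small y : `|y| <= 2 * r -> `|t *: v + y *m B| < del.
  move=> yr; apply: le_lt_trans (Kn t y) _.
  have -> : del = K * (4 * r) by rewrite /r; field; rewrite gt_eqF.
  by rewrite ltr_pM2l // (gtr0_norm t0); lra.
have est y : `|y| <= r -> `|f (x y) - c - y| <= (t + `|y|) / 8.
  move=> yr; have [+ _] := hdel _ (small y ltac:(lra)).
  rewrite linearD linearZ /= dv scaler0 add0r BK => /le_trans; apply.
  rewrite mulrC invfM mulrA mulrAC ler_pM2r ?invr_gt0 // ler_pdivrMr //.
  by have := Kn t y; rewrite (gtr0_norm t0) mulrC.
have Ux y : `|y| <= 2 * r -> U (x y) by move=> yr; have [_ [_]] := hdel _ (small y yr).
have dfx y : `|y| <= 2 * r -> forall u, `|'d f (x y) u - 'd f x0 u| <=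
  (2 * n.+1%:R * K)^-1 * `|u|.
  by move=> yr; have [_ []] := hdel _ (small y yr).
pose Q : set 'rV[R]_n := [set y | forall i, `[- r, r]%classic (y ord0 i)].
have QE y : Q y <-> `|y| <= r.
  split=> [Qy|yr i].
    by apply: norm_rV_le; rewrite ?ltW // => i; rewrite ler_norml; have := Qy i;
      rewrite /= in_itv.
  by rewrite /= in_itv /= -ler_norml (le_trans (norm_rV_coord y i)).
have cQ : compact Q by apply: (@rV_compact R n (fun=> `[- r, r]%classic)) => _;
  exact: segment_compact.
have Q0 : Q !=set0 by exists 0; apply/QE; rewrite normr0 ltW.
pose phi y := sqnorm (f (x y) - c).
have cphi : {within Q, continuous phi}.
  apply: continuous_in_subspaceT => y; rewrite inE => /QE yr.
  have sx : smooth_on setT x.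
    apply: smooth_onD; [exact: openT|exact: smooth_on_cst openT _ _|].
    apply: smooth_onD; [exact: openT|exact: smooth_on_cst openT _ _|].
    have s1 : smooth_on setT (fun y : 'rV[R]_n => \sum_i y ord0 i *: row i B).
      apply: smooth_on_sum => [|i]; first exact: openT.
      apply: smooth_on_scaler; first exact: openT.
      exact: smooth_on_coord openT (smooth_on_id openT).
    by apply: (smooth_on_eq openT _ s1) => w _; rewrite mulmx_sum_row.
  have oxU := open_preimage_smooth openT sx oU.
  have sx' := smooth_on_subset (@subsetT _ _) sx.
  have fR k := finite_coordinates_rV R k.
  have sfx := smooth_on_comp oxU (fR m) (fR n) oU (fun y h => proj2 h) (sx' _) sf.
  have sphi : smooth_on (setT `&` x @^-1` U) phi.
    apply: smooth_on_sum => // i; under eq_fun do rewrite expr2.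
    by apply: smooth_onM => //; apply: smooth_on_coord => //; apply: smooth_onD => //;
      exact: smooth_on_cst.
  by apply: (smooth_on_continuous sphi); split => //; apply: Ux; exact: le_trans r2.
have [y Qy ymin] := EVT_min_rV Q0 cQ cphi.
move: Qy; rewrite inE => /QE yr.
have y2 : `|y| <= 2 * r by exact: le_trans r2.
have yr' : `|y| < r.
  rewrite lt_neqAle yr andbT; apply/eqP => yE.
  have Q00 : 0 \in Q by rewrite inE; apply/QE; rewrite normr0 ltW.
  have h1 := ymin 0 Q00.
  have h2 := est 0 ltac:(by rewrite normr0 ltW).
  have h3 := est y yr.
  move: h2; rewrite normr0 addr0 subr0 => h2.
  have h4 : phi 0 <= n%:R * (t / 8) ^+ 2.
    apply: le_trans (sqnorm_le _) _; rewrite ler_wpM2l // ler_sqr ?nnegrE //.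
    by rewrite divr_ge0 // ltW.
  have h5 : n%:R * (t / 8) ^+ 2 <= r ^+ 2 / 64.
    have : n%:R * t <= r.
      by rewrite /t mulrCA ler_piMr ?(ltW r0) // ler_pdivrMr // mul1r ler_nat.
    by have := t0; nra.
  have h6 : r / 2 <= `|f (x y) - c|.
    have : `|y| <= `|f (x y) - c| + `|f (x y) - c - y|.
      rewrite -[X in `|X| <= _](subKr (f (x y) - c)); exact: ler_normB.
    by rewrite yE; rewrite yE in h3; lra.
  have h7 := sqnorm_ge (f (x y) - c).
  have h8 : (r / 2) ^+ 2 <= `|f (x y) - c| ^+ 2 by rewrite ler_sqr ?nnegrE // divr_ge0 // ltW.
  by move: h1; rewrite /phi in h4 *; nra.
set z := f (x y) - c.
have zE : z = 0.
  pose u := z *m B.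
  pose sg := (r - `|y|) / (1 + `|z|).
  have z1 : 0 < 1 + `|z| by rewrite ltr_pwDl.
  have sg0 : 0 < sg by rewrite divr_gt0 // subr_gt0.
  have xs s : x y + s *: u = x (y + s *: z).
    by rewrite /x /u (scalemxAl s z B) mulmxDl !addrA.
  have ys s : `|s| < sg -> `|y + s *: z| <= r.
    rewrite ltr_pdivlMr // => ssg; apply: le_trans (ler_normD _ _) _; rewrite normrZ.
    by have := normr_ge0 s; lra.
  have cr : \sum_i z ord0 i * 'd f (x y) u ord0 i = 0.
    apply: (@sqnorm_min_critical R m n f (x y) u c sg sg0) => s /ys syr; rewrite xs.
      by apply: smooth_on_differentiable sf _ (Ux _ _); exact: le_trans syr r2.
    by apply: ymin; rewrite inE; apply/QE.
  have du : `|'d f (x y) u - z| <= (2 * n.+1%:R * K)^-1 * `|u|.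
    by rewrite -[X in _ - X]BK; exact: dfx.
  have zz : sqnorm z = \sum_i z ord0 i * (z - 'd f (x y) u) ord0 i.
    rewrite -[LHS]subr0 -[X in _ - X = _]cr /sqnorm -sumrB; apply: eq_bigr => i _.
    by rewrite !mxE mulrBr expr2.
  have zz2 : sqnorm z <= n%:R * (`|z| * ((2 * n.+1%:R * K)^-1 * `|u|)).
    rewrite zz -[n in n%:R]card_ord -sum1_card natr_sum mulr_suml.
    apply: ler_sum => i _; rewrite mul1r; apply: le_trans (ler_norm _) _; rewrite normrM.
    apply: ler_pM => //; first exact: norm_rV_coord.
    by apply: le_trans (norm_rV_coord _ _) _; rewrite distrC.
  have uz : `|u| <= `|z| * K.
    apply: le_trans (norm_mulmx_le _ _) _; rewrite ler_wpM2l // /K -/KB.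
    by rewrite lerDr addr_ge0.
  have zz3 : sqnorm z <= `|z| ^+ 2 / 2.
    apply: le_trans zz2 _.
    apply: (@le_trans _ _ (n%:R * (`|z| * ((2 * n.+1%:R * K)^-1 * (`|z| * K))))).
      by rewrite !ler_wpM2l // ltW.
    have -> : n%:R * (`|z| * ((2 * n.+1%:R * K)^-1 * (`|z| * K))) =
      (n%:R / n.+1%:R) * (`|z| ^+ 2 / 2).
      by field; rewrite nat1r pnatr_eq0 /= gt_eqF.
    rewrite ler_piMl // ?divr_ge0 // ?sqr_ge0 // ler_pdivrMr // mul1r ler_nat.
    exact: leqnSn.
  have := sqnorm_ge z => zz4.
  have : `|z| ^+ 2 <= 0 by lra.
  by rewrite exprn_even_le0 //= normr_eq0 => /eqP.
exists (x y); split.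
- exact: Ux.
- rewrite /x -subr_eq0 addrC addKr; apply/eqP => h.
  have := congr1 ('d f x0) h; rewrite linearD linearZ /= dv scaler0 add0r BK linear0 => y0.
  move: h; rewrite y0 mul0mx addr0 => /eqP; rewrite scaler_eq0 (negPf v0) orbF.
  by rewrite gt_eqF.
- by apply/eqP; rewrite -subr_eq0; apply/eqP.
Qed.
End Fibres.

(** * Power series of one quaternionic variable *)

Section QuaternionTopology.
Variable R : realType.
Implicit Types (p q a b : quat R) (u v : nat -> quat R) (l : quat R).

Lemma norm_le_qnorm q : `|q| <= qnorm q.
Proof.
have := sqnorm_ge (q : 'rV[R]_4); rewrite (_ : sqnorm _ = qnorm2 q).
  by move=> h; rewrite -(ler_sqr (x := `|q|)) ?nnegrE ?sqrtr_ge0 // sqr_sqrtr // qnorm2_ge0.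
by apply: eq_bigr => i _; rewrite /qcoord inord_val.
Qed.

Lemma qnormM p q : qnorm (p * q) = qnorm p * qnorm q.
Proof. by rewrite /qnorm qnorm2M sqrtrM // qnorm2_ge0. Qed.

Lemma qnorm1 : qnorm (1 : quat R) = 1.
Proof. by rewrite /qnorm qnorm2E !qcoord_mk //= expr1n !expr0n /= !addr0 sqrtr1. Qed.

Lemma qnormX q n : qnorm (q ^+ n) = qnorm q ^+ n.
Proof. by elim: n => [|n IH]; rewrite ?expr0 ?qnorm1 // !exprS qnormM IH. Qed.

Lemma qnorm_ge0 q : 0 <= qnorm q. Proof. exact: sqrtr_ge0. Qed.

Lemma qnorm_eq0 q : (qnorm q == 0) = (q == 0).
Proof. by rewrite /qnorm sqrtr_eq0 -qnorm2_eq0 eq_le qnorm2_ge0 andbT. Qed.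

Lemma qnorm_conj q : qnorm (qconj q) = qnorm q.
Proof. by rewrite /qnorm qnorm2_conj. Qed.

Lemma qnormV q : q != 0 -> qnorm q^-1 = (qnorm q)^-1.
Proof.
move=> q0; have n0 : qnorm q != 0 by rewrite qnorm_eq0.
by apply: (mulIf n0); rewrite -qnormM mulVr ?qnorm1 ?mulVf.
Qed.

Lemma qnorm2_lt1 q : (qnorm q < 1) = (qnorm2 q < 1).
Proof.
have h : qnorm2 q = qnorm q ^+ 2 by rewrite /qnorm sqr_sqrtr // qnorm2_ge0.
by rewrite h expr_lt1 // qnorm_ge0.
Qed.

Lemma qmull_continuous a : continuous (fun q => a * q).
Proof.
move=> q; have := smooth_on_continuous (@smooth_on_qmul R _ setT openT (fun=> a) id
  (smooth_on_cst openT _) (smooth_on_id openT)); exact.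
Qed.

Lemma qmulr_continuous a : continuous (fun q => q * a).
Proof.
move=> q; have := smooth_on_continuous (@smooth_on_qmul R _ setT openT id (fun=> a)
  (smooth_on_id openT) (smooth_on_cst openT _)); exact.
Qed.

Lemma cvg_qmull a u (l : quat R) : u @ \oo --> l -> (fun n => a * u n) @ \oo --> a * l.
Proof. by move=> ul; apply: (@cvg_comp _ _ _ u (fun q => a * q) _ _ _ ul);
  exact: qmull_continuous. Qed.

Lemma cvg_qmulr a u (l : quat R) : u @ \oo --> l -> (fun n => u n * a) @ \oo --> l * a.
Proof. by move=> ul; apply: (@cvg_comp _ _ _ u (fun q => q * a) _ _ _ ul);
  exact: qmulr_continuous. Qed.

Lemma cvg_qnorm0 u : (fun n => qnorm (u n)) @ \oo --> (0 : R) -> u @ \oo --> (0 : quat R).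
Proof.
move=> /cvgr0Pnorm_lt h; apply/cvgr0Pnorm_lt => e e0.
have := h e e0; apply: filterS => n; rewrite ger0_norm ?qnorm_ge0 //.
exact: le_lt_trans (norm_le_qnorm _).
Qed.

End QuaternionTopology.

Section PowerSeriesUniqueness.
Variable R : realType.
Implicit Types (s t : nat -> quat R).

Lemma qreal_exp (x : R) n : (x%:A : quat R) ^+ n = (x ^+ n)%:A.
Proof. by rewrite exprZn expr1n. Qed.

(** Convergence at [x = 1/2] bounds the coefficients by [M 2^n], so that for
    [x <= 1/4] the tail of the series is at most [4 M x], and [x] tends to [0]. *)
Lemma real_series_head0 s :
  (forall x : R, 0 < x < 1 -> series (fun n => x ^+ n *: s n) @ \oo --> (0 : quat R)) ->
  s 0%N = 0.
Proof.
move=> s0.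
have h01 : 0 < (2^-1 : R) < 1 by lra.
have /cvgr0Pnorm_lt/(_ 1 ltr01) := cvg_series_cvg_0 (cvgP _ (s0 _ h01)).
move=> [N _ sN].
have [M M0 sM] : exists2 M : R, 0 <= M & forall n, `|s n| <= M * 2 ^+ n.
  exists (1 + \sum_(k < N) `|s k|); first by rewrite addr_ge0 // sumr_ge0.
  move=> n; have [nN|Nn] := ltnP n N.
    apply: (@le_trans _ _ (`|s n|)) => //.
    apply: (@le_trans _ _ (1 + \sum_(k < N) `|s k|)).
      by rewrite (bigD1 (Ordinal nN)) //= addrCA lerDl addr_ge0 // sumr_ge0.
    rewrite ler_peMr ?addr_ge0 ?sumr_ge0 //.
    by rewrite exprn_ege1 // ler1n.
  have := sN n Nn; rewrite /= normrZ ger0_norm ?exprn_ge0 // => h.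
  have e2 : 0 < (2 : R) ^+ n by rewrite exprn_gt0.
  apply: (@le_trans _ _ (2 ^+ n)).
    by move: h; rewrite exprVn mulrC ltr_pdivrMr // mul1r => /ltW.
  by rewrite ler_peMl ?(ltW e2) // lerDl sumr_ge0.
apply/eqP; rewrite -normr_eq0 eq_le normr_ge0 andbT; apply/ler_addgt0Pr => e e0.
rewrite add0r.
pose x : R := Num.min (1 / 4) (e / (8 * (M + 1))).
have M1 : 0 < M + 1 by rewrite ltr_wpDl.
have x0 : 0 < x by rewrite lt_min !divr_gt0 // mulr_gt0.
have x4 : x <= 1 / 4 by rewrite ge_min lexx.
have xe : x * (4 * M) <= e / 2.
  have : x <= e / (8 * (M + 1)) by rewrite ge_min lexx orbT.
  by rewrite ler_pdivlMr ?mulr_gt0 //; nra.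
have x01 : 0 < x < 1 by lra.
have e20 : 0 < e / 2 by rewrite divr_gt0.
have /cvgr0Pnorm_lt/(_ _ e20)[N' _ sN'] := s0 x x01.
have := sN' N'.+1 (leqnSn _); rewrite /series /= big_mkord big_ord_recl /= expr0 scale1r.
set T := (X in `|_ + X|) => hT.
have : `|s 0%N| <= `|s 0%N + T| + `|T|.
  by rewrite -[X in `|X| <= _](addrK T); exact: ler_normB.
suff : `|T| <= x * (4 * M) by lra.
apply: le_trans (ler_norm_sum _ _ _) _.
have g2 : forall k, \sum_(i < k) (2^-1 : R) ^+ i <= 2.
  move=> k; suff -> : \sum_(i < k) (2^-1 : R) ^+ i = 2 - 2 * 2^-1 ^+ k.
    by rewrite gerBl mulr_ge0 // exprn_ge0.
  elim: k => [|k IH]; first by rewrite big_ord0 expr0 mulr1 subrr.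
  by rewrite big_ord_recr /= IH exprS; lra.
apply: (@le_trans _ _ (\sum_(i < N') (2 * M * x) * 2^-1 ^+ i)); last first.
  rewrite -mulr_sumr (_ : x * (4 * M) = 2 * M * x * 2); last by ring.
  by rewrite ler_wpM2l // !mulr_ge0 // ltW.
apply: ler_sum => i _; rewrite /bump leq0n add1n normrZ (ger0_norm (exprn_ge0 _ (ltW x0))).
apply: (@le_trans _ _ (x ^+ i.+1 * (M * 2 ^+ i.+1))).
  by rewrite ler_wpM2l // exprn_ge0 // ltW.
have -> : x ^+ i.+1 * (M * 2 ^+ i.+1) = (2 * M * x) * (2 * x) ^+ i.
  by rewrite !exprS exprMn; ring.
rewrite ler_wpM2l ?mulr_ge0 ?(ltW x0) // lerXn2r ?nnegrE ?mulr_ge0 ?(ltW x0) //.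
by lra.
Qed.

(** After removal of a vanishing head the series is divided by [x]. *)
Lemma real_series_coef0 s :
  (forall x : R, 0 < x < 1 -> series (fun n => x ^+ n *: s n) @ \oo --> (0 : quat R)) ->
  forall n, s n = 0.
Proof.
move=> h n; elim: n s h => [|n IH] s h; first exact: real_series_head0.
apply: (IH (fun k => s k.+1)) => x x01.
have s00 := real_series_head0 h.
have x0 : x != 0 by move: x01 => /andP[x0 _]; rewrite gt_eqF.
have := h x x01; rewrite -(cvg_shiftS (series _)) => /(cvgZl_tmp (k := x^-1)).
rewrite scaler0; apply: cvg_trans; apply: near_eq_cvg; near=> k.
rewrite /series /= !big_mkord big_ord_recl /= s00 scaler0 add0r scaler_sumr.
by apply: eq_bigr => i _; rewrite scalerA /bump /= add1n exprS mulKf.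
Unshelve. all: by end_near. Qed.

(** Real points suffice: there the powers of [q] are scalars. *)
Lemma has_expansion_unique f s t : has_expansion f s -> has_expansion f t -> s = t.
Proof.
move=> hs ht; apply/funext => n; apply/eqP; rewrite -subr_eq0; apply/eqP.
apply: (real_series_coef0 (s := fun n => s n - t n)) => x /andP[x0 x1].
have q1 : qnorm (x%:A : quat R) < 1.
  rewrite qnorm2_lt1 qnorm2E !qcoordZ !qcoord_mk //= !mulr0 mulr1 !expr0n /= !addr0.
  by rewrite expr_lt1 // ltW.
have h := cvgB (hs _ q1) (ht _ q1); rewrite subrr in h.
have e : series (fun n => x ^+ n *: (s n - t n)) =
    series (pseries_terms s x%:A) - series (pseries_terms t x%:A) :> (nat -> quat R).
  apply: funext => k; rewrite /series /= !fctE /= -sumrB.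
  by apply: eq_bigr => i _; rewrite /pseries_terms qreal_exp !mulr_algl scalerBr.
rewrite e; exact: h.
Qed.

Lemma expansionE f s : has_expansion f s -> expansion f = s.
Proof.
move=> hs; apply: (has_expansion_unique _ hs).
exact: (@xgetPex _ _ (has_expansion f) (ex_intro _ s hs)).
Qed.

End PowerSeriesUniqueness.

(** * The geometric series with noncommuting ratio *)

Section QuaternionAlgebra.
Variable R : realType.
Implicit Types p q x y : quat R.

Lemma qunitE q : (q \is a GRing.unit) = (q != 0). Proof. by []. Qed.

Lemma qmulVr q : q != 0 -> q^-1 * q = 1. Proof. by move=> q0; rewrite mulVr. Qed.

Lemma qmulrV q : q != 0 -> q * q^-1 = 1. Proof. by move=> q0; rewrite mulrV. Qed.

Lemma qmul_eq0 p q : (p * q == 0) = (p == 0) || (q == 0).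
Proof. by rewrite -!qnorm_eq0 qnormM mulf_eq0. Qed.

Lemma qinvM p q : p != 0 -> q != 0 -> (p * q)^-1 = q^-1 * p^-1.
Proof. by move=> p0 q0; rewrite invrM. Qed.

Lemma qinv_neq0 q : q != 0 -> q^-1 != 0.
Proof. by move=> q0; rewrite -qunitE unitrV. Qed.

Lemma qadd_conj p : p + qconj p = (2 * qcoord p 0)%:A.
Proof. by apply: quatP; rewrite qcoordD qcoordZ !qcoord_mk //=; ring. Qed.

Lemma qconjV q : q != 0 -> qconj q^-1 = (qconj q)^-1.
Proof.
move=> q0; have c0 : qconj q != 0 by rewrite -qnorm_eq0 qnorm_conj qnorm_eq0.
have e : qconj q^-1 * qconj q = 1 by rewrite -qconjM qmulrV // qconj1.
by rewrite -[LHS](mulrK (c0 : qconj q \is a GRing.unit)) e mul1r.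
Qed.

Lemma qconj_eq0 q : (qconj q == 0) = (q == 0).
Proof. by rewrite -!qnorm_eq0 qnorm_conj. Qed.

Lemma one_sub_neq0 q p : qnorm q < 1 -> qnorm p < 1 -> 1 - q * p != 0.
Proof.
move=> q1 p1; rewrite subr_eq0; apply/eqP => /(congr1 (@qnorm R)).
rewrite qnorm1 qnormM => e.
have := mulr_ilt1 (qnorm_ge0 q) (qnorm_ge0 p) q1 p1.
by rewrite -e ltxx.
Qed.
End QuaternionAlgebra.

Section GeometricSeries.
Variable R : realType.
Implicit Types p q : quat R.

(** At [q] a *-quotient of [f] and [g] is the quotient of the values of [f] and [g]
    at [f^c(q)^-1 q f^c(q)], where [f^c] is the regular conjugate; this is that point
    for [f = 1 - q p]. *)
Definition twist p q : quat R :=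
  (1 - q * qconj p)^-1 * q * (1 - q * qconj p).

Lemma qnorm_twist p q : qnorm p < 1 -> qnorm q < 1 -> qnorm (twist p q) = qnorm q.
Proof.
move=> p1 q1; have y0 : 1 - q * qconj p != 0 by rewrite one_sub_neq0 ?qnorm_conj.
rewrite /twist !qnormM qnormV // mulrAC mulVf ?mul1r //.
by rewrite qnorm_eq0.
Qed.

(** This is [1 - q (p + p^c) + q^2 (p^c p)], with [p^c] the conjugate of [p]: a
    polynomial in [q] with real coefficients, the symmetrization of [1 - q p]. *)
Lemma geometric_denominator p q : let y := 1 - q * qconj p in
  GRing.comm q (y - q * y * p).
Proof.
move=> y.
have -> : y - q * y * p = 1 - (2 * qcoord p 0) *: q + qnorm2 p *: (q * q).
  rewrite /y mulrBr mulr1 mulrBl opprB -!addrA; congr (_ + _).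
  rewrite !mulrA -(mulrA (q * q)) qconj_mull mulr_algr [_ *: _ - _]addrC addrA -opprD -mulrDr.
  by rewrite [_ + p]addrC qadd_conj mulr_algr.
set t := 2 * _; rewrite /GRing.comm mulrDr mulrDl mulrBr mulrBl mul1r mulr1.
by rewrite -!scalerAl -!scalerAr mulrA.
Qed.

Lemma geometric_denominatorE p q : qnorm p < 1 -> qnorm q < 1 ->
  let y := 1 - q * qconj p in
  y - q * y * p = y * (1 - twist p q * p) /\ y - q * y * p != 0.
Proof.
move=> p1 q1 y; have y0 : y != 0 by rewrite one_sub_neq0 ?qnorm_conj.
have e : y - q * y * p = y * (1 - twist p q * p).
  rewrite /twist -/y; move: (y) y0 => z z0.
  by rewrite mulrBr mulr1 !mulrA qmulrV // mul1r.
split => //; rewrite e qmul_eq0 negb_or y0 /= one_sub_neq0 ?qnorm_twist //.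
Qed.

(** With [N = y - q y p], which commutes with [q], one has
    [N q^n p^n = q^n y p^n - q^(n+1) y p^(n+1)], so [N] times the partial sums
    telescopes to [y - q^n y p^n]; and [N^-1 y] is the limit. *)
Lemma cvg_geometric_twist p q : qnorm p < 1 -> qnorm q < 1 ->
  (fun n => \sum_(k < n) q ^+ k * p ^+ k) @ \oo --> (1 - twist p q * p)^-1.
Proof.
move=> p1 q1; have [] := geometric_denominatorE p1 q1.
set y := 1 - q * qconj p; set N := y - q * y * p => NE N0.
have y0 : y != 0 by rewrite one_sub_neq0 ?qnorm_conj.
have t0 : 1 - twist p q * p != 0 by rewrite one_sub_neq0 ?qnorm_twist.
have Nq n : N * q ^+ n = q ^+ n * N.
  by apply/esym/commr_sym/commrX/commr_sym; exact: geometric_denominator.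
have step z n : q ^+ n * (z - q * z * p) * p ^+ n =
    q ^+ n * z * p ^+ n - q ^+ n.+1 * z * p ^+ n.+1.
  by rewrite mulrBr mulrBl exprSr exprS !mulrA.
have tel n : N * \sum_(k < n) q ^+ k * p ^+ k = y - q ^+ n * y * p ^+ n.
  have {step} : forall k, N * (q ^+ k * p ^+ k) =
      q ^+ k * y * p ^+ k - q ^+ k.+1 * y * p ^+ k.+1.
    by move=> k; rewrite mulrA Nq; exact: step.
  move: {NE N0 Nq y0} N (y) => M z step.
  elim: n => [|n IH]; first by rewrite big_ord0 !expr0 mulr0 mul1r mulr1 subrr.
  by rewrite big_ord_recr mulrDr IH step addrA subrK.
have -> : (1 - twist p q * p)^-1 = N^-1 * (y - 0).
  by rewrite subr0 NE qinvM // -mulrA qmulVr // mulr1.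
have -> : (fun n => \sum_(k < n) q ^+ k * p ^+ k) =
    (fun n => N^-1 * (y - q ^+ n * y * p ^+ n)).
  by apply/funext => n; rewrite -tel mulrA qmulVr // mul1r.
apply: cvg_qmull; apply: (@cvgB _ _ _ _ _ (fun=> y) (fun n => q ^+ n * y * p ^+ n));
  first exact: cvg_cst.
apply: cvg_qnorm0.
have -> : (fun n => qnorm (q ^+ n * y * p ^+ n)) = (fun n => qnorm y * (qnorm q * qnorm p) ^+ n).
  by apply/funext => n; rewrite !qnormM !qnormX exprMn; ring.
rewrite -[X in _ --> X](mulr0 (qnorm y)).
apply: cvgM; first exact: cvg_cst.
apply: cvg_expr; rewrite ger0_norm ?mulr_ge0 ?qnorm_ge0 //.
by apply: mulr_ilt1; rewrite ?qnorm_ge0.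
Qed.
End GeometricSeries.

(** * Expansion of slice regular Moebius transformations *)

Section MobiusExpansion.
Variable R : realType.
Implicit Types a b c d p q : quat R.

Definition affine_coef a b (n : nat) : quat R :=
  if n is k.+1 then (if k is 0 then a else 0) else b.

Lemma cvg_pseries_finite (s : nat -> quat R) N q : (forall n, (N <= n)%N -> s n = 0) ->
  series (pseries_terms s q) @ \oo --> \sum_(k < N) q ^+ k * s k.
Proof.
move=> s0; apply: cvg_near_cst; near=> n.
have Nn : (N <= n)%N by near: n; exact: nbhs_infty_ge.
rewrite /series /= (big_cat_nat (leq0n N) Nn) /=.
rewrite big_mkord [X in _ + X](_ : _ = 0) ?addr0 // big_nat_cond big1 //.
by move=> i /andP[/andP[Ni _] _]; rewrite /pseries_terms s0 // mulr0.
Unshelve. all: by end_near. Qed.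

Lemma pseries_sumE (s : nat -> quat R) q l :
  series (pseries_terms s q) @ \oo --> l -> pseries_sum s q = l.
Proof. by move=> h; apply: cvg_lim => //; exact: norm_hausdorff. Qed.

Lemma has_expansion_affine a b : has_expansion (affine a b) (affine_coef a b).
Proof.
move=> q _; have := @cvg_pseries_finite (affine_coef a b) 2 q.
rewrite !big_ord_recl big_ord0 /= expr0 mul1r addr0 expr1 addrC.
by apply => -[|[|n]].
Qed.

Lemma regular_conj_affine a b q :
  regular_conj (affine a b) q = affine (qconj a) (qconj b) q.
Proof.
apply: pseries_sumE; rewrite (expansionE (@has_expansion_affine a b)).
have := @cvg_pseries_finite (fun n => qconj (affine_coef a b n)) 2 q.
rewrite !big_ord_recl big_ord0 /= expr0 mul1r addr0 expr1 addrC /affine.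
by apply => -[|[|n]] // _; rewrite /= qconj0.
Qed.

(** The shape of the right-hand side is the one to which the factorisation
    [qconj d + q * qconj c = y * qconj d] in [star_inv_affine] applies. *)
Lemma symmetrization_affine c d q : symmetrization (affine c d) q =
  (qconj d + q * qconj c) * d + q * (qconj d + q * qconj c) * c.
Proof.
have he : has_expansion (regular_conj (affine c d)) (affine_coef (qconj c) (qconj d)).
  move=> x x1; rewrite regular_conj_affine; exact: has_expansion_affine.
apply: pseries_sumE; rewrite (expansionE (@has_expansion_affine c d)) (expansionE he).
set s := (fun n => _).
have sE : forall n, (3 <= n)%N -> s n = 0.
  move=> n n3; rewrite /s big1 // => -[[|[|k]] kn] _ /=; rewrite ?mul0r //.
    by case: n n3 {kn} => [|[|n]] // _; rewrite subn0 /= mulr0.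
  by case: n n3 {kn} => [|[|[|n]]] // _; rewrite subn1 /= mulr0.
have := @cvg_pseries_finite s 3 q sE.
rewrite !big_ord_recl big_ord0 /= /s !big_ord_recl !big_ord0 /=.
rewrite /bump /= !(addr0, mul0r, mulr0, add0r) expr0 mul1r expr1.
suff -> : d * qconj d + (q * (d * qconj c + c * qconj d) + q ^+ (1 + 1) * (c * qconj c)) =
  (qconj d + q * qconj c) * d + q * (qconj d + q * qconj c) * c by [].
have -> : d * qconj c + c * qconj d = qconj c * d + qconj d * c.
  by rewrite !qmulE; apply: quatP; rewrite !qcoordD !qcoord_mk //=; ring.
rewrite qconj_mulr -qconj_mull qconj_mulr -qconj_mull.
by rewrite !(mulrDr, mulrDl) expr2 !mulrA !addrA.
Qed.

Lemma ratio_lt1 c d : qnorm c < qnorm d -> qnorm (- (d^-1 * c)) < 1.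
Proof.
move=> cd; have d0 : d != 0.
  by rewrite -qnorm_eq0 gt_eqF // (le_lt_trans (qnorm_ge0 c)).
rewrite -mulNr qnormM -mulN1r qnormM qnormV //.
have -> : qnorm (- 1 : quat R) = 1.
  by rewrite /qnorm qnorm2E !qcoordN !qcoord_mk //= !oppr0 sqrrN expr1n !expr0n /= !addr0 sqrtr1.
by rewrite mul1r mulrC ltr_pdivrMr ?mul1r // (le_lt_trans (qnorm_ge0 c)).
Qed.

(** The symmetrization is [qnorm2 d] times the denominator [y - q y p] of the
    geometric series of ratio [p], and the regular conjugate is
    [y * qconj d]. *)
Lemma star_inv_affine c d q : qnorm c < qnorm d -> qnorm q < 1 ->
  let p := - (d^-1 * c) in
  star_inv (affine c d) q = (1 - twist p q * p)^-1 * d^-1.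
Proof.
move=> cd q1 p; have p1 : qnorm p < 1 := ratio_lt1 cd.
have d0 : d != 0 by rewrite -qnorm_eq0 gt_eqF // (le_lt_trans (qnorm_ge0 c)).
have [] := geometric_denominatorE p1 q1.
set y := 1 - q * qconj p => NE N0.
have t0 : 1 - twist p q * p != 0.
  by apply: contraNneq N0; rewrite NE => ->; rewrite mulr0.
have yd : y * qconj d = qconj d + q * qconj c.
  rewrite /y /p qconjN qconjM qconjV // mulrN opprK mulrDl mul1r -!mulrA.
  by rewrite qmulVr ?mulr1 // qconj_eq0.
have dV : d^-1 = (qnorm2 d)^-1 *: qconj d by [].
have nd0 : qnorm2 d != 0 by rewrite qnorm2_eq0.
rewrite /star_inv regular_conj_affine /affine addrC -yd.
have sE : symmetrization (affine c d) q = qnorm2 d *: (y - q * y * p).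
  rewrite symmetrization_affine -yd -(mulrA y) qconj_mull mulr_algr.
  rewrite (scalerBr (qnorm2 d) y (q * y * p)); congr (_ + _).
  rewrite /p mulrN -scalerN opprK dV -scalerAl -scalerAr scalerA mulfV // scale1r.
  by rewrite !mulrA.
have s0 : symmetrization (affine c d) q != 0 by rewrite sE scaler_eq0 negb_or nd0.
apply: (can_inj (mulKr (s0 : symmetrization (affine c d) q \is a GRing.unit))).
rewrite mulVKr // sE NE -scalerAl mulrA -(mulrA y) qmulrV // mulr1 dV.
by rewrite -scalerAr scalerA mulfV // scale1r.
Qed.

Lemma has_expansion_star_inv c d : qnorm c < qnorm d ->
  has_expansion (star_inv (affine c d)) (fun n => (- (d^-1 * c)) ^+ n * d^-1).
Proof.
move=> cd q q1; rewrite (star_inv_affine cd q1).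
have -> : series (pseries_terms (fun n => (- (d^-1 * c)) ^+ n * d^-1) q) =
   (fun n => (\sum_(k < n) q ^+ k * (- (d^-1 * c)) ^+ k) * d^-1) :> (nat -> quat R).
  apply: funext => n; rewrite /series /= big_mkord mulr_suml.
  by apply: eq_bigr => k _; rewrite /pseries_terms mulrA.
exact/cvg_qmulr/cvg_geometric_twist/q1/ratio_lt1.
Qed.

Definition mobius_coef a b c d (n : nat) : quat R :=
  (- (d^-1 * c)) ^+ n * (d^-1 * b) +
  (if n is k.+1 then (- (d^-1 * c)) ^+ k * (d^-1 * a) else 0).

(** The two parts of the coefficients give [G (d^-1 b)] and [q G (d^-1 a)] with
    [G] the sum of the geometric series, and [q G = G T] for the twisted point
    [T]. *)
Lemma mobius_series a b c d q : qnorm c < qnorm d -> qnorm q < 1 ->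
  let p := - (d^-1 * c) in
  series (pseries_terms (mobius_coef a b c d) q) @ \oo -->
    (1 - twist p q * p)^-1 * (d^-1 * b + twist p q * (d^-1 * a)).
Proof.
move=> cd q1 p; have p1 : qnorm p < 1 := ratio_lt1 cd.
have G := cvg_geometric_twist p1 q1.
have [] := geometric_denominatorE p1 q1.
set y := 1 - q * qconj p; set N := y - q * y * p => NE N0.
have t0 : 1 - twist p q * p != 0 by rewrite one_sub_neq0 ?qnorm_twist.
have y0 : y != 0 by rewrite one_sub_neq0 ?qnorm_conj.
have GE : (1 - twist p q * p)^-1 = N^-1 * y.
  by rewrite NE qinvM // -mulrA qmulVr // mulr1.
have qG : (1 - twist p q * p)^-1 * twist p q = q * (1 - twist p q * p)^-1.
  rewrite GE /twist -/y !mulrA mulrK //; congr (_ * _).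
  by apply/esym/commrV; exact: geometric_denominator.
rewrite mulrDr [in X in _ + X]mulrA qG.
rewrite -(cvg_shiftS (series _)).
have -> : [sequence series (pseries_terms (mobius_coef a b c d) q) n.+1]_n =
   (fun n => (\sum_(k < n.+1) q ^+ k * p ^+ k) * (d^-1 * b)) +
   (fun n => q * (\sum_(k < n) q ^+ k * p ^+ k) * (d^-1 * a)) :> (nat -> quat R).
  apply: funext => n; rewrite /series /= big_mkord fctE !mulr_suml mulr_sumr mulr_suml.
  under eq_bigr => k _ do rewrite /pseries_terms /mobius_coef mulrDr.
  rewrite big_split /=; congr (_ + _).
    by apply: eq_bigr => k _; rewrite mulrA.
  rewrite big_ord_recl /= mulr0 add0r; apply: eq_bigr => k _.
  by rewrite exprS !mulrA.
apply: cvgD; first by apply: cvg_qmulr; rewrite (cvg_shiftS (fun n =>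
  \sum_(k < n) q ^+ k * p ^+ k)).
by apply: cvg_qmulr; apply: cvg_qmull.
Qed.

Lemma star_coef a b c d : qnorm c < qnorm d ->
  (fun n => \sum_(k < n.+1) expansion (star_inv (affine c d)) k *
     expansion (affine a b) (n - k)%N) = mobius_coef a b c d.
Proof.
move=> cd; apply/funext => n.
rewrite (expansionE (@has_expansion_affine a b)) (expansionE (has_expansion_star_inv cd)).
rewrite big_ord_recr /= subnn /= /mobius_coef mulrA addrC; congr (_ + _).
case: n => [|n]; first by rewrite big_ord0.
rewrite big_ord_recr /= subSnn /= big1 ?add0r ?mulrA // => k _.
by rewrite /= subSn ?(ltnW (ltn_ord k)) // -subnSK //= mulr0.
Qed.

End MobiusExpansion.

(** * Moebius transformations and cosets *)

Section Sp11Entries.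
Variable R : realType.
Implicit Types (A B : sp11 R) (a b c d u : quat R).

Lemma ord2_ind (P : 'I_2 -> Prop) : P 0 -> P 1 -> forall i, P i.
Proof.
move=> P0 P1 [[|[|//]] ilt].
  by rewrite (_ : Ordinal ilt = 0) //; exact: val_inj.
by rewrite (_ : Ordinal ilt = 1) //; exact: val_inj.
Qed.

Lemma mx2_eq (M N : 'M[quat R]_2) : M 0 0 = N 0 0 -> M 0 1 = N 0 1 ->
  M 1 0 = N 1 0 -> M 1 1 = N 1 1 -> M = N.
Proof.
by move=> h00 h01 h10 h11; apply/matrixP; apply: ord2_ind; apply: ord2_ind.
Qed.

Lemma I11_formE (M N : 'M[quat R]_2) i j :
  (M *m I11 R *m N) i j = M i 0 * N 0 j - M i 1 * N 1 j.
Proof.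
rewrite mxE !big_ord_recl big_ord0 addr0 /= mul_mx_diag !mxE /=.
rewrite expr0 expr1 mulr1 mulrN1 mulNr.
by rewrite (_ : lift ord0 ord0 = 1) //; exact: val_inj.
Qed.

Lemma sp11_eq A B : val A 0 0 = val B 0 0 -> val A 0 1 = val B 0 1 ->
  val A 1 0 = val B 1 0 -> val A 1 1 = val B 1 1 -> A = B.
Proof. by move=> *; apply: val_inj; exact: mx2_eq. Qed.

Lemma I11E : [/\ I11 R 0 0 = 1, I11 R 0 1 = 0, I11 R 1 0 = 0 & I11 R 1 1 = -1].
Proof. by split; rewrite !mxE /= ?mulr1n ?mulr0n ?expr0 ?expr1. Qed.

Lemma sp11_relations A : let: (a, c, b, d) := sp11_entries A in
  [/\ qnorm2 a = qnorm2 d, qnorm2 b = qnorm2 c, qnorm2 d = 1 + qnorm2 c,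
      qconj a * c = qconj b * d & a * qconj b = c * qconj d].
Proof.
rewrite /sp11_entries.
have [i00 i01 i10 i11] := I11E.
have AA := valP A; have /eqP h := AA; have h' := is_sp11_ctr AA.
have := congr1 (fun M : 'M[quat R]_2 => M 0 0) h;
  rewrite /= I11_formE i00 !mxE !qconj_mull => e00.
have := congr1 (fun M : 'M[quat R]_2 => M 1 1) h;
  rewrite /= I11_formE i11 !mxE !qconj_mull => e11.
have := congr1 (fun M : 'M[quat R]_2 => M 0 1) h; rewrite /= I11_formE i01 !mxE => /subr0_eq e01.
have := congr1 (fun M : 'M[quat R]_2 => M 0 0) h';
  rewrite /= I11_formE i00 !mxE !qconj_mulr => f00.
have := congr1 (fun M : 'M[quat R]_2 => M 0 1) h'; rewrite /= I11_formE i01 !mxE => /subr0_eq f01.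
have g00 : qnorm2 (val A 0 0) - qnorm2 (val A 1 0) = 1.
  by apply: qalg_inj; rewrite scalerBl scale1r.
have g11 : qnorm2 (val A 0 1) - qnorm2 (val A 1 1) = -1.
  by apply: qalg_inj; rewrite scalerBl scaleN1r.
have k00 : qnorm2 (val A 0 0) - qnorm2 (val A 0 1) = 1.
  by apply: qalg_inj; rewrite scalerBl scale1r.
by split => //; lra.
Qed.

Definition mx2 a c b d : 'M[quat R]_2 :=
  \matrix_(i, j) if i == 0 then (if j == 0 then a else c) else (if j == 0 then b else d).

Lemma is_sp11_mx2 a c b d : qnorm2 a = 1 + qnorm2 b -> qnorm2 d = 1 + qnorm2 c ->
  qconj a * c = qconj b * d -> is_sp11 (mx2 a c b d).
Proof.
have [i00 i01 i10 i11] := I11E.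
move=> ha hd hac; apply/eqP; apply: mx2_eq; rewrite I11_formE ?i00 ?i01 ?i10 ?i11 !mxE /=.
- by rewrite !qconj_mull -scalerBl ha addrK scale1r.
- by rewrite hac subrr.
- by have := congr1 (@qconj R) hac; rewrite !qconjM !qconjK => ->; rewrite subrr.
- by rewrite !qconj_mull -scalerBl hd opprD addrCA subrr addr0 scaleN1r.
Qed.

Lemma is_sp11_scalar u : qnorm u = 1 -> is_sp11 (u%:M : 'M[quat R]_2).
Proof.
move=> u1; have u2 : qnorm2 u = 1.
  by rewrite -[qnorm2 u]sqr_sqrtr ?qnorm2_ge0 // -/(qnorm u) u1 expr1n.
rewrite (_ : u%:M = mx2 u 0 0 u); last by apply: mx2_eq; rewrite !mxE.
have z0 : qnorm2 (0 : quat R) = 0 by apply/eqP; rewrite qnorm2_eq0.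
by apply: is_sp11_mx2; rewrite ?u2 ?z0 ?addr0 // mulr0 qconj0 mul0r.
Qed.

Definition sp1 u (u1 : qnorm u = 1) : sp11 R :=
  exist (fun M => is_true (is_sp11 M)) u%:M (is_sp11_scalar u1).

Lemma sp1I_sp1 u (u1 : qnorm u = 1) : sp1I (sp1 u1).
Proof. by exists u. Qed.

Lemma sp1I_scalar_entries A B : sp1I B -> exists2 u, qnorm u = 1 &
  forall i j, val (B * A)%g i j = u * val A i j.
Proof. by move=> [u u1 Bu]; exists u => // i j; rewrite /= Bu mul_scalar_mx mxE. Qed.

Lemma sp1IV B : sp1I B -> sp1I (B^-1)%g.
Proof.
move=> [u u1 Bu]; have c1 : qnorm (qconj u) = 1 by rewrite qnorm_conj.
exists (qconj u) => //; suff -> : (B^-1)%g = sp1 c1 by [].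
apply: (mulIg B); rewrite mulVg; apply: val_inj; rewrite /= Bu -scalar_mxM.
by rewrite qconj_mull -[qnorm2 u]sqr_sqrtr ?qnorm2_ge0 // -/(qnorm u) u1 expr1n scale1r.
Qed.

Lemma left_coset_eqP A A' :
  left_coset A = left_coset A' <-> exists2 B, sp1I B & A' = (A * B)%g.
Proof.
have one1 : sp1I (1%g : sp11 R).
  exists 1; first exact: qnorm1.
  by [].
split=> [e|[B [u u1 Bu] ->]].
  have : left_coset A' A' by exists 1%g => //; rewrite mulg1.
  by rewrite -e => -[B hB <-]; exists B.
have mulI B1 B2 : sp1I B1 -> sp1I B2 -> sp1I (B1 * B2)%g.
  move=> [v v1 Bv] [w w1 Bw]; exists (v * w); first by rewrite qnormM v1 w1 mulr1.
  by rewrite /= Bv Bw -scalar_mxM.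
have hB : sp1I B by exists u.
apply/seteqP; split => x [C hC <-].
  exists (B^-1 * C)%g; first by apply: mulI => //; exact: sp1IV.
  by rewrite mulgA mulgK.
by exists (B * C)%g; [exact: mulI|rewrite mulgA].
Qed.

End Sp11Entries.

Section MobiusBall.
Variable R : realType.
Implicit Types (A B : sp11 R) (a b c d p q u : quat R).

Lemma qnorm2D p q : qnorm2 (p + q) = qnorm2 p + qnorm2 q + 2 * qcoord (p * qconj q) 0.
Proof. by rewrite qmulE !qnorm2E !qcoordD !qcoord_mk //=; ring. Qed.

Lemma sp11_d_neq0 A : val A 1 1 != 0.
Proof.
have [_ _ h _ _] := sp11_relations A; rewrite -qnorm2_eq0 h.
by rewrite gt_eqF // ltr_wpDr // qnorm2_ge0.
Qed.

Lemma sp11_c_lt_d A : qnorm (val A 0 1) < qnorm (val A 1 1).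
Proof.
have [_ _ h _ _] := sp11_relations A.
by rewrite ltr_sqrt h ?ltrDr // ltr_wpDr // qnorm2_ge0.
Qed.

Definition mobius_coefs A := mobius_coef (val A 0 0) (val A 1 0) (val A 0 1) (val A 1 1).

Lemma mobiusE A : mobius A = pseries_sum (mobius_coefs A).
Proof. by rewrite /mobius /star star_coef // sp11_c_lt_d. Qed.

Lemma mobius_value A q : qnorm q < 1 -> let d1 := (val A 1 1)^-1 in
  let T := twist (- (d1 * val A 0 1)) q in
  mobius A q = (1 + T * (d1 * val A 0 1))^-1 * (d1 * val A 1 0 + T * (d1 * val A 0 0)).
Proof.
move=> q1 d1 T; rewrite mobiusE.
rewrite (pseries_sumE (@mobius_series _ _ _ _ _ _ (sp11_c_lt_d A) q1)).
by rewrite mulrN opprK.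
Qed.

Lemma has_expansion_mobius A : has_expansion (mobius A) (mobius_coefs A).
Proof.
move=> q q1; have h := @mobius_series _ (val A 0 0) (val A 1 0) _ _ _ (sp11_c_lt_d A) q1.
by rewrite mobiusE (pseries_sumE h).
Qed.

(** After division of the entries by [d] on the left, the difference between the
    squared moduli of denominator and numerator is
    [(1 - |T|^2) (1 - |d^-1 c|^2)]: the cross terms agree because
    [(d^-1 a) (d^-1 b)^c = d^-1 c], where [x^c] is the conjugate of [x]. *)
Lemma mobius_ball A q : qnorm q < 1 -> qnorm (mobius A q) < 1.
Proof.
move=> q1; rewrite (mobius_value A q1); set d := val A 1 1; set c := val A 0 1.
have [/= ad bc dc _ abcd] := sp11_relations A; rewrite -/d -/c in ad bc dc abcd.
have d0 : d != 0 := sp11_d_neq0 A.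
set T := twist _ _.
have T1 : qnorm2 T < 1.
  rewrite -qnorm2_lt1 /T qnorm_twist //; exact/ratio_lt1/sp11_c_lt_d.
have nd0 : 0 < qnorm2 d by rewrite dc ltr_wpDr // qnorm2_ge0.
have dV1 : qnorm2 d^-1 * qnorm2 d = 1.
  by rewrite -qnorm2M qmulVr // qnorm2E !qcoord_mk //= expr1n !expr0n /= !addr0.
have na : qnorm2 (d^-1 * val A 0 0) = 1 by rewrite qnorm2M ad.
have nb : qnorm2 (d^-1 * val A 1 0) = qnorm2 (d^-1 * c) by rewrite !qnorm2M bc.
have nc : qnorm2 (d^-1 * c) < 1.
  rewrite qnorm2M -dV1 ltr_pM2l; first by rewrite dc ltrDr.
  by rewrite lt_neqAle qnorm2_ge0 andbT eq_sym qnorm2_eq0 qinv_neq0.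
have ab : (d^-1 * val A 0 0) * qconj (d^-1 * val A 1 0) = d^-1 * c.
  rewrite qconjM qconjV // -!mulrA (mulrA (val A 0 0)) abcd -mulrA mulrV ?mulr1 //.
  by rewrite qunitE qconj_eq0.
have lt : qnorm2 (d^-1 * val A 1 0 + T * (d^-1 * val A 0 0)) < qnorm2 (1 + T * (d^-1 * c)).
  rewrite [X in qnorm2 X < _]addrC [X in _ < qnorm2 X]addrC !qnorm2D -mulrA ab qconj1 mulr1.
  rewrite !(qnorm2M T) na nb.
  have n1 : qnorm2 (1 : quat R) = 1 by rewrite qnorm2E !qcoord_mk //= expr1n !expr0n /= !addr0.
  by rewrite n1; nra.
have z0 : 0 < qnorm (1 + T * (d^-1 * c)).
  by rewrite sqrtr_gt0 (le_lt_trans _ lt) // qnorm2_ge0.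
rewrite qnormM qnormV -?qnorm_eq0 ?gt_eqF // mulrC ltr_pdivrMr // mul1r.
by rewrite ltr_sqrt // (le_lt_trans _ lt) // qnorm2_ge0.
Qed.

(** Left multiplication by [u] replaces every entry [x] by [u x], which leaves
    [d^-1 a], [d^-1 b] and [d^-1 c] unchanged. *)
Lemma mobius_sp1I A B : sp1I B -> mobius (B * A)%g = mobius A.
Proof.
move=> hB; have [u u1 BE] := sp1I_scalar_entries A hB.
have u0 : u != 0 by rewrite -qnorm_eq0 u1 oner_eq0.
have d0 := sp11_d_neq0 A.
have can x : (u * val A 1 1)^-1 * (u * x) = (val A 1 1)^-1 * x.
  by rewrite qinvM // -mulrA mulKr.
rewrite !mobiusE /mobius_coefs; congr pseries_sum.
by apply/funext => n; rewrite /mobius_coef !BE !can.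
Qed.

(** The coefficients of degree 0, 1 and 2 are [d^-1 b], [e1] and [- d^-1 c e1],
    where [e1 = d^-1 (a^c)^-1] is nonzero, [a^c] being the conjugate of [a]. They
    determine [d^-1 b], [d^-1 c] and [d^-1 a], hence [A] up to the left factor
    [u = d' d^-1], whose modulus is forced by [|d|^2 = 1 + |c|^2]. *)
Lemma mobius_inj A A' : (forall q, qnorm q < 1 -> mobius A q = mobius A' q) ->
  exists2 B, sp1I B & A' = (B * A)%g.
Proof.
move=> AA'.
have ce : mobius_coefs A = mobius_coefs A'.
  apply: (has_expansion_unique (f := mobius A)); first exact: has_expansion_mobius.
  by move=> q q1; rewrite (AA' q q1); exact: has_expansion_mobius.
have := congr1 (fun s : nat -> quat R => s 0%N) ce.
have := congr1 (fun s : nat -> quat R => s 1%N) ce.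
have := congr1 (fun s : nat -> quat R => s 2%N) ce.
rewrite /mobius_coefs /mobius_coef /= !expr0 !expr1 !mul1r !addr0 !expr2 -!mulrA -!mulrDr.
set d := val A 1 1; set d' := val A' 1 1; set e1 := (_ + _ as X in _ * X = _ -> _).
move=> h2 h1 h0.
have d0 : d != 0 := sp11_d_neq0 A.
have d0' : d' != 0 := sp11_d_neq0 A'.
have [/= ad bc dc acbd _] := sp11_relations A; rewrite -/d in ad dc acbd.
have [/= _ _ dc' _ _] := sp11_relations A'; rewrite -/d' in dc'.
have e10 : e1 != 0.
  suff h : qconj (val A 0 0) * (d * e1) = 1.
    apply/eqP => e10; move: h; rewrite e10 !mulr0 => /eqP.
    by rewrite eq_sym oner_eq0.
  have -> : d * e1 = val A 0 0 - val A 0 1 * (d^-1 * val A 1 0).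
    by rewrite /e1 mulrDr mulNr mulrN -mulrA mulVKr // mulVKr // addrC.
  rewrite mulrBr mulrA acbd -mulrA mulVKr // !qconj_mull -scalerBl.
  by rewrite ad bc dc addrK scale1r.
rewrite -h1 in h2; have hc : d^-1 * val A 0 1 = d'^-1 * val A' 0 1.
  by apply: oppr_inj; apply: (mulIr (e10 : e1 \is a GRing.unit)).
have ha : d^-1 * val A 0 0 = d'^-1 * val A' 0 0.
  by move: h1; rewrite /e1 h0 hc => /addrI.
pose u := d' * d^-1.
have hu x x' : d^-1 * x = d'^-1 * x' -> x' = u * x.
  by move=> e; rewrite /u -mulrA e mulVKr.
have u2 : qnorm2 u = 1.
  have := dc'; rewrite (hu _ _ hc) (_ : d' = u * d); last by rewrite /u -mulrA mulVr // mulr1.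
  by rewrite !qnorm2M dc; lra.
have u1 : qnorm u = 1 by rewrite /qnorm u2 sqrtr1.
exists (sp1 u1); first exact: sp1I_sp1.
apply: sp11_eq; rewrite /= mul_scalar_mx mxE; [exact: hu|exact: hu|exact: hu|].
by rewrite /u -mulrA mulVr // mulr1.
Qed.

End MobiusBall.

(** * Submersions and dimensions *)

Section SmoothMapsOfManifolds.
Variable R : realType.

Lemma embedded_smooth_map (V W : normedModType R) (X Y : Type) (eX : X -> V) (eY : Y -> W)
    (M : manifold R X) (N : manifold R Y) (f : X -> Y) (O : set V) (F : V -> W) :
  finite_coordinates V -> finite_coordinates W ->
  submanifold eX M -> submanifold eY N ->
  open O -> (forall x, O (eX x)) -> smooth_on O F -> (forall x, F (eX x) = eY (f x)) ->
  smooth_map M N f.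
Proof.
move=> fV fW sM sN oO Oe sF FE c d; rewrite sM sN => cM dN.
by apply: (embedded_smooth_coord_rep fV fW cM dN) => x _ _; exists O, F.
Qed.

(** The differential of a section is a right inverse of the differential. *)
Lemma submersion_of_sections (X Y : Type) (M : manifold R X) (N : manifold R Y) (f : X -> Y) :
  smooth_map M N f ->
  (forall x, exists s, [/\ smooth_map N M s, cancel s f & s (f x) = x]) ->
  submersion M N f.
Proof.
move=> sf sec; split => // c d g cM dN [og sg gE] u [x [cx dfx] <-].
have [s [ss sK sfx]] := sec x.
have [k [ok sk kE]] := ss d c dN cM.
have dD : coord_dom s d c (d (f x)) by exists (f x) => //; split => //=; rewrite sfx.
have kd : k (d (f x)) = c x by rewrite kE // sfx.
rewrite -kd; apply: local_section_surjective.
- exact: smooth_on_differentiable sk _ dD.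
- by rewrite kd; apply: (smooth_on_differentiable sg); exists x.
- apply: filterS (open_nbhs_nbhs (conj ok dD)) => _ [y [dy cy] <-].
  by rewrite kE // gE ?sK // /mkset sK.
Qed.

Lemma diffeomorphism_mdim (X Y : Type) (M : manifold R X) (N : manifold R Y) (f : X ->
  Y) (x : X) :
  diffeomorphism M N f -> mdim M = mdim N.
Proof.
move=> [sf [h [fK hK sh]]].
have [c cM cx] := atlas_cover M x; have [d dN dfx] := atlas_cover N (f x).
have [g [og sg gE]] := sf c d cM dN; have [k [ok sk kE]] := sh d c dN cM.
have cD : coord_dom f c d (c x) by exists x.
have dD : coord_dom h d c (d (f x)) by exists (f x) => //; split => //=; rewrite fK.
have gx : g (c x) = d (f x) by exact: gE.
have kx : k (d (f x)) = c x by rewrite kE ?fK.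
apply/eqP; rewrite eqn_leq; apply/andP; split.
  apply: (surjective_linear_leq (L := 'd k (g (c x)))).
  apply: local_section_surjective.
  - exact: smooth_on_differentiable sg _ cD.
  - by rewrite gx; exact: smooth_on_differentiable sk _ dD.
  - apply: filterS (open_nbhs_nbhs (conj og cD)) => _ [y [cy dfy] <-].
    by rewrite gE // kE ?fK // /mkset fK.
apply: (surjective_linear_leq (L := 'd g (k (d (f x))))).
apply: local_section_surjective.
- exact: smooth_on_differentiable sk _ dD.
- by rewrite kx; exact: smooth_on_differentiable sg _ cD.
- apply: filterS (open_nbhs_nbhs (conj ok dD)) => _ [y [dy chy] <-].
  by rewrite kE // gE ?hK // /mkset hK.
Qed.

(** Read in a chart of [N0] and a chart of [N], the identity of [Y] is [f \o s],
    hence smooth and injective. Since [f] read in [N] is [f] read in [N0] followed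
    by this map, the map inherits a surjective differential from the submersion
    [f]; by [submersion_fibre] its source and target have the same dimension. *)
Lemma submersion_mdim (X Y : Type) (M : manifold R X) (N N0 : manifold R Y) (f : X -> Y)
    (s : Y -> X) (y : Y) :
  submersion M N f -> smooth_map M N0 f -> smooth_map N0 M s -> cancel s f ->
  mdim N = mdim N0.
Proof.
move=> [sf subm] sf0 ss sK.
have [d0 d0N d0y] := atlas_cover N0 y.
have [c cM csy] := atlas_cover M (s y).
have [d dN dy] := atlas_cover N y.
have [k [ok sk kE]] := ss d0 c d0N cM.
have [g repg] := sf c d cM dN; have [og sg gE] := repg.
have [g0 [og0 sg0 g0E]] := sf0 c d0 cM d0N.
have [_ ic] := atlas_chart cM; have [_ id_] := atlas_chart dN.
pose D := coord_dom s d0 c `&` k @^-1` coord_dom f c d.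
have oD : open D by exact: open_preimage_smooth.
have DE u : D u -> exists2 z, u = d0 z & [/\ chart_dom d0 z, chart_dom c (s z),
  chart_dom d z & g (k u) = d z].
  move=> [[z [d0z csz] <-]]; rewrite /= kE // => -[x [cx dfx] cxz].
  have xE : x = s z by apply: ic => //; exact: mem_set.
  have dz : chart_dom d z by move: dfx; rewrite xE /preimage /mkset sK.
  by exists z => //; split => //; rewrite gE ?sK.
have DI z : chart_dom d0 z -> chart_dom c (s z) -> chart_dom d z -> D (d0 z).
  move=> d0z csz dz; split; first by exists z.
  by rewrite /= kE //; exists (s z) => //; split => //=; rewrite sK.
have sphi : smooth_on D (fun u => g (k u)).
  have fR n := finite_coordinates_rV R n.
  apply: (smooth_on_comp oD (fR _) (fR _) og (fun u h => proj2 h) _ sg).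
  by apply: smooth_on_subset sk => u [].
have Du0 : D (d0 y) by exact: DI.
have ku0 : k (d0 y) = c (s y) by exact: kE.
have g0c : g0 (c (s y)) = d0 y by rewrite g0E ?sK.
have cD : coord_dom f c d (c (s y)) by exists (s y) => //; split => //=; rewrite sK.
have cD0 : coord_dom f c d0 (c (s y)) by exists (s y) => //; split => //=; rewrite sK.
have dg0 := smooth_on_differentiable sg0 cD0.
have dphi : differentiable (fun u => g (k u)) (g0 (c (s y))).
  by rewrite g0c; exact: smooth_on_differentiable sphi _ Du0.
(* f read in the charts c, d is the transition from d0 to d after f read in c, d0 *)
have surj : set_surj setT setT ('d (fun u => g (k u)) (d0 y)).
  move=> z _; have [v _ vz] := subm c d g cM dN repg _ cD z I.
  exists ('d g0 (c (s y)) v) => //; rewrite -vz -g0c.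
  transitivity ('D_v ((fun u => g (k u)) \o g0) (c (s y))).
    by rewrite (deriveE _ (differentiable_comp dg0 dphi)) (diff_comp dg0 dphi).
  rewrite -(deriveE _ (smooth_on_differentiable sg cD)).
  apply: near_eq_derive.
  have := open_preimage_smooth og0 sg0 oD.
  move=> oE; have : (coord_dom f c d0 `&` g0 @^-1` D) (c (s y)).
    by split => //=; rewrite g0c.
  move=> /(conj oE) /open_nbhs_nbhs; apply: filterS => _ [[x [cx d0fx] <-]] /=.
  rewrite g0E // => /DE[z' e [d0z csz dz ->]].
  have [_ id0] := atlas_chart d0N.
  have zE : f x = z' by apply: id0 => //; exact: mem_set.
  by rewrite gE ?zE.
have le1 := surjective_linear_leq surj.
apply/eqP; rewrite eqn_leq le1 /= leqNgt; apply/negP => lt1.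
have [u [Du uu0 phiu]] := submersion_fibre oD sphi Du0 surj lt1.
have [z uE [d0z csz dz gz]] := DE u Du.
move: phiu; rewrite gz; have [z1 e1 [d0z1 _ dz1 ->]] := DE _ Du0 => e.
have [_ id0] := atlas_chart d0N.
have zz1 : z = z1 by apply: id_ => //; exact: mem_set.
by move: uu0; rewrite uE zz1 e1 eqxx.
Qed.

End SmoothMapsOfManifolds.

(** * Transport of a manifold structure along a bijection *)

Section Transport.
Variables (R : realType) (X Y : Type) (f : X -> Y) (h : Y -> X).
Hypotheses (fK : cancel f h) (hK : cancel h f).

Definition pull n (c : chart R Y n) : chart R X n := Chart (f @^-1` chart_dom c) (c \o f).

Definition push n (c : chart R X n) : chart R Y n := Chart (h @^-1` chart_dom c) (c \o h).

Lemma pushK n (c : chart R X n) : pull (push c) = c.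
Proof.
case: c => D m; rewrite /pull /push; congr Chart; apply/funext => x.
  by rewrite /preimage /mkset /= fK.
by rewrite /= fK.
Qed.

Lemma pull_image n (c : chart R Y n) (A : set Y) : pull c @` (f @^-1` A) = c @` A.
Proof.
apply/seteqP; split => _ [x Ax <-]; first by exists (f x).
by exists (h x); rewrite /= /preimage /mkset /= hK.
Qed.

Lemma is_chart_pull n (c : chart R Y n) : is_chart (pull c) <-> is_chart c.
Proof.
rewrite /is_chart (pull_image c (chart_dom c)).
split=> -[oc ic]; split => // x y.
  move=> /set_mem cx /set_mem cy cxy; rewrite -(hK x) -(hK y); congr f.
  by apply: ic; rewrite ?inE /preimage /mkset /= ?hK //= !hK.
move=> /set_mem cx /set_mem cy cxy; rewrite -(fK x) -(fK y); congr h.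
by apply: ic; rewrite ?inE.
Qed.

Lemma smooth_coord_rep_pull m n (Z : Type) (c : chart R Y m) (d : chart R Z n) (phi : Y -> Z) g :
  smooth_coord_rep (phi \o f) (pull c) d g <-> smooth_coord_rep phi c d g.
Proof.
have e : coord_dom (phi \o f) (pull c) d = coord_dom phi c d.
  exact: (pull_image c (chart_dom c `&` phi @^-1` chart_dom d)).
rewrite /smooth_coord_rep e; split=> -[oD sg gE]; split => // x.
  by move=> cx dx; have := gE (h x); rewrite /= /preimage /mkset /= hK; apply.
exact: gE.
Qed.

Lemma smooth_coord_rep_pull2 m n (c : chart R Y m) (d : chart R Y n) g :
  smooth_coord_rep id (pull c) (pull d) g <-> smooth_coord_rep id c d g.
Proof. exact: (smooth_coord_rep_pull c d id). Qed.

Lemma smooth_coord_rep_pullr m n (d : chart R Y m) (c : chart R Y n) g :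
  smooth_coord_rep h d (pull c) g <-> smooth_coord_rep id d c g.
Proof.
have e : coord_dom h d (pull c) = coord_dom id d c.
  by rewrite /coord_dom; congr (_ @` (_ `&` _)); apply/funext => y;
    rewrite /preimage /mkset /= hK.
rewrite /smooth_coord_rep e; split=> -[oD sg gE]; split => // y.
  by move=> dy cy; have := gE y dy; rewrite /= /preimage /mkset /= hK; apply.
by rewrite /= /preimage /mkset /= hK => dy cy; exact: gE.
Qed.

Lemma compatible_pull n (c d : chart R Y n) : compatible (pull c) (pull d) <-> compatible c d.
Proof.
split=> -[[g1 /smooth_coord_rep_pull2 h1] [g2 /smooth_coord_rep_pull2 h2]]; split;
  by [exists g1|exists g2].
Qed.

Variable Q : manifold R X.

(** The existential hides that the two dimensions are the same number, whence the
    cast. *)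
Lemma transported_manifold : exists T : manifold R Y,
  exists e : mdim T = mdim Q, forall c : chart R Y (mdim T),
    atlas T c <-> atlas Q (ecast n (chart R X n) e (pull c)).
Proof.
pose At : set (chart R Y (mdim Q)) := [set c | atlas Q (pull c)].
have chartT c : At c -> is_chart c by move/atlas_chart/is_chart_pull.
have coverT y : exists2 c, At c & chart_dom c y.
  have [c cQ cy] := atlas_cover Q (h y).
  by exists (push c); rewrite /At /= ?pushK.
have compT c d : At c -> At d -> compatible c d.
  by move=> cQ dQ; apply/compatible_pull; exact: atlas_compatible.
have maxT c : is_chart c -> (forall d, At d -> compatible c d) -> At c.
  move=> cc cd; apply: atlas_maximal; first exact/is_chart_pull.
  move=> d dQ; rewrite -(pushK d); apply/compatible_pull/cd.
  by rewrite /At /= pushK.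
have openT (U : set X) : atlas_open (atlas Q) U -> atlas_open At (h @^-1` U).
  move=> oU c cQ; rewrite -(pull_image c).
  rewrite (_ : f @^-1` _ = chart_dom (pull c) `&` U); first exact: oU.
  by apply/funext => x; rewrite /preimage /mkset /setI /mkset /= fK.
have openQ (U : set Y) : atlas_open At U -> atlas_open (atlas Q) (f @^-1` U).
  move=> oU c cQ; have := oU (push c); rewrite -(pull_image (push c)) pushK.
  rewrite (_ : f @^-1` (chart_dom (push c) `&` U) = chart_dom c `&` f @^-1` U).
    by apply; rewrite /At /= pushK.
  by apply/funext => x; rewrite /preimage /mkset /setI /mkset /= fK.
have hausT x y : x <> y -> exists U V : set Y, [/\ atlas_open At U, atlas_open At V,
    U x, V y & U `&` V = set0].
  move=> xy; have [|U [V [oU oV Ux Vy UV]]] := @atlas_hausdorff _ _ Q (h x) (h y).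
    by move=> e; apply: xy; rewrite -(hK x) e hK.
  exists (h @^-1` U), (h @^-1` V); split => //; try exact: openT.
  by rewrite -preimage_setI UV preimage_set0.
have scT : exists B : nat -> set Y, (forall i, atlas_open At (B i)) /\
    (forall U x, atlas_open At U -> U x -> exists i, B i x /\ B i `<=` U).
  have [B [oB hB]] := atlas_second_countable Q.
  exists (fun i => h @^-1` B i); split => [i|U x oU Ux]; first exact: openT.
  have [|i [Bx BU]] := hB _ (h x) (openQ _ oU); first by rewrite /preimage /mkset hK.
  by exists i; split => // y /BU; rewrite /preimage /mkset hK.
by exists (Manifold chartT coverT compT maxT hausT scT), erefl.
Qed.

Lemma transported_diffeomorphism (T : manifold R Y) (e : mdim T = mdim Q) :
  (forall c : chart R Y (mdim T), atlas T c <-> atlas Q (ecast n (chart R X n) e (pull c))) ->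
  diffeomorphism Q T f.
Proof.
move: T e; case => n At /= ch cov comp mx ha sc; case: Q => m AQ /= chQ covQ compQ mxQ haQ scQ e.
case: _ / e in ch cov comp mx ha sc AQ chQ covQ compQ mxQ haQ scQ * => /= AtE.
split=> [c d cQ /AtE dT|]; first by have [] := compQ _ _ cQ dT.
exists h; split => // c d /AtE cT dQ.
have [[g rg] _] := compQ _ _ cT dQ.
exists g; apply/smooth_coord_rep_pull.
by rewrite (_ : h \o f = id) //; apply/funext => x /=; rewrite fK.
Qed.

(** Both atlases are maximal, so it suffices that the charts of one are compatible
    with those of the other; the representations of [f] and [h] in charts of [M] and
    [Q] are the transition maps between charts of [M] and transported charts. *)
Lemma diffeomorphism_unique (T : manifold R Y) (e : mdim T = mdim Q) (M : manifold R Y) :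
  (forall c : chart R Y (mdim T), atlas T c <-> atlas Q (ecast n (chart R X n) e (pull c))) ->
  mdim M = mdim Q -> diffeomorphism Q M f -> T = M.
Proof.
move: T e M; case => n At /= ch cov comp mx ha sc.
case: Q => m AQ chQ covQ compQ mxQ haQ scQ /= e.
case: _ / e in AQ chQ covQ compQ mxQ haQ scQ * => M /= AtE.
move: M; case => k AM chM covM compM mxM haM scM /= ek; subst k.
move=> [/= sf [h' [fK' hK' sh']]].
have hh' : h' = h by apply/funext => y; rewrite -[in LHS](hK y) fK'.
subst h'.
have AE : At = AM.
  apply/seteqP; split => c.
    move/AtE => /= cQ; apply: (mxM); first exact/is_chart_pull/chQ.
    move=> d dM; split.
      have [g rg] := sf _ d cQ dM; exists g.
      exact/(smooth_coord_rep_pull c d id).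
    have [g rg] := sh' d _ dM cQ; exists g.
    exact/smooth_coord_rep_pullr.
  move=> cM; apply/AtE => /=; apply: (mxQ); first exact/is_chart_pull/chM.
  move=> d dQ; split.
    have [g rg] := sh' c d cM dQ; exists g.
    have := (smooth_coord_rep_pull c d h g).2 rg.
    by rewrite (_ : h \o f = id) //; apply/funext => x /=; rewrite fK.
  have [g rg] := sf d c dQ cM; exists g.
  exact: rg.
subst AM; congr Manifold; exact: Prop_irrelevance.
Qed.

End Transport.

(** * The Cayley transform of the unit sphere *)

Section Cayley.
Variable R : realType.
Implicit Types (w u v z : quat R).

(** Stereographic projection of the unit sphere from [- w0] onto the imaginary
    quaternions. *)
Definition cayley w0 w : quat R := (w0^-1 * w - 1) * (w0^-1 * w + 1)^-1.

Definition cayley_inv w0 v : quat R := w0 * ((1 + v) * (1 - v)^-1).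

Lemma q2_neq0 : (2 : quat R) != 0.
Proof.
apply/eqP => /(congr1 (fun q => qcoord q 0)).
rewrite (_ : (2 : quat R) = 1 + 1) ?mulr2n // qcoordD qcoord0 !qcoord_mk //=.
by move/eqP; rewrite paddr_eq0 // oner_eq0.
Qed.

Lemma imag_conj v : qcoord v 0 = 0 -> qconj v = - v.
Proof. by move=> v0; apply: quatP; rewrite qcoordN qcoord_mk //= v0 oppr0. Qed.

Lemma imag_of_conj v : v + qconj v = 0 -> qcoord v 0 = 0.
Proof.
rewrite qadd_conj => /(congr1 (fun q => qcoord q 0)).
rewrite qcoordZ qcoord0 qcoord_mk //= mulr1 => /eqP.
by rewrite mulf_eq0 pnatr_eq0 /= => /eqP.
Qed.

Lemma imag_neq v : qcoord v 0 = 0 -> 1 - v != 0 /\ 1 + v != 0.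
Proof.
move=> v0; split; apply/eqP => /(congr1 (fun q => qcoord q 0));
  rewrite qcoordD ?qcoordN v0 qcoord0 qcoord_mk //= ?oppr0 addr0 => /eqP;
  by rewrite oner_eq0.
Qed.

Lemma cayley_domain w0 w : w0 != 0 -> w + w0 != 0 -> w0^-1 * w + 1 != 0.
Proof.
move=> w00; apply: contra => /eqP e; have := congr1 (fun z => w0 * z) e.
by rewrite /= mulr0 mulrDr mulVKr // mulr1 => ->.
Qed.

Lemma q2C z : 2 * z = z * 2.
Proof. by rewrite mulr2n mulrDl mulrDr mul1r mulr1. Qed.

Lemma q2E z : 2 * z = z + z.
Proof. by rewrite mulr2n mulrDl mul1r. Qed.

Lemma q2_ratioK z t : t != 0 -> 2 * z * t^-1 * (2 * t^-1)^-1 = z.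
Proof.
move=> t0; rewrite qinvM ?q2_neq0 ?qinv_neq0 // invrK mulrA -(mulrA (2 * z)) mulVr // mulr1.
by rewrite q2C mulrK // qunitE q2_neq0.
Qed.

Lemma cayleyK w0 w : w0 != 0 -> w + w0 != 0 -> cayley_inv w0 (cayley w0 w) = w.
Proof.
move=> w00 ww; have z0 := cayley_domain w00 ww; rewrite /cayley_inv /cayley.
set z := w0^-1 * w in z0 *; have -> : w = w0 * z by rewrite mulVKr.
congr (_ * _).
have e1 : 1 + (z - 1) * (z + 1)^-1 = 2 * z * (z + 1)^-1.
  rewrite -[X in X + _](qmulrV z0) -mulrDl; congr (_ * _).
  by rewrite q2E; apply: quatP; rewrite !(qcoordD, qcoordN); ring.
have e2 : 1 - (z - 1) * (z + 1)^-1 = 2 * (z + 1)^-1.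
  rewrite -[X in X - _](qmulrV z0) -mulrBl; congr (_ * _).
  by rewrite mulr2n; apply: quatP; rewrite !(qcoordD, qcoordN); ring.
by rewrite e1 e2 q2_ratioK.
Qed.

Lemma cayley_invK w0 v : w0 != 0 -> qcoord v 0 = 0 -> cayley w0 (cayley_inv w0 v) = v.
Proof.
move=> w00 v0; have [v1 _] := imag_neq v0; rewrite /cayley /cayley_inv mulKr //.
have e1 : (1 + v) * (1 - v)^-1 - 1 = 2 * v * (1 - v)^-1.
  rewrite -[X in _ - X](qmulrV v1) -mulrBl; congr (_ * _).
  by rewrite q2E; apply: quatP; rewrite !(qcoordD, qcoordN); ring.
have e2 : (1 + v) * (1 - v)^-1 + 1 = 2 * (1 - v)^-1.
  by rewrite -[X in _ + X](qmulrV v1) -mulrDl addrACA subrr addr0 -mulr2n.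
by rewrite e1 e2 q2_ratioK.
Qed.

Lemma qnorm_cayley_inv w0 v : qnorm w0 = 1 -> qcoord v 0 = 0 -> qnorm (cayley_inv w0 v) = 1.
Proof.
move=> w01 v0; have [v1 _] := imag_neq v0.
rewrite /cayley_inv !qnormM w01 mul1r qnormV // -[1 + v]qconjK qconjD (imag_conj v0) qconj1.
by rewrite qnorm_conj mulfV // qnorm_eq0.
Qed.

Lemma cayley_inv_domain w0 v : w0 != 0 -> qcoord v 0 = 0 -> cayley_inv w0 v + w0 != 0.
Proof.
move=> w00 v0; have [v1 _] := imag_neq v0.
rewrite /cayley_inv -[X in _ + X]mulr1 -mulrDr qmul_eq0 negb_or w00 /=.
rewrite -[X in _ + X](qmulrV v1) -mulrDl addrACA subrr addr0 -mulr2n.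
by rewrite qmul_eq0 negb_or q2_neq0 qinv_neq0.
Qed.

(** With [z = w0^-1 w] of modulus one and [t = z + 1], multiplying twice the real
    part of [(z - 1) t^-1] by the conjugate of [t] on the left and by [t] on the right
    gives [2 (z^c z - 1) = 0], where [z^c] is the conjugate of [z]. *)
Lemma cayley_imag w0 w : qnorm w0 = 1 -> qnorm w = 1 -> w + w0 != 0 ->
  qcoord (cayley w0 w) 0 = 0.
Proof.
move=> w01 w1 ww.
have w00 : w0 != 0 by rewrite -qnorm_eq0 w01 oner_eq0.
have z0 := cayley_domain w00 ww; rewrite /cayley; set z := w0^-1 * w in z0 *.
have z1 : qconj z * z = 1.
  have : qnorm z = 1 by rewrite qnormM qnormV // w01 w1 invr1 mulr1.
  by rewrite qconj_mull -[qnorm2 z]sqr_sqrtr ?qnorm2_ge0 // -/(qnorm z) => ->;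
    rewrite expr1n scale1r.
apply: imag_of_conj.
have c0 : qconj (z + 1) != 0 by rewrite qconj_eq0.
have : qconj (z + 1) * ((z - 1) * (z + 1)^-1 + qconj ((z - 1) * (z + 1)^-1)) * (z + 1) = 0.
  have gen t X : qconj t * (X + qconj X) * t = qconj t * (X * t) + qconj (X * t) * t.
    by rewrite mulrDr mulrDl qconjM !mulrA.
  rewrite gen mulrVK // !qconjD qconjN qconj1.
  rewrite !(mulrDl, mulrDr) !mul1r !mulr1 mulrN1 mulN1r z1.
  by apply: quatP; rewrite !(qcoordD, qcoordN, qcoord0); ring.
by move/eqP; rewrite !qmul_eq0 (negPf z0) (negPf c0) /= orbF => /eqP.
Qed.

End Cayley.

(** * Coordinate vectors of quaternions *)

Section Rows.
Variable R : realType.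

Definition row_entry n (r : 'rV[R]_n.+1) k : R := r ord0 (inord k).
Definition row_of_seq n (s : seq R) : 'rV[R]_n.+1 := \row_i s`_i.

Lemma row_entry_of_seq n s k : (k < n.+1)%N -> row_entry (row_of_seq n s) k = s`_k.
Proof. by move=> kn; rewrite /row_entry mxE inordK. Qed.

Lemma row_entryP n (r r' : 'rV[R]_n.+1) :
  (forall k, (k < n.+1)%N -> row_entry r k = row_entry r' k) -> r = r'.
Proof. by move=> h; apply/rowP => i; have := h i (ltn_ord i); rewrite /row_entry inord_val. Qed.

Lemma smooth_on_row_entry (V : normedModType R) (U : set V) n (f : V -> 'rV[R]_n.+1) k :
  open U -> smooth_on U f -> smooth_on U (fun x => row_entry (f x) k).
Proof. exact: smooth_on_coord. Qed.

Lemma smooth_on_row_of_seq (V : normedModType R) (U : set V) n (s : V -> seq R) : open U ->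
  (forall k, (k < n.+1)%N -> smooth_on U (fun x => (s x)`_k)) ->
  smooth_on U (fun x => row_of_seq n (s x)).
Proof.
move=> oU ss; apply: smooth_on_rV => // i; under eq_fun do rewrite mxE.
exact: ss.
Qed.

Lemma smooth_on_mkquat (V : normedModType R) (U : set V) (f0 f1 f2 f3 : V -> R) : open U ->
  smooth_on U f0 -> smooth_on U f1 -> smooth_on U f2 -> smooth_on U f3 ->
  smooth_on U (fun x => mkquat (f0 x) (f1 x) (f2 x) (f3 x)).
Proof. by move=> oU *; apply: smooth_on_quat => //; under eq_fun do rewrite qcoord_mk //=. Qed.

Definition row_p n (r : 'rV[R]_n.+1) : quat R :=
  mkquat (row_entry r 0) (row_entry r 1) (row_entry r 2) (row_entry r 3).
Definition row_v n (r : 'rV[R]_n.+1) : quat R :=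
  mkquat 0 (row_entry r 4) (row_entry r 5) (row_entry r 6).
Definition row_w n (r : 'rV[R]_n.+1) : quat R :=
  mkquat 0 (row_entry r 7) (row_entry r 8) (row_entry r 9).

Definition row7 (p v : quat R) : 'rV[R]_7 :=
  row_of_seq 6 [:: qcoord p 0; qcoord p 1; qcoord p 2; qcoord p 3; qcoord v 1; qcoord v 2;
    qcoord v 3].

Definition row10 (p v w : quat R) : 'rV[R]_10 :=
  row_of_seq 9 [:: qcoord p 0; qcoord p 1; qcoord p 2; qcoord p 3; qcoord v 1; qcoord v 2;
    qcoord v 3;
             qcoord w 1; qcoord w 2; qcoord w 3].

Lemma row7_p p v : row_p (row7 p v) = p.
Proof. by apply: quatP; rewrite qcoord_mk //= row_entry_of_seq. Qed.
Lemma row7_v p v : qcoord v 0 = 0 -> row_v (row7 p v) = v.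
Proof. by move=> v0; apply: quatP; rewrite qcoord_mk //= ?row_entry_of_seq. Qed.
Lemma row10_p p v w : row_p (row10 p v w) = p.
Proof. by apply: quatP; rewrite qcoord_mk //= row_entry_of_seq. Qed.
Lemma row10_v p v w : qcoord v 0 = 0 -> row_v (row10 p v w) = v.
Proof. by move=> v0; apply: quatP; rewrite qcoord_mk //= ?row_entry_of_seq. Qed.
Lemma row10_w p v w : qcoord w 0 = 0 -> row_w (row10 p v w) = w.
Proof. by move=> v0; apply: quatP; rewrite qcoord_mk //= ?row_entry_of_seq. Qed.

Lemma row7K (r : 'rV[R]_7) : row7 (row_p r) (row_v r) = r.
Proof.
by apply: row_entryP => -[|[|[|[|[|[|[|//]]]]]]] k7; rewrite row_entry_of_seq //= qcoord_mk.
Qed.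
Lemma row10K (r : 'rV[R]_10) : row10 (row_p r) (row_v r) (row_w r) = r.
Proof.
by apply: row_entryP => -[|[|[|[|[|[|[|[|[|[|//]]]]]]]]]] k7;
  rewrite row_entry_of_seq //= qcoord_mk.
Qed.
Lemma row_v_imag n (r : 'rV[R]_n.+1) : qcoord (row_v r) 0 = 0.
Proof. by rewrite qcoord_mk. Qed.
Lemma row_w_imag n (r : 'rV[R]_n.+1) : qcoord (row_w r) 0 = 0.
Proof. by rewrite qcoord_mk. Qed.

Section Smooth.
Variables (V : normedModType R) (U : set V).
Hypothesis oU : open U.

Lemma smooth_on_row_p n (f : V -> 'rV[R]_n.+1) : smooth_on U f ->
  smooth_on U (fun x => row_p (f x)).
Proof. by move=> sf; apply: smooth_on_mkquat => //; exact: smooth_on_row_entry. Qed.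

Lemma smooth_on_row_v n (f : V -> 'rV[R]_n.+1) : smooth_on U f ->
  smooth_on U (fun x => row_v (f x)).
Proof.
move=> sf; apply: smooth_on_mkquat => //; try exact: smooth_on_row_entry.
exact: smooth_on_cst.
Qed.

Lemma smooth_on_row_w n (f : V -> 'rV[R]_n.+1) : smooth_on U f ->
  smooth_on U (fun x => row_w (f x)).
Proof.
move=> sf; apply: smooth_on_mkquat => //; try exact: smooth_on_row_entry.
exact: smooth_on_cst.
Qed.

Lemma smooth_on_row7 (p v : V -> quat R) : smooth_on U p -> smooth_on U v ->
  smooth_on U (fun x => row7 (p x) (v x)).
Proof.
move=> sp sv; apply: smooth_on_row_of_seq => //.
by move=> -[|[|[|[|[|[|[|//]]]]]]] _ /=; exact: smooth_on_qcoord.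
Qed.

Lemma smooth_on_row10 (p v w : V -> quat R) : smooth_on U p -> smooth_on U v -> smooth_on U w ->
  smooth_on U (fun x => row10 (p x) (v x) (w x)).
Proof.
move=> sp sv sw; apply: smooth_on_row_of_seq => //.
by move=> -[|[|[|[|[|[|[|[|[|[|//]]]]]]]]]] _ /=; exact: smooth_on_qcoord.
Qed.

Lemma smooth_on_qD (f g : V -> quat R) : smooth_on U f -> smooth_on U g ->
  smooth_on U (fun x => f x + g x).
Proof. by move=> sf sg; exact: smooth_onD. Qed.

Lemma smooth_on_qsub (f g : V -> quat R) : smooth_on U f -> smooth_on U g ->
  smooth_on U (fun x => f x - g x).
Proof.
move=> sf sg; apply: smooth_onD => //; apply: (smooth_on_eq oU (f := fun x => (-1) * g x)).
  by move=> x _; rewrite mulN1r.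
by apply: smooth_on_qmul => //; exact: smooth_on_cst.
Qed.

Lemma smooth_on_cayley w0 (w : V -> quat R) : w0 != 0 -> (forall x, U x -> w x + w0 != 0) ->
  smooth_on U w -> smooth_on U (fun x => cayley w0 (w x)).
Proof.
move=> w00 ww sw.
have s1 : smooth_on U (fun x => w0^-1 * w x) by apply: smooth_on_qmul => //; exact: smooth_on_cst.
apply: smooth_on_qmul => //; first by apply: smooth_on_qsub => //; exact: smooth_on_cst.
apply: smooth_on_qinv => //; first by move=> x Ux; apply: cayley_domain => //; exact: ww.
by apply: smooth_on_qD => //; exact: smooth_on_cst.
Qed.

Lemma smooth_on_cayley_inv w0 (v : V -> quat R) : (forall x, U x -> qcoord (v x) 0 = 0) ->
  smooth_on U v -> smooth_on U (fun x => cayley_inv w0 (v x)).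
Proof.
move=> v0 sv; apply: smooth_on_qmul => //; first exact: smooth_on_cst.
apply: smooth_on_qmul => //; first by apply: smooth_on_qD => //; exact: smooth_on_cst.
apply: smooth_on_qinv => //; first by move=> x /v0 /imag_neq[].
by apply: smooth_on_qsub => //; exact: smooth_on_cst.
Qed.

End Smooth.

Lemma open_qneq0 : open [set q : quat R | q != 0].
Proof.
have s2 : smooth_on setT (@qnorm2 R).
  by apply: smooth_on_qnorm2; [exact: openT|exact: smooth_on_id openT].
have := open_preimage_smooth openT s2 (@open_gt R 0).
rewrite (_ : _ `&` _ = [set q | q != 0]) //; apply/seteqP; split => q /=.
  by move=> [_]; rewrite /preimage /mkset lt_neqAle eq_sym qnorm2_eq0 => /andP[].
by move=> q0; split => //; rewrite /preimage /mkset lt_neqAle eq_sym qnorm2_eq0 q0 qnorm2_ge0.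
Qed.

Lemma open_qneq0_preimage (V : normedModType R) (U : set V) (f : V -> quat R) :
  open U -> smooth_on U f -> open [set x | U x /\ f x != 0].
Proof. by move=> oU sf; exact: open_preimage_smooth oU sf open_qneq0. Qed.

Lemma open_qball_preimage (V : normedModType R) (U : set V) (f : V -> quat R) :
  open U -> smooth_on U f -> open [set x | U x /\ qnorm2 (f x) < 1].
Proof.
move=> oU sf; have s2 := smooth_on_qnorm2 oU sf.
exact: open_preimage_smooth oU s2 (@open_lt R 1).
Qed.

End Rows.

(** * Coordinates on the group and on the coset space *)

Section GroupCoordinates.
Variable R : realType.
Implicit Types (p w u : quat R) (A B : sp11 R).

Local Notation quat4 := (quat R * quat R * quat R * quat R)%type.
Implicit Types x : quat4.

(** For the entries [x = (a, c, b, d)] of a matrix in Sp(1,1) these are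
    [c d^-1] in the ball, [a d^-1] and [d / |d|] in the unit sphere; the first two are
    invariant under right multiplication by Sp(1). *)
Definition ratio_cd x : quat R := x.1.1.2 * x.2^-1.
Definition ratio_ad x : quat R := x.1.1.1 * x.2^-1.
Definition phase_d x : quat R := (Num.sqrt (qnorm2 x.2))^-1 *: x.2.

(** The relations between the entries give [|d|^-2 = 1 - |c d^-1|^2] and
    [b = (c d^-1)^c a], where [x^c] is the conjugate of [x]. *)
Definition entries_of p w u : quat4 :=
  let d := (Num.sqrt (1 - qnorm2 p))^-1 *: u in (w * d, p * d, qconj p * w * d, d).

Lemma qnorm2Z (t : R) q : qnorm2 (t *: q : quat R) = t ^+ 2 * qnorm2 q.
Proof. by rewrite !qnorm2E !qcoordZ; ring. Qed.

Lemma qnorm_eq1 w : qnorm2 w = 1 -> qnorm w = 1.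
Proof. by move=> e; rewrite /qnorm e sqrtr1. Qed.

Lemma unit_neq0 w : qnorm2 w = 1 -> w != 0.
Proof. by move=> e; rewrite -qnorm2_eq0 e oner_eq0. Qed.

Lemma qnorm2V q : q != 0 -> qnorm2 (q^-1 : quat R) = (qnorm2 q)^-1.
Proof.
move=> q0; have n0 : qnorm2 q != 0 by rewrite qnorm2_eq0.
apply: (mulIf n0); rewrite -qnorm2M qmulVr // mulVf //.
by rewrite qnorm2E !qcoord_mk //= expr1n !expr0n /= !addr0.
Qed.

Lemma entries_of_exists p w u : qnorm2 p < 1 -> qnorm2 w = 1 -> qnorm2 u = 1 ->
  exists A : sp11 R, sp11_entries A = entries_of p w u.
Proof.
move=> p1 w1 u1; rewrite /entries_of; set d := _ *: u.
have p0 : 0 < 1 - qnorm2 p by rewrite subr_gt0.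
have d2 : qnorm2 d = (1 - qnorm2 p)^-1.
  by rewrite qnorm2Z u1 mulr1 exprVn sqr_sqrtr // ltW.
have dE : qnorm2 d = 1 + qnorm2 p * qnorm2 d.
  by rewrite d2; field; rewrite gt_eqF.
have hA : is_sp11 (mx2 (w * d) (p * d) (qconj p * w * d) d).
  apply: is_sp11_mx2; rewrite ?qnorm2M ?qnorm2_conj ?w1 ?mul1r ?mulr1 //.
  by rewrite !qconjM qconjK !mulrA.
exists (exist (fun M => is_true (is_sp11 M)) _ hA).
by rewrite /sp11_entries /= !mxE.
Qed.

Lemma entries_of_coords p w u : qnorm2 p < 1 -> qnorm2 u = 1 ->
  [/\ ratio_cd (entries_of p w u) = p, ratio_ad (entries_of p w u) =
    w & phase_d (entries_of p w u) = u].
Proof.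
move=> p1 u1; have p0 : 0 < 1 - qnorm2 p by rewrite subr_gt0.
have s0 : 0 < Num.sqrt (1 - qnorm2 p) by rewrite sqrtr_gt0.
have d0 : (Num.sqrt (1 - qnorm2 p))^-1 *: u != 0.
  by rewrite scaler_eq0 negb_or invr_eq0 gt_eqF //= unit_neq0.
rewrite /ratio_cd /ratio_ad /phase_d /=; split; rewrite ?mulrK //.
rewrite qnorm2Z u1 mulr1 exprVn sqr_sqrtr ?(ltW p0) // sqrtrV ?(ltW p0) // invrK.
by rewrite scalerA mulfV ?scale1r // gt_eqF.
Qed.

Lemma sp11_coords A : let x := sp11_entries A in
  [/\ qnorm2 (ratio_cd x) < 1, qnorm2 (ratio_ad x) = 1, qnorm2 (phase_d x) = 1 &
      entries_of (ratio_cd x) (ratio_ad x) (phase_d x) = x].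
Proof.
have := sp11_relations A; have := sp11_d_neq0 A; rewrite /sp11_entries.
set a := val A 0 0; set c := val A 0 1; set b := val A 1 0; set d := val A 1 1.
move=> d0 [ad bc dc acbd abcd]; set x := (a, c, b, d); rewrite /=.
have nd0 : 0 < qnorm2 d by rewrite dc ltr_wpDr // qnorm2_ge0.
have ndn : qnorm2 d != 0 by rewrite gt_eqF.
have pE : qnorm2 (ratio_cd x) = qnorm2 c / qnorm2 d by rewrite /ratio_cd qnorm2M qnorm2V.
have p1 : qnorm2 (ratio_cd x) < 1 by rewrite pE ltr_pdivrMr // mul1r dc ltrDr.
have dE : (Num.sqrt (1 - qnorm2 (ratio_cd x)))^-1 *: phase_d x = d.
  have -> : 1 - qnorm2 (ratio_cd x) = (qnorm2 d)^-1.
    by rewrite pE -[1](mulfV ndn) -mulrBl dc addrK mul1r.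
  rewrite sqrtrV ?(ltW nd0) // invrK /phase_d /= scalerA mulfV ?scale1r //.
  by rewrite gt_eqF // sqrtr_gt0.
split => //.
- by rewrite /ratio_ad qnorm2M qnorm2V //= ad mulfV.
- by rewrite /phase_d qnorm2Z /= exprVn sqr_sqrtr ?(ltW nd0) // mulVf.
rewrite /entries_of dE; have wd : ratio_ad x * d = a by rewrite /ratio_ad /= mulrVK.
have pd : ratio_cd x * d = c by rewrite /ratio_cd /= mulrVK.
have bE : qconj (ratio_cd x) * a = b.
  have cdb : qconj c * a = qconj d * b.
    by rewrite -[a]qconjK -qconjM acbd qconjM qconjK.
  have dc0 : qconj d != 0 by rewrite qconj_eq0.
  by rewrite /ratio_cd qconjM (qconjV d0) -mulrA (cdb : qconj x.1.1.2 * a = _) mulKr.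
by rewrite -(mulrA (qconj (ratio_cd x)) (ratio_ad x) d) wd pd bE.
Qed.

Lemma sp11_entries_inj : injective (@sp11_entries R).
Proof. by move=> A B [*]; exact: sp11_eq. Qed.

Definition coset_rep (C : coset_space R) : sp11 R := projT1 (cid (svalP C)).

Lemma coset_projP (C C' : coset_space R) : sval C = sval C' -> C = C'.
Proof.
by case: C C' => [C hC] [C' hC'] /= e; subst C'; congr exist; exact: Prop_irrelevance.
Qed.

Lemma coset_repK : cancel coset_rep (@coset_proj R).
Proof. by move=> C; apply: coset_projP; rewrite /coset_rep; case: cid. Qed.

Lemma coset_proj_eqP A A' :
  coset_proj A = coset_proj A' <-> exists2 B, sp1I B & A' = (A * B)%g.
Proof.
rewrite -left_coset_eqP; split=> [/(congr1 sval)|e] //.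
exact: coset_projP.
Qed.

Lemma mul_scalar_entry (M : 'M[quat R]_2) u i j : (M *m u%:M) i j = M i j * u.
Proof. by rewrite -diag_const_mx mul_mx_diag !mxE. Qed.

Definition coset_coord (C : coset_space R) : quat R * quat R :=
  let x := sp11_entries (coset_rep C) in (ratio_cd x, ratio_ad x).

Lemma coset_coordE A : coset_coord (coset_proj A) = (ratio_cd (sp11_entries A),
  ratio_ad (sp11_entries A)).
Proof.
have := coset_repK (coset_proj A); rewrite /coset_coord.
move: (coset_rep _) => A' /coset_proj_eqP[B [u u1 Bu] ->].
have u0 : u != 0 by rewrite -qnorm_eq0 u1 oner_eq0.
have d0 := sp11_d_neq0 A'.
have can y : y * u * (val A' 1 1 * u)^-1 = y * (val A' 1 1)^-1.
  by rewrite qinvM // mulrA mulrK.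
have AB i j : val (A' * B)%g i j = val A' i j * u.
  by rewrite /= Bu mul_scalar_entry.
by rewrite /ratio_cd /ratio_ad /sp11_entries /= !AB !can.
Qed.

Lemma coset_coord_inj : injective coset_coord.
Proof.
move=> C C'; rewrite -(coset_repK C) -(coset_repK C') !coset_coordE.
set A := coset_rep C; set A' := coset_rep C' => -[ep ew].
have [p1 w1 u1 sE] := sp11_coords A; have [p1' w1' u1' sE'] := sp11_coords A'.
set u := phase_d _ in u1 sE; set u' := phase_d _ in u1' sE'.
have u0 := unit_neq0 u1.
have uu : qnorm (u^-1 * u') = 1.
  by apply: qnorm_eq1; rewrite qnorm2M qnorm2V // u1 u1' invr1 mulr1.
apply/coset_proj_eqP; exists (sp1 uu); first exact: sp1I_sp1.
apply: sp11_entries_inj; rewrite -sE' -ep -ew.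
have AB i j : val (A * sp1 uu)%g i j = val A i j * (u^-1 * u').
  exact: mul_scalar_entry.
set r := (Num.sqrt (1 - qnorm2 (ratio_cd (sp11_entries A))))^-1.
have e : r *: u' = (r *: u) * (u^-1 * u') by rewrite -scalerAl mulVKr.
move: sE; rewrite /sp11_entries !AB /entries_of -/r e.
by move: (ratio_ad _) (ratio_cd _) (r *: u) (u^-1 * u') => W P D D' [<- <- <- <-]; rewrite !mulrA.
Qed.

End GroupCoordinates.

(** * The manifolds and the submersion *)

Section Manifolds.
Variable R : realType.
Implicit Types (p w u : quat R) (A B : sp11 R).

Local Notation quat4 := (quat R * quat R * quat R * quat R)%type.

Lemma finite_coordinates_quat4 : finite_coordinates quat4.
Proof. by do !apply: finite_coordinates_prod; exact: finite_coordinates_quat. Qed.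

Lemma finite_coordinates_quat2 : finite_coordinates (quat R * quat R)%type.
Proof. by do !apply: finite_coordinates_prod; exact: finite_coordinates_quat. Qed.

Lemma smooth_on_entries_of (V : normedModType R) (U : set V) (p w u : V -> quat R) : open U ->
  (forall x, U x -> qnorm2 (p x) < 1) ->
  smooth_on U p -> smooth_on U w -> smooth_on U u ->
  smooth_on U (fun x => entries_of (p x) (w x) (u x)).
Proof.
move=> oU p1 sp sw su.
have sr : smooth_on U (fun x => (Num.sqrt (1 - qnorm2 (p x)))^-1).
  have s1 : smooth_on U (fun x => 1 - qnorm2 (p x)).
    apply: smooth_onD => //; first exact: (smooth_on_cst oU (1 : R)).
    by apply: smooth_onN => //; exact: smooth_on_qnorm2.
  apply: smooth_onV => // [x Ux|].
    by rewrite gt_eqF // sqrtr_gt0 subr_gt0 p1.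
  by apply: smooth_on_sqrt => // x Ux; rewrite subr_gt0 p1.
have sd : smooth_on U (fun x => (Num.sqrt (1 - qnorm2 (p x)))^-1 *: u x).
  exact: smooth_on_scaleq.
have sc := smooth_on_qconj oU sp.
by do !apply: smooth_on_pair => //; do !apply: smooth_on_qmul => //.
Qed.

Section GroupParameters.
Variable U : set quat4.
Hypotheses (oU : open U) (U0 : forall x, U x -> x.2 != 0).

Let sd : smooth_on U (fun x => x.2).
Proof. exact: smooth_on_snd (smooth_on_id oU). Qed.

Let sdV : smooth_on U (fun x => x.2^-1).
Proof. exact: smooth_on_qinv. Qed.

Let sb : smooth_on U (fun x => x.1.1).
Proof. by apply: smooth_on_fst => //; apply: smooth_on_fst => //; exact: smooth_on_id. Qed.

Lemma smooth_on_ratio_cd : smooth_on U (@ratio_cd R).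
Proof. by apply: smooth_on_qmul => //; exact: smooth_on_snd. Qed.

Lemma smooth_on_ratio_ad : smooth_on U (@ratio_ad R).
Proof. by apply: smooth_on_qmul => //; exact: smooth_on_fst. Qed.

Lemma smooth_on_phase_d : smooth_on U (@phase_d R).
Proof.
have n0 x : U x -> 0 < qnorm2 x.2.
  by move=> Ux; rewrite lt_neqAle eq_sym qnorm2_eq0 U0 // qnorm2_ge0.
have s2 := smooth_on_qnorm2 oU sd.
apply: smooth_on_scaleq => //; apply: smooth_onV => // [x Ux|].
  by rewrite gt_eqF // sqrtr_gt0 n0.
exact: smooth_on_sqrt.
Qed.
End GroupParameters.

Definition chart_sp11 w0 u0 : chart R (sp11 R) 10 :=
  Chart [set A | ratio_ad (sp11_entries A) + w0 != 0 /\ phase_d (sp11_entries A) + u0 != 0]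
    (fun A => let x := sp11_entries A in
       row10 (ratio_cd x) (cayley w0 (ratio_ad x)) (cayley u0 (phase_d x))).

Lemma sp11_entries_d A : (sp11_entries A).2 != 0.
Proof. exact: sp11_d_neq0. Qed.

Lemma open_d_neq0 : open [set x : quat4 | x.2 != 0].
Proof.
have := open_qneq0_preimage openT (smooth_on_snd openT (smooth_on_id (V := quat4) openT)).
by rewrite (_ : [set x | setT x /\ _] = [set x : quat4 | x.2 != 0]) //; apply/seteqP;
  split => x //= [].
Qed.

Lemma row_ball_open n : open [set r : 'rV[R]_n.+1 | qnorm2 (row_p r) < 1].
Proof.
have := open_qball_preimage openT (smooth_on_row_p openT (smooth_on_id (V := 'rV[R]_n.+1) openT)).
by rewrite (_ : [set x | setT x /\ _] = [set r : 'rV[R]_n.+1 | qnorm2 (row_p r) < 1]) //;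
  apply/seteqP; split => x //= [].
Qed.

Lemma chart_sp11_euclidean w0 u0 : qnorm2 w0 = 1 -> qnorm2 u0 = 1 ->
  euclidean_chart (@sp11_entries R) (chart_sp11 w0 u0).
Proof.
move=> w01 u01; have w00 := unit_neq0 w01; have u00 := unit_neq0 u01.
have w0n := qnorm_eq1 w01; have u0n := qnorm_eq1 u01.
pose S (r : 'rV[R]_10) := entries_of (row_p r) (cayley_inv w0 (row_v r)) (cayley_inv u0
  (row_w r)).
pose c := chart_sp11 w0 u0.
have qn2 v : qnorm v = 1 -> qnorm2 v = 1 :> R.
  by move=> h; rewrite -[qnorm2 v]sqr_sqrtr ?qnorm2_ge0 // -/(qnorm v) h expr1n.
have SE A : chart_dom c A -> S (c A) = sp11_entries A.
  move=> [/= wA uA]; have [p1 w1 u1 sE] := sp11_coords A.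
  rewrite /S row10_p row10_v ?row10_w; last first.
  - by apply: cayley_imag => //; exact: qnorm_eq1.
  - by apply: cayley_imag => //; exact: qnorm_eq1.
  by rewrite !cayleyK.
have SI r : qnorm2 (row_p r) < 1 -> exists2 A, chart_dom c A & c A = r.
  move=> p1.
  have v1 := qn2 _ (qnorm_cayley_inv w0n (row_v_imag r)).
  have u1 := qn2 _ (qnorm_cayley_inv u0n (row_w_imag r)).
  have [A AE] := entries_of_exists p1 v1 u1.
  have [pE wE uE] := entries_of_coords (cayley_inv w0 (row_v r)) p1 u1.
  exists A; rewrite /= AE wE uE.
    by split; apply: cayley_inv_domain; rewrite ?row_v_imag ?row_w_imag.
  by rewrite pE !cayley_invK ?row_v_imag ?row_w_imag // row10K.
have cI : c @` chart_dom c = [set r | qnorm2 (row_p r) < 1].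
  apply/seteqP; split => [_ [A cA <-]|r /SI[A cA <-]]; last by exists A.
  by rewrite /= row10_p; have [] := sp11_coords A.
have oI : open (c @` chart_dom c) by rewrite cI; exact: row_ball_open.
pose O0 := [set x : quat4 | x.2 != 0].
have oO0 : open O0 := open_d_neq0.
have O00 x : O0 x -> x.2 != 0 by [].
have sw0 : smooth_on O0 (fun x => ratio_ad x + w0).
  by apply: smooth_onD => //; [exact: smooth_on_ratio_ad|exact: smooth_on_cst].
pose O1 := [set x | O0 x /\ ratio_ad x + w0 != 0].
have oO1 : open O1 by exact: open_qneq0_preimage.
have O10 x : O1 x -> x.2 != 0 by case.
have su0 : smooth_on O1 (fun x => phase_d x + u0).
  by apply: smooth_onD => //; [exact: smooth_on_phase_d|exact: smooth_on_cst].
pose O2 := [set x | O1 x /\ phase_d x + u0 != 0].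
have oO2 : open O2 by exact: open_qneq0_preimage.
have O20 x : O2 x -> x.2 != 0 by case=> /O10.
have domE : chart_dom c = @sp11_entries R @^-1` O2.
  apply/seteqP; split => A /=; last by case=> -[].
  by move=> [wA uA]; do !split => //; exact: sp11_entries_d.
split.
- by exists O2.
- split => // A B /set_mem cA /set_mem cB cAB; apply: sp11_entries_inj.
  by rewrite -(SE A cA) -(SE B cB) cAB.
- exists S; last exact: SE.
  rewrite -/c cI; have oB := @row_ball_open 9.
  apply: smooth_on_entries_of => //.
  + by apply: smooth_on_row_p => //; exact: smooth_on_id.
  + apply: smooth_on_cayley_inv => //; first by move=> x _; exact: row_v_imag.
    by apply: smooth_on_row_v => //; exact: smooth_on_id.
  + apply: smooth_on_cayley_inv => //; first by move=> x _; exact: row_w_imag.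
    by apply: smooth_on_row_w => //; exact: smooth_on_id.
- move=> A cA; exists O2, (fun x => row10 (ratio_cd x) (cayley w0 (ratio_ad x)) (cayley u0
  (phase_d x))).
  split => //; first by move: cA; rewrite -/c domE.
  apply: smooth_on_row10 => //; first exact: smooth_on_ratio_cd.
    by apply: smooth_on_cayley => //; [move=> x [[]]|exact: smooth_on_ratio_ad].
  by apply: smooth_on_cayley => //; [move=> x []|exact: smooth_on_phase_d].
Qed.

(** The chart centred at [w] has [w] in its domain. *)
Lemma unit_add_self_neq0 w : qnorm2 w = 1 -> w + w != 0.
Proof. by move=> w1; rewrite -q2E qmul_eq0 negb_or q2_neq0 unit_neq0. Qed.

Lemma sp11_manifold : exists2 G : manifold R (sp11 R), mdim G = 10%N & lie_structure G.
Proof.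
apply: embedded_manifold.
- exact: finite_coordinates_quat4.
- exact: sp11_entries_inj.
move=> A; have [_ w1 u1 _] := sp11_coords A.
exists (chart_sp11 (ratio_ad (sp11_entries A)) (phase_d (sp11_entries A))).
  exact: chart_sp11_euclidean.
by split; exact: unit_add_self_neq0.
Qed.

Definition chart_coset w0 : chart R (coset_space R) 7 :=
  Chart [set C | (coset_coord C).2 + w0 != 0]
    (fun C => row7 (coset_coord C).1 (cayley w0 (coset_coord C).2)).

Lemma coset_coord_unit C : qnorm2 (coset_coord C).1 < 1 /\ qnorm2 (coset_coord C : quat R *
  quat R).2 = 1.
Proof. by have [] := sp11_coords (coset_rep C). Qed.

Lemma qnorm2_1 : qnorm2 (1 : quat R) = 1.
Proof. by rewrite qnorm2E !qcoord_mk //= expr1n !expr0n /= !addr0. Qed.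

Lemma chart_coset_euclidean w0 : qnorm2 w0 = 1 ->
  euclidean_chart (@coset_coord R) (chart_coset w0).
Proof.
move=> w01; have w00 := unit_neq0 w01; have w0n := qnorm_eq1 w01.
pose S (r : 'rV[R]_7) := (row_p r, cayley_inv w0 (row_v r)).
pose c := chart_coset w0.
have qn2 v : qnorm v = 1 -> qnorm2 v = 1 :> R.
  by move=> h; rewrite -[qnorm2 v]sqr_sqrtr ?qnorm2_ge0 // -/(qnorm v) h expr1n.
have SE C : chart_dom c C -> S (c C) = coset_coord C.
  move=> /= wC; have [p1 w1] := coset_coord_unit C.
  rewrite /S row7_p row7_v; last by apply: cayley_imag => //; exact: qnorm_eq1.
  by rewrite cayleyK // -surjective_pairing.
have SI r : qnorm2 (row_p r) < 1 -> exists2 C, chart_dom c C & c C = r.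
  move=> p1; have v1 := qn2 _ (qnorm_cayley_inv w0n (row_v_imag r)).
  have [A AE] := entries_of_exists p1 v1 qnorm2_1.
  have [pE wE _] := entries_of_coords (cayley_inv w0 (row_v r)) p1 qnorm2_1.
  have cE := coset_coordE A; rewrite AE pE wE in cE.
  exists (coset_proj A).
    rewrite -[chart_dom _ _]/(is_true ((coset_coord (coset_proj A)).2 + w0 != 0)) cE.
    by apply: cayley_inv_domain; rewrite ?row_v_imag.
  rewrite -[LHS]/(row7 (coset_coord (coset_proj A)).1 (cayley w0 (coset_coord (coset_proj A)).2)).
  by rewrite cE cayley_invK ?row_v_imag // row7K.
have cI : c @` chart_dom c = [set r | qnorm2 (row_p r) < 1].
  apply/seteqP; split => [_ [C cC <-]|r /SI[C cC <-]]; last by exists C.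
  by rewrite /= row7_p; have [] := coset_coord_unit C.
have oI : open (c @` chart_dom c) by rewrite cI; exact: row_ball_open.
have sid := smooth_on_id (V := (quat R * quat R)%type) openT.
pose O := [set x : quat R * quat R | setT x /\ x.2 + w0 != 0].
have oO : open O.
  apply: open_qneq0_preimage; first exact: openT.
  have s2 := smooth_on_snd openT sid.
  exact: (smooth_on_qD openT s2 (smooth_on_cst openT w0)).
have sO := smooth_on_id oO.
split.
- by exists O => //; apply/seteqP; split => C //= [].
- split => // C C' /set_mem cC /set_mem cC' cCC; apply: coset_coord_inj.
  by rewrite -(SE C cC) -(SE C' cC') cCC.
- exists S; last exact: SE.
  rewrite -/c cI; have oB := @row_ball_open 6.
  apply: smooth_on_pair => //.
    by apply: smooth_on_row_p => //; exact: smooth_on_id.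
  apply: smooth_on_cayley_inv => //; first by move=> x _; exact: row_v_imag.
  by apply: smooth_on_row_v => //; exact: smooth_on_id.
- move=> C cC; exists O, (fun x => row7 x.1 (cayley w0 x.2)); split => //.
  apply: smooth_on_row7 => //; first exact: smooth_on_fst.
  by apply: smooth_on_cayley => //; [move=> x []|exact: smooth_on_snd].
Qed.

Lemma coset_manifold :
  exists2 Q : manifold R (coset_space R), mdim Q = 7%N & submanifold (@coset_coord R) Q.
Proof.
apply: embedded_manifold.
- exact: finite_coordinates_quat2.
- exact: coset_coord_inj.
move=> C; have [_ w1] := coset_coord_unit C.
exists (chart_coset (coset_coord C).2); first exact: chart_coset_euclidean.
exact: unit_add_self_neq0.
Qed.

Section Projection.
Variables (G : manifold R (sp11 R)) (Q : manifold R (coset_space R)).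
Hypotheses (lG : lie_structure G) (sQ : submanifold (@coset_coord R) Q).

Lemma coset_proj_smooth : smooth_map G Q (@coset_proj R).
Proof.
have oO := open_d_neq0.
apply: (embedded_smooth_map finite_coordinates_quat4 finite_coordinates_quat2 lG sQ
  (F := fun x => (ratio_cd x, ratio_ad x)) oO) => //.
- exact: sp11_entries_d.
- by apply: smooth_on_pair => //; [exact: smooth_on_ratio_cd|exact: smooth_on_ratio_ad].
- by move=> A; rewrite coset_coordE.
Qed.

(** Cosets are parametrised by the first two coordinates, so fixing the
    third one, [d / |d|], to its value at [A] gives a smooth global section through
    [A]. *)
Lemma coset_section A : exists s : coset_space R -> sp11 R,
  [/\ smooth_map Q G s, cancel s (@coset_proj R) & s (coset_proj A) = A].
Proof.
have [_ _ u1 AE] := sp11_coords A; set u := phase_d _ in u1 AE.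
have hs (C : coset_space R) : exists B : sp11 R,
    sp11_entries B = entries_of (coset_coord C).1 (coset_coord C).2 u.
  by have [p1 w1] := coset_coord_unit C; exact: entries_of_exists.
have [s sE] := choice hs; exists s; split.
- have sid := smooth_on_id (V := (quat R * quat R)%type) openT.
  pose O := [set x : quat R * quat R | setT x /\ qnorm2 x.1 < 1].
  have oO : open O.
    have s1 := smooth_on_fst openT sid.
    exact: (open_qball_preimage openT s1).
  have sO := smooth_on_id oO.
  apply: (embedded_smooth_map finite_coordinates_quat2 finite_coordinates_quat4 sQ lG
    (F := fun x => entries_of x.1 x.2 u) oO) => //.
  + by move=> C; have [] := coset_coord_unit C.
  + apply: smooth_on_entries_of => //; [by move=> x []|exact: smooth_on_fst|exact:
    smooth_on_snd|].
    exact: smooth_on_cst.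
- move=> C; apply: coset_coord_inj; rewrite coset_coordE sE.
  have [p1 w1] := coset_coord_unit C.
  by have [-> -> _] := entries_of_coords (coset_coord C).2 p1 u1; rewrite -surjective_pairing.
- by apply: sp11_entries_inj; rewrite sE coset_coordE.
Qed.

Lemma coset_proj_submersion : submersion G Q (@coset_proj R).
Proof.
apply: submersion_of_sections; first exact: coset_proj_smooth.
by move=> A; exact: coset_section.
Qed.

End Projection.

Lemma coset_mdim (G : manifold R (sp11 R)) (Q : manifold R (coset_space R)) :
  lie_structure G -> submersion G Q (@coset_proj R) -> mdim Q = 7%N.
Proof.
move=> lG subm; have [Q0 <- sQ0] := coset_manifold.
have [s [ss sK _]] := coset_section lG sQ0 1%g.
exact: (submersion_mdim (coset_proj 1%g) subm (coset_proj_smooth lG sQ0) ss sK).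
Qed.

(** * The bijection *)

Definition mobius_self A : ball1 R -> ball1 R := fun q =>
  exist (fun q => is_true (qnorm q < 1)) (mobius A (sval q)) (mobius_ball A (svalP q)).

Definition mobius_point A : mobius_set R :=
  exist _ (mobius_self A) (ex_intro _ A (fun=> erefl)).

Definition mobius_of_coset (C : coset_space R) : mobius_set R :=
  mobius_point (coset_rep C)^-1%g.

Lemma mobius_set_eq (F F' : mobius_set R) :
  (forall q, sval (sval F q) = sval (sval F' q)) -> F = F'.
Proof.
case: F F' => [F hF] [F' hF'] /= FF'.
have e : F = F' by apply/funext => q; apply: val_inj; exact: FF'.
by subst F'; congr exist; exact: Prop_irrelevance.
Qed.

Lemma mobius_of_cosetE A : mobius_of_coset (coset_proj A) = mobius_point A^-1%g.
Proof.
have := coset_repK (coset_proj A); rewrite /mobius_of_coset.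
move: (coset_rep _) => A' /coset_proj_eqP[B hB ->].
apply: mobius_set_eq => q /=; rewrite invgM mobius_sp1I //; exact: sp1IV.
Qed.

Lemma mobius_of_coset_bij : bijective mobius_of_coset.
Proof.
have inj : injective mobius_of_coset.
  move=> C C'; rewrite -(coset_repK C) -(coset_repK C') !mobius_of_cosetE => e.
  have [q q1|B hB BE] := @mobius_inj R (coset_rep C)^-1%g (coset_rep C')^-1%g.
    by have := congr1 (fun F : mobius_set R => sval (sval F (exist _ q q1))) e.
  apply/coset_proj_eqP; exists (B^-1)%g; first exact: sp1IV.
  by rewrite -[coset_rep C']invgK BE invgM invgK.
have surj F : exists C, mobius_of_coset C = F.
  case: F => F [A FA]; exists (coset_proj A^-1%g); rewrite mobius_of_cosetE invgK.
  by apply: mobius_set_eq => q /=; rewrite FA.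
have [h hK] := choice surj.
by exists h => // C; apply: inj; rewrite hK.
Qed.

End Manifolds.

Local Close Scope ring_scope.
Local Close Scope classical_set_scope.

Theorem theorem4p1p1 (R : realType) :
  exists Phi : coset_space R -> mobius_set R,
  [/\ (forall (A : sp11 R) (q : ball1 R),
         sval (sval (Phi (coset_proj A)) q) = mobius (A^-1)%g (sval q)),
      bijective Phi,
      (exists (G : manifold R (sp11 R)) (Q : manifold R (coset_space R)),
         lie_structure G /\ submersion G Q (@coset_proj R)) &
      (forall (G : manifold R (sp11 R)) (Q : manifold R (coset_space R)),
         lie_structure G -> submersion G Q (@coset_proj R) ->
         (exists! M : manifold R (mobius_set R), diffeomorphism Q M Phi) /\
         (forall M : manifold R (mobius_set R),
            diffeomorphism Q M Phi -> mdim M = 7))].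
Proof.
exists (@mobius_of_coset R); split.
- by move=> A q; rewrite mobius_of_cosetE.
- exact: mobius_of_coset_bij.
- have [G _ lG] := sp11_manifold R; have [Q _ sQ] := coset_manifold R.
  by exists G, Q; split => //; exact: coset_proj_submersion.
move=> G Q lG subm.
have dimQ (M : manifold R (mobius_set R)) : diffeomorphism Q M (@mobius_of_coset R) ->
  mdim M = mdim Q.
  by move=> dM; rewrite (diffeomorphism_mdim (coset_proj 1%g) dM).
split; last by move=> M dM; rewrite (dimQ M dM) (coset_mdim lG subm).
have [h fK hK] := mobius_of_coset_bij R.
have [T [e TE]] := transported_manifold fK hK Q.
exists T; split; first exact: transported_diffeomorphism TE.
by move=> M dM; apply: (diffeomorphism_unique fK hK TE _ dM); exact: dimQ.
Qed.
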